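(* For each $\ell\ge 0$ there are isomorphisms of $U_q(gl_2(\mathbb{C}))$-modules $$S^3_\sigma V_\ell\cong \begin{cases}\bigoplus\limits_{0\le i\le \frac{\ell-1}{2}} V_{(3\ell -2i,2i)} & \text{if $\ell$ is odd}\\ \bigoplus\limits_{0\le i\le \frac{3\ell}{4}} V_{(3\ell -2i,2i)} & \text{if $\ell$ is even}\end{cases}$$ and $$\Lambda_\sigma^3 V_\ell \cong \begin{cases}0 & \text{if $\ell$ is odd}\\ \bigoplus\limits_{\frac{\ell}{2}\le i\le \frac{3\ell-2}{4}} V_{(3\ell -2i-1,2i+1)} & \text{if $\ell$ is even,}\end{cases}$$ where $i$ runs over integers in the indicated ranges, $V_\ell=V_{(\ell,0)}$, and $S^3_\sigma$, $\Lambda^3_\sigma$ denote the braided symmetric and exterior cubes.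
   Context: $U_q(gl_2(\mathbb{C}))$ is the $\mathbb{C}(q)$-algebra generated by $E,F,K_\lambda$ ($\lambda\in\mathbb{Z}^2$) with $K_\lambda K_\mu=K_{\lambda+\mu}$, $K_0=1$, $K_\lambda E=q^{(\alpha|\lambda)}EK_\lambda$, $K_\lambda F=q^{-(\alpha|\lambda)}FK_\lambda$, $EF-FE=\frac{K_\alpha-K_{-\alpha}}{q-q^{-1}}$, where $\alpha=(1,-1)$ and $(\cdot|\cdot)$ is the standard inner product on $\mathbb{Z}^2$; coproduct $\Delta(E)=E\otimes1+K_\alpha\otimes E$, $\Delta(F)=F\otimes K_{-\alpha}+1\otimes F$, $\Delta(K_\lambda)=K_\lambda\otimes K_\lambda$. $\mathcal{O}_f$ is the category of finite-dimensional modules $V=\bigoplus_{\mu\in\mathbb{Z}^2}V(\mu)$ with $K_\lambda$ acting on $V(\mu)$ by $q^{(\lambda|\mu)}$. Simple objects are $V_{(\lambda_1,\lambda_2)}$, $\lambda_1\ge\lambda_2$ integers, of dimension $\lambda_1-\lambda_2+1$; $V_\ell:=V_{(\ell,0)}$. The braiding is $\mathcal{R}_{U,V}=\tau\circ R:U\otimes V\to V\otimes U$, $\tau$ the permutation of factors, $R=R_0R_1$ the universal $R$-matrix ($R\Delta=\Delta^{op}R$), with $R_0(u\otimes v)=q^{(\lambda|\mu)}u\otimes v$ on weight vectors of weights $\lambda,\mu$ and $R_1\in1\otimes1+\widehat{\bigoplus}_{k\ge1}\mathbb{C}(q)F^k\otimes E^k$. For $V$ in $\mathcal{O}_f$, $\mathcal{R}_{V,V}$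 is diagonalizable with eigenvalues $\pm q^k$, $k\in\mathbb{Z}$; $S^2_\sigma V$ (resp. $\Lambda^2_\sigma V$) is the span in $V\otimes V$ of eigenvectors with eigenvalues of the form $+q^k$ (resp. $-q^k$). Then $S^3_\sigma V=(S^2_\sigma V\otimes V)\cap(V\otimes S^2_\sigma V)$ and $\Lambda^3_\sigma V=(\Lambda^2_\sigma V\otimes V)\cap(V\otimes\Lambda^2_\sigma V)$ inside $V^{\otimes3}$. (Equivalently, $S^2_\sigma V_\ell$, resp. $\Lambda^2_\sigma V_\ell$, is the sum of the submodules of $V_\ell\otimes V_\ell$ isomorphic to $V_{(2\ell-m,m)}$ with $m$ even, resp. odd, $0\le m\le\ell$.) *)

(* Defs.v *)
From mathcomp Require Import all_boot all_order all_algebra.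
From mathcomp Require Import ring.
From mathcomp Require Import boolp reals.
From mathcomp.real_closed Require Import mxtens complex.

Set Implicit Arguments.
Unset Strict Implicit.
Unset Printing Implicit Defensive.

Import Order.TTheory GRing.Theory Num.Theory.
Local Open Scope ring_scope.

Notation weight := (int * int)%type.

Definition wip (lam mu : weight) : int := lam.1 * mu.1 + lam.2 * mu.2.

Definition alpha : weight := (1, -1).

Section QuantumGL2.
Variables (K : fieldType) (q : K).

(* A finite-dimensional U_q(gl_2)-module, written in a basis: the module is    *)
(* the space of column vectors 'cV_(udim M), on which the generators E, F and  *)
(* K_lam act by left multiplication by matrices satisfying the defining        *)
(* relations of U_q(gl_2).                                                     *)
Record uqmod := UqMod {
  udim : nat;
  actE : 'M[K]_udim;
  actF : 'M[K]_udim;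
  actK : weight -> 'M[K]_udim;
  actKD : forall lam mu, actK lam *m actK mu = actK (lam + mu);
  actK0 : actK 0 = 1%:M;
  actKE : forall lam,
    actK lam *m actE = q ^ wip alpha lam *: (actE *m actK lam);
  actKF : forall lam,
    actK lam *m actF = q ^ (- wip alpha lam) *: (actF *m actK lam);
  actEF : actE *m actF - actF *m actE =
    (q - q^-1)^-1 *: (actK alpha - actK (- alpha))
}.

Definition lspan n (P : 'cV[K]_n -> Prop) (x : 'cV[K]_n) : Prop :=
  exists s : seq (K * 'cV[K]_n),
    (forall y, y \in s -> P y.2) /\ x = \sum_(y <- s) y.1 *: y.2.

Definition weight_vector (M : uqmod) (mu : weight) (v : 'cV[K]_(udim M)) :=
  forall lam, actK M lam *m v = q ^ wip lam mu *: v.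
Arguments weight_vector : clear implicits.

(* Category O_f: M is the sum of its weight spaces M(mu).  The sum is          *)
(* automatically direct when q is not a root of unity.                         *)
Definition in_Of (M : uqmod) : Prop :=
  forall v, lspan (fun x => exists mu, weight_vector M mu x) v.

Lemma zero_mod_subproof (A B : 'M[K]_0) : A = B.
Proof. by rewrite (flatmx0 A) (flatmx0 B). Qed.

Definition zero_mod : uqmod :=
  @UqMod 0 0 0 (fun=> 0)
    (fun _ _ => zero_mod_subproof _ _) (zero_mod_subproof _ _)
    (fun=> zero_mod_subproof _ _) (fun=> zero_mod_subproof _ _)
    (zero_mod_subproof _ _).

Section DirectSum.
Variables U V : uqmod.
Let bd (A : 'M[K]_(udim U)) (B : 'M[K]_(udim V)) := block_mx A 0 0 B.

Let bdM A B A' B' : bd A B *m bd A' B' = bd (A *m A') (B *m B').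
Proof.
by rewrite /bd mulmx_block !mulmx0 !mul0mx !addr0 !add0r.
Qed.

Let bdZ c A B : c *: bd A B = bd (c *: A) (c *: B).
Proof. by rewrite /bd scale_block_mx !scaler0. Qed.

Let bdB A B A' B' : bd A B - bd A' B' = bd (A - A') (B - B').
Proof. by rewrite /bd opp_block_mx add_block_mx !subr0. Qed.

Fact dsum_KD lam mu :
  bd (actK U lam) (actK V lam) *m bd (actK U mu) (actK V mu) =
  bd (actK U (lam + mu)) (actK V (lam + mu)).
Proof. by rewrite bdM !actKD. Qed.

Fact dsum_K0 : bd (actK U 0) (actK V 0) = 1%:M.
Proof. by rewrite !actK0 /bd -scalar_mx_block. Qed.

Fact dsum_KE lam :
  bd (actK U lam) (actK V lam) *m bd (actE U) (actE V) =
  q ^ wip alpha lam *: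
    (bd (actE U) (actE V) *m bd (actK U lam) (actK V lam)).
Proof. by rewrite !bdM bdZ !actKE. Qed.

Fact dsum_KF lam :
  bd (actK U lam) (actK V lam) *m bd (actF U) (actF V) =
  q ^ (- wip alpha lam) *:
    (bd (actF U) (actF V) *m bd (actK U lam) (actK V lam)).
Proof. by rewrite !bdM bdZ !actKF. Qed.

Fact dsum_EF :
  bd (actE U) (actE V) *m bd (actF U) (actF V)
    - bd (actF U) (actF V) *m bd (actE U) (actE V) =
  (q - q^-1)^-1 *: (bd (actK U alpha) (actK V alpha)
    - bd (actK U (- alpha)) (actK V (- alpha))).
Proof. by rewrite !bdM !bdB bdZ !actEF. Qed.

Definition dsum : uqmod := UqMod dsum_KD dsum_K0 dsum_KE dsum_KF dsum_EF.

End DirectSum.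

Section TensLinear.
Variables m n p r : nat.
Implicit Types (A : 'M[K]_(m, n)) (B : 'M[K]_(p, r)).

Lemma tensDl A A' B : (A + A') *t B = A *t B + A' *t B.
Proof. by apply/matrixP=> i j; rewrite !mxE mulrDl. Qed.

Lemma tensDr A B B' : A *t (B + B') = A *t B + A *t B'.
Proof. by apply/matrixP=> i j; rewrite !mxE mulrDr. Qed.

Lemma tensZl c A B : (c *: A) *t B = c *: (A *t B).
Proof. by apply/matrixP=> i j; rewrite !mxE mulrA. Qed.

Lemma tensZr c A B : A *t (c *: B) = c *: (A *t B).
Proof. by apply/matrixP=> i j; rewrite !mxE mulrCA. Qed.

Lemma tensBl A A' B : (A - A') *t B = A *t B - A' *t B.
Proof. by apply/matrixP=> i j; rewrite !mxE mulrBl. Qed.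

Lemma tensBr A B B' : A *t (B - B') = A *t B - A *t B'.
Proof. by apply/matrixP=> i j; rewrite !mxE mulrBr. Qed.

End TensLinear.

Lemma tens11 m n : (1%:M : 'M[K]_m) *t (1%:M : 'M[K]_n) = 1%:M.
Proof.
apply/matrixP=> i j; case: (mxtens_indexP i) => a b.
case: (mxtens_indexP j) => c d; rewrite tensmxE !mxE.
rewrite (can_eq (@mxtens_indexK m n)) xpair_eqE.
by case: eqP => _ /=; rewrite ?mul0r // mul1r.
Qed.

Section Tensor.
Variables U V : uqmod.

Definition tensK lam := actK U lam *t actK V lam.

(* Delta(E) = E (x) 1 + K_alpha (x) E, Delta(F) = F (x) K_{-alpha} + 1 (x) F *)
Definition tensE : 'M[K]_(udim U * udim V) :=
  actE U *t 1%:M + actK U alpha *t actE V.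
Definition tensF : 'M[K]_(udim U * udim V) :=
  actF U *t actK V (- alpha) + 1%:M *t actF V.

(* the images of E and F under the opposite coproduct *)
Definition tensE_op : 'M[K]_(udim U * udim V) :=
  1%:M *t actE V + actE U *t actK V alpha.
Definition tensF_op : 'M[K]_(udim U * udim V) :=
  actK U (- alpha) *t actF V + actF U *t 1%:M.

Lemma actKC (M : uqmod) lam mu : actK M lam *m actK M mu = actK M mu *m actK M lam.
Proof. by rewrite !actKD addrC. Qed.

Fact tens_KD lam mu : tensK lam *m tensK mu = tensK (lam + mu).
Proof. by rewrite tensmx_mul !actKD. Qed.

Fact tens_K0 : tensK 0 = 1%:M.
Proof. by rewrite /tensK !actK0 tens11. Qed.

Fact tens_KE lam : tensK lam *m tensE = q ^ wip alpha lam *: (tensE *m tensK lam).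
Proof.
rewrite /tensE mulmxDr mulmxDl !tensmx_mul !actKE mulmx1 mul1mx.
by rewrite tensZl tensZr (actKC _ lam alpha) scalerDr.
Qed.

Fact tens_KF lam :
  tensK lam *m tensF = q ^ (- wip alpha lam) *: (tensF *m tensK lam).
Proof.
rewrite /tensF mulmxDr mulmxDl !tensmx_mul !actKF mulmx1 mul1mx.
by rewrite tensZl tensZr (actKC _ lam (- alpha)) scalerDr.
Qed.

Lemma wip_aa : wip alpha alpha = 2. Proof. by []. Qed.
Lemma wip_aNa : wip alpha (- alpha) = - 2. Proof. by []. Qed.

Fact tens_EF :
  tensE *m tensF - tensF *m tensE =
  (q - q^-1)^-1 *: (tensK alpha - tensK (- alpha)).
Proof.
have XF : (actK U alpha *m actF U) *t (actE V *m actK V (- alpha)) =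
          (actF U *m actK U alpha) *t (actK V (- alpha) *m actE V).
  rewrite actKF actKE wip_aa wip_aNa tensZl tensZr.
  by [].
rewrite /tensE /tensF !mulmxDr !mulmxDl !tensmx_mul !mulmx1 !mul1mx XF.
set a := (_ *m _) *t actK V _; set b := _ *t (actK V _ *m _).
set c := (_ *t actF V); set d := _ *t (_ *m actF V).
set e := (_ *m _) *t actK V _; set f := _ *t (_ *m _).
have -> : a + b + (c + d) - (e + c + (b + f)) = (a - e) + (d - f).
  by move: a b c d e f => a b c d e f; apply/matrixP=> i j; rewrite !mxE; ring.
rewrite /a /e /d /f -tensBl -tensBr !actEF tensZl tensZr -scalerDr.
by congr (_ *: _); rewrite tensBl tensBr addrC addrA subrK.
Qed.

Definition tens : uqmod := UqMod tens_KD tens_K0 tens_KE tens_KF tens_EF.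

End Tensor.


Definition qint (n : int) : K := (q ^ n - q ^ (- n)) / (q - q^-1).

Section Simple.
Hypothesis q_neq0 : q != 0.
Variable lam : weight.

(* The simple module V_lam of highest weight lam, for lam_1 >= lam_2; the       *)
(* construction is not meant for other lam.                                    *)
Let d : nat := `|lam.1 - lam.2|%N.

(* The basis v_0, ..., v_d has weights lam - i alpha, with                     *)
(* E v_i = [d-i+1] v_(i-1) and F v_i = [i+1] v_(i+1).                          *)
Definition simple_weight (i : nat) : weight :=
  (lam.2 + d%:Z - i%:Z, lam.2 + i%:Z).
Definition simpleE : 'M[K]_d.+1 :=
  \matrix_(i, j) if j == i.+1 :> nat then qint (d%:Z - i%:Z) else 0.
Definition simpleF : 'M[K]_d.+1 :=
  \matrix_(i, j) if i == j.+1 :> nat then qint i%:Z else 0.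
Definition simpleK (mu : weight) : 'M[K]_d.+1 :=
  diag_mx (\row_i q ^ wip mu (simple_weight i)).

Lemma wipDl (mu nu x : weight) : wip (mu + nu) x = wip mu x + wip nu x.
Proof. by rewrite /wip /=; ring. Qed.

Lemma wipNl (mu x : weight) : wip (- mu) x = - wip mu x.
Proof. by rewrite /wip /=; ring. Qed.

Lemma wipDr (mu nu x : weight) : wip x (mu + nu) = wip x mu + wip x nu.
Proof. by rewrite /wip /=; ring. Qed.

Lemma wipNr (mu x : weight) : wip x (- mu) = - wip x mu.
Proof. by rewrite /wip /=; ring. Qed.

Lemma wipC (mu x : weight) : wip x mu = wip mu x.
Proof. by rewrite /wip /=; ring. Qed.

Lemma simple_weightS i : simple_weight i.+1 = simple_weight i - alpha.
Proof. by congr (_, _); rewrite /= -[in LHS]addn1 PoszD; ring. Qed.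

Fact simple_KD mu nu : simpleK mu *m simpleK nu = simpleK (mu + nu).
Proof.
rewrite mulmx_diag; congr diag_mx; apply/rowP=> i; rewrite !mxE.
by rewrite wipDl (expfzDr _ _ q_neq0).
Qed.

Fact simple_K0 : simpleK 0 = 1%:M.
Proof.
rewrite -[RHS]diag_const_mx; congr diag_mx; apply/rowP=> i; rewrite !mxE.
by rewrite /wip /= !mul0r addr0 expr0z.
Qed.

Fact simple_KE mu :
  simpleK mu *m simpleE = q ^ wip alpha mu *: (simpleE *m simpleK mu).
Proof.
rewrite mul_diag_mx mul_mx_diag; apply/matrixP=> i j; rewrite !mxE.
case: eqP => [->|_]; last by rewrite mul0r !mulr0.
rewrite simple_weightS wipDr wipNr (wipC alpha mu).
move: (wip mu _) (wip alpha mu) => x y; rewrite (expfzDr _ _ q_neq0).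
have := expfzDr y (- y) q_neq0; rewrite subrr expr0z => /esym e.
by move: (q ^ y) (q ^ (- y)) (q ^ x) (qint _) e => a b c h e; ring: e.
Qed.

Fact simple_KF mu :
  simpleK mu *m simpleF = q ^ (- wip alpha mu) *: (simpleF *m simpleK mu).
Proof.
rewrite mul_diag_mx mul_mx_diag; apply/matrixP=> i j; rewrite !mxE.
case: eqP => [->|_]; last by rewrite mul0r !mulr0.
rewrite simple_weightS wipDr wipNr (wipC alpha mu).
move: (wip mu _) (wip alpha mu) => x y; rewrite (expfzDr _ _ q_neq0).
have := expfzDr y (- y) q_neq0; rewrite subrr expr0z => /esym e.
by move: (q ^ y) (q ^ (- y)) (q ^ x) (qint _) e => a b c h e; ring: e.
Qed.

Lemma simple_EF_entry i j :
  (simpleE *m simpleF) i j =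
  (i == j)%:R * (qint (d%:Z - i%:Z) * qint (i%:Z + 1)).
Proof.
rewrite mxE; have [ltid|leid] := ltnP i.+1 d.+1; last first.
  have ->: i = d :> nat by apply/eqP; rewrite eqn_leq -ltnS ltn_ord.
  rewrite subrr /qint !expr0z subrr !mul0r mulr0 big1 // => h _.
  rewrite !mxE; case: eqP => [hE|_]; last by rewrite mul0r.
  by move: (ltn_ord h); rewrite hE ltnNge leid.
rewrite (bigD1 (Ordinal ltid)) //= big1 ?addr0 => [|h neq]; last first.
  rewrite !mxE; case: eqP => [hE|_]; last by rewrite mul0r.
  by case/eqP: neq; apply: val_inj.
rewrite !mxE /= eqxx eqSS -[i == j]val_eqE /=.
by case: eqP => _; rewrite ?mulr0 ?mul0r // mul1r -[i.+1]addn1 PoszD.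
Qed.

Lemma simple_FE_entry i j :
  (simpleF *m simpleE) i j =
  (i == j)%:R * (qint i%:Z * qint (d%:Z - i%:Z + 1)).
Proof.
rewrite mxE; case: (posnP i) => [i0|ipos].
  rewrite i0 /qint !expr0z subrr !mul0r mulr0 big1 // => h _.
  by rewrite !mxE i0 /= mul0r.
have lti : (i.-1 < d.+1)%N by apply: leq_ltn_trans (ltn_ord i); apply: leq_pred.
rewrite (bigD1 (Ordinal lti)) //= big1 ?addr0 => [|h neq]; last first.
  rewrite !mxE; case: eqP => [hE|_]; last by rewrite mul0r.
  by case/eqP: neq; apply: val_inj; rewrite /= hE.
rewrite !mxE /= prednK // eqxx eq_sym -[i == j]val_eqE /=.
case: eqP => _; rewrite ?mulr0 ?mul0r // mul1r.
congr (_ * qint _); case: (nat_of_ord i) ipos => // n _.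
by rewrite /= intS; ring.
Qed.

Lemma qintM_sub (a b : int) :
  qint a * qint (b + 1) - qint b * qint (a + 1) = qint (a - b).
Proof.
rewrite /qint; set h := q - q^-1.
have [->|h0] := eqVneq h 0; first by rewrite invr0 !mulr0 subr0.
have q0 := q_neq0.
apply: (mulIf h0); apply: (mulIf h0); rewrite mulrBl mulrBl.
rewrite !mulrA.
have -> (x y : K) : x / h * y / h * h * h = x * y by field.
have -> (x y : K) : x / h * y / h * h * h = x * y by field.
have -> (x : K) : x / h * h = x by field.
rewrite /h !opprD !opprK !(expfzDr _ _ q0) !expr1z !exprN1.
have := expfzDr a (- a) q0; rewrite subrr expr0z => ea.
have := expfzDr b (- b) q0; rewrite subrr expr0z => eb.
by ring.
Qed.

Fact simple_EF :
  simpleE *m simpleF - simpleF *m simpleE =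
  (q - q^-1)^-1 *: (simpleK alpha - simpleK (- alpha)).
Proof.
apply/matrixP=> i j; rewrite mxE [X in _ + X]mxE simple_EF_entry simple_FE_entry !mxE.
case: eqVneq => [_|_]; last by rewrite /= !mulr0n !mul0r !subr0 mulr0.
rewrite /= !mulr1n !mul1r qintM_sub /qint mulrC !wipNl.
suff -> : wip alpha (simple_weight i) = d%:Z - i%:Z - i%:Z by [].
by rewrite /wip /=; ring.
Qed.

Definition simple_mod : uqmod :=
  UqMod simple_KD simple_K0 simple_KE simple_KF simple_EF.

Lemma simple_weight_vector (i : 'I_d.+1) :
  weight_vector simple_mod (simple_weight i) (delta_mx i 0).
Proof.
move=> mu; rewrite /= mul_diag_mx; apply/matrixP=> a b; rewrite !mxE.
by case: eqP => [->|_] //=; rewrite !mulr0.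
Qed.

Lemma simple_in_Of : in_Of simple_mod.
Proof.
move=> v; exists [seq (v i 0, delta_mx i 0) | i : 'I_d.+1]; split.
  by move=> y /mapP[i _ ->]; exists (simple_weight i); apply: simple_weight_vector.
rewrite big_map big_enum /= [LHS]matrix_sum_delta; apply: eq_bigr => i _.
by rewrite big_ord_recl big_ord0 addr0.
Qed.

Lemma simple_hw (lam_dom : lam.2 <= lam.1) : simple_weight 0 = lam.
Proof.
by rewrite /simple_weight /d gez0_abs ?subr_ge0 //; case: lam => a b /=;
  congr (_, _); ring.
Qed.

End Simple.

(* the permutation of factors u (x) v |-> v (x) u *)
Definition swap_mx m n : 'M[K]_(n * m, m * n) :=
  \matrix_(i, j) (((mxtens_unindex i).1 == (mxtens_unindex j).2)
                   && ((mxtens_unindex i).2 == (mxtens_unindex j).1))%:R.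

Lemma tensvE m n (u : 'cV[K]_m) (v : 'cV[K]_n) a b j :
  (u *t v : 'cV[K]_(m * n)) (mxtens_index (a, b)) j = u a 0 * v b 0.
Proof. by rewrite mxE mxtens_indexK !ord1. Qed.

Lemma swap_mxE m n (u : 'cV[K]_m) (v : 'cV[K]_n) :
  swap_mx m n *m (u *t v) = v *t u.
Proof.
apply/matrixP=> i j; case: (mxtens_indexP i) => a b.
case: (mxtens_indexP j) => e f; rewrite tensmxE mxE.
rewrite (bigD1 (mxtens_index (b, a))) //= big1 => [|h neq].
  by rewrite tensmxE mxE !mxtens_indexK !eqxx mul1r addr0 mulrC !ord1.
rewrite mxE; move: neq; case: (mxtens_indexP h) => c d.
rewrite (can_eq (@mxtens_indexK m n)) xpair_eqE !mxtens_indexK /=.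
rewrite (eq_sym a) (eq_sym b) andbC => /negbTE ->.
by rewrite mul0r.
Qed.

(* The action of R_1 = \sum_k c_k F^k (x) E^k on U (x) V.  For U in O_f, F is  *)
(* nilpotent, so that F^k = 0 for k >= dim U.                                  *)
Definition R1_mx (c : nat -> K) (U V : uqmod) : 'M[K]_(udim U * udim V) :=
  \sum_(i < udim U) c i *: (actF U ^+ i *t actE V ^+ i).

(* The universal R-matrix R = R_0 R_1, acting on U (x) V for U, V in O_f.      *)
Record universal_R := UniversalR {
  R0_mx : forall U V : uqmod, 'M[K]_(udim U * udim V);
  R1_coef : nat -> K;
  R0_mxE : forall U V lam mu u v, in_Of U -> in_Of V ->
    weight_vector U lam u -> weight_vector V mu v ->
    R0_mx U V *m (u *t v) = q ^ wip lam mu *: (u *t v);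
  R1_coef0 : R1_coef 0 = 1;
  R_intertwines : forall U V, in_Of U -> in_Of V ->
    let R := R0_mx U V *m R1_mx R1_coef U V in
    [/\ R *m tensE U V = tensE_op U V *m R,
        R *m tensF U V = tensF_op U V *m R
      & forall lam, R *m tensK U V lam = tensK U V lam *m R]
}.

Section Braided.
Variable Ru : universal_R.

Definition braiding (U V : uqmod) : 'M[K]_(udim V * udim U, udim U * udim V) :=
  swap_mx _ _ *m (R0_mx Ru U V *m R1_mx (R1_coef Ru) U V).

Definition S2 (V : uqmod) : 'cV[K]_(udim V * udim V) -> Prop :=
  lspan (fun x => exists z : int, braiding V V *m x = q ^ z *: x).

Definition L2 (V : uqmod) : 'cV[K]_(udim V * udim V) -> Prop :=
  lspan (fun x => exists z : int, braiding V V *m x = - q ^ z *: x).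

Definition tens_sub m n (A : 'cV[K]_m -> Prop) (B : 'cV[K]_n -> Prop) :
    'cV[K]_(m * n) -> Prop :=
  lspan (fun x => exists a b, [/\ A a, B b & x = a *t b]).

Definition tens3 (V : uqmod) : uqmod := tens (tens V V) V.

(* (W (x) V) \cap (V (x) W) inside (V (x) V) (x) V, which castmx identifies    *)
(* with V (x) (V (x) V): with the indexing of *t this cast maps                *)
(* (u (x) v) (x) w to u (x) (v (x) w).                                         *)
Definition cube_sub n (W : 'cV[K]_(n * n) -> Prop) (x : 'cV[K]_(n * n * n)) :
    Prop :=
  tens_sub W (fun _ : 'cV[K]_n => True) x /\
  tens_sub (fun _ : 'cV[K]_n => True) W
    (castmx (esym (mulnA n n n), erefl 1%N) x).

Lemma tens_castA n (u v w : 'cV[K]_n) :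
  castmx (esym (mulnA n n n), erefl 1%N) (u *t v *t w : 'cV[K]_(n * n * n)) =
  u *t (v *t w).
Proof.
apply/matrixP=> i j; case: (mxtens_indexP i) => a b.
case: (mxtens_indexP b) => c d; rewrite castmxE.
have -> : cast_ord (esym (esym (mulnA n n n))) (mxtens_index (a, mxtens_index (c, d)))
    = mxtens_index (mxtens_index (a, c), d).
  by apply: val_inj; rewrite /= mulnDl mulnA addnA.
by rewrite (ord1 (cast_ord _ j)) !tensvE mulrA.
Qed.

Definition S3 (V : uqmod) : 'cV[K]_(udim (tens3 V)) -> Prop :=
  cube_sub (@S2 V).

Definition L3 (V : uqmod) : 'cV[K]_(udim (tens3 V)) -> Prop :=
  cube_sub (@L2 V).

End Braided.

(* The subspace S of W is a submodule isomorphic to M: there is an injective   *)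
(* module homomorphism M -> W with image S.                                    *)
Definition submod_iso (W : uqmod) (S : 'cV[K]_(udim W) -> Prop) (M : uqmod) :
    Prop :=
  exists f : 'M[K]_(udim W, udim M),
    [/\ injective (fun x : 'cV[K]_(udim M) => f *m x),
        forall y, S y <-> exists x : 'cV[K]_(udim M), y = f *m x
      & [/\ f *m actE M = actE W *m f,
            f *m actF M = actF W *m f
          & forall lam, f *m actK M lam = actK W lam *m f]].

End QuantumGL2.

Arguments weight_vector {K q} M mu v.
Arguments submod_iso {K q} W S M.
Arguments S2 {K q} Ru V.
Arguments L2 {K q} Ru V.
Arguments S3 {K q} Ru V.
Arguments L3 {K q} Ru V.

(* The field C(q), for C a field, and its generator q.                         *)
Definition Cq (C : fieldType) : fieldType := {fraction {poly C}}.

Definition qvar (C : fieldType) : Cq C := tofrac 'X.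

Lemma qvar_neq0 C : qvar C != 0.
Proof. by rewrite /qvar tofrac_eq0 polyX_eq0. Qed.

Lemma qvar_free C n : (0 < n)%N -> qvar C ^+ n != 1.
Proof.
move=> n0; rewrite /qvar -tofracXn -tofrac1 tofrac_eq.
apply/eqP=> /(congr1 (fun p : {poly C} => size p)).
by rewrite size_polyXn size_poly1; case: n n0.
Qed.

(* V_(a, b), for integers a >= b *)
Definition Vsimple (C : fieldType) (a b : int) : uqmod (qvar C) :=
  simple_mod (qvar_neq0 C) (a, b).

Section Existence.
Variables (K : fieldType) (q : K).
Local Notation uqmod := (uqmod q).
Hypothesis q_neq0 : q != 0.
Hypothesis q_free : forall n, (0 < n)%N -> q ^+ n != 1.

Lemma expq_inj (a b : int) : q ^ a = q ^ b -> a = b.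
Proof.
wlog suff main : / forall a b : int, q ^ a = q ^ b -> (a <= b)%R -> a = b.
  by case: (lerP a b) => [ab /main|/ltW ba /esym /main] -> //.
move=> {}a {}b e ab; apply/eqP; rewrite eq_sym -subr_eq0; apply/eqP.
have : q ^ (b - a) = 1.
  by rewrite (expfzDr _ _ q_neq0) -e -(expfzDr _ _ q_neq0) subrr expr0z.
have : 0 <= b - a by rewrite subr_ge0.
case: (b - a) => // -[//|n] _ /eqP.
by rewrite -exprnP (negbTE (q_free _)).
Qed.

Lemma tens_suml m n (s : seq (K * 'cV[K]_m)) (v : 'cV[K]_n) :
  (\sum_(y <- s) y.1 *: y.2) *t v = \sum_(y <- s) y.1 *: (y.2 *t v).
Proof.
elim: s => [|y s IH]; first by rewrite !big_nil tens0mx.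
by rewrite !big_cons tensDl IH tensZl.
Qed.

Lemma tens_sumr m n (s : seq (K * 'cV[K]_m)) (v : 'cV[K]_n) :
  v *t (\sum_(y <- s) y.1 *: y.2) = \sum_(y <- s) y.1 *: (v *t y.2).
Proof.
elim: s => [|y s IH]; first by rewrite !big_nil tensmx0.
by rewrite !big_cons tensDr IH tensZr.
Qed.

Lemma weight_ext (U V : uqmod) m (A B : 'M[K]_(m, udim U * udim V)) :
  in_Of U -> in_Of V ->
  (forall lam mu u v, weight_vector U lam u -> weight_vector V mu v ->
     A *m (u *t v) = B *m (u *t v)) ->
  A = B.
Proof.
move=> oU oV h.
have h1 mu (u : 'cV_(udim U)) v : weight_vector V mu v ->
    A *m (u *t v) = B *m (u *t v).
  move=> wv; have [s [hs ->]] := oU u.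
  rewrite tens_suml !mulmx_sumr; apply: eq_big_seq => y ys.
  have [lam wu] := hs y ys.
  by rewrite -!scalemxAr (h _ _ _ _ wu wv).
have h2 (u : 'cV_(udim U)) (v : 'cV_(udim V)) :
    A *m (u *t v) = B *m (u *t v).
  have [s [hs ->]] := oV v.
  rewrite tens_sumr !mulmx_sumr; apply: eq_big_seq => y ys.
  have [lam wu] := hs y ys.
  by rewrite -!scalemxAr (h1 _ _ _ wu).
apply/matrixP=> i j; case: (mxtens_indexP j) => a b.
pose x := (delta_mx a 0 : 'cV[K]_(udim U)) *t (delta_mx b 0 : 'cV[K]_(udim V)).
have ev (C : 'M[K]_(m, udim U * udim V)) : (C *m x) i 0 = C i (mxtens_index (a, b)).
  rewrite mxE (bigD1 (mxtens_index (a, b))) //= big1 => [|c neq].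
    by rewrite tensvE !mxE !eqxx !mulr1 addr0.
  move: neq; case: (mxtens_indexP c) => c1 c2.
  rewrite (can_eq (@mxtens_indexK _ _)) xpair_eqE tensvE !mxE eqxx !andbT.
  by case: eqP => _ /=; [move=> /negbTE ->|]; rewrite ?mul0r ?mulr0.
by rewrite -!ev /x h2.
Qed.

Lemma weightE (U : uqmod) mu v :
  weight_vector U mu v -> weight_vector U (mu + alpha) (actE U *m v).
Proof.
move=> wv lam; rewrite mulmxA actKE -scalemxAl -mulmxA wv -scalemxAr scalerA.
have -> : wip lam (mu + alpha) = wip alpha lam + wip lam mu.
  by rewrite wipDr addrC (wipC lam).
by rewrite (expfzDr _ (wip lam mu) q_neq0).
Qed.

Lemma weightF (U : uqmod) mu v :
  weight_vector U mu v -> weight_vector U (mu - alpha) (actF U *m v).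
Proof.
move=> wv lam; rewrite mulmxA actKF -scalemxAl -mulmxA wv -scalemxAr scalerA.
have -> : wip lam (mu - alpha) = - wip alpha lam + wip lam mu.
  by rewrite wipDr wipNr addrC (wipC lam).
by rewrite (expfzDr _ (wip lam mu) q_neq0).
Qed.

Lemma weightFX (U : uqmod) mu v j : weight_vector U mu v ->
  weight_vector U (mu - alpha *+ j) (actF U ^+ j *m v).
Proof.
move=> wv; elim: j => [|j IH]; first by rewrite mulr0n subr0 expr0 mul1mx.
by rewrite exprS -mulmxA mulrSr opprD addrA; apply: weightF.
Qed.

Lemma F_nil (U : uqmod) : in_Of U -> actF U ^+ udim U = 0.
Proof.
move=> oU; have nilw mu v : weight_vector U mu v -> actF U ^+ udim U *m v = 0.
  move=> wv; apply/eqP/negPn/negP=> nz.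
  pose A := (actK U (1, 0))^T.
  pose rs := [seq q ^ (mu.1 - j%:Z) | j <- iota 0 (udim U).+1].
  have := @max_poly_roots _ (char_poly A) rs.
  rewrite size_char_poly size_map size_iota ltnn => imp.
  suff: false by []; apply: imp.
  - by rewrite -size_poly_eq0 size_char_poly.
  - apply/allP=> x /mapP[j]; rewrite mem_iota add0n ltnS => /andP[_ jn] ->.
    rewrite -eigenvalue_root_char; apply/eigenvalueP.
    exists (actF U ^+ j *m v)^T; last first.
      apply: contra nz => /eqP/(congr1 trmx); rewrite trmxK trmx0 => e.
      have := exprD (actF U) (udim U - j) j; rewrite subnK // => ->.
      by rewrite -mulmxA e mulmx0.
    rewrite -trmx_mul (weightFX j wv) linearZ /=; congr (q ^ _ *: _).
    rewrite /wip /= mul0r addr0 mul1r; congr (_ - _).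
    by elim: j {jn} => // j IH; rewrite mulrSr /= IH addrC -intS.
  rewrite map_inj_uniq ?iota_uniq // => i j /expq_inj.
  by move=> /addrI /oppr_inj [].
apply/matrixP=> i j; have [s [hs e]] := oU (delta_mx j 0).
have : actF U ^+ udim U *m (delta_mx j 0 : 'cV_(udim U)) = 0.
  rewrite e mulmx_sumr big_seq big1 // => y ys.
  by have [mu wy] := hs y ys; rewrite -scalemxAr (nilw _ _ wy) scaler0.
by rewrite -colE => /matrixP /(_ i 0); rewrite !mxE.
Qed.

Let h := q - q^-1.
Let b := h^-1.
Definition acoef k : K := (q - q^-1 ^+ (k.*2.+1)) * b ^+ 2.

Lemma h_neq0 : h != 0.
Proof.
rewrite /h subr_eq0; apply/negP=> /eqP e.
by have := q_free (isT : (0 < 2)%N); rewrite expr2 {1}e mulVf // eqxx.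
Qed.

Lemma acoef_neq0 k : acoef k != 0.
Proof.
rewrite mulf_neq0 ?expf_neq0 ?invr_neq0 ?h_neq0 // subr_eq0.
apply/negP=> /eqP e; have := q_free (isT : (0 < k.*2.+2)%N).
by rewrite exprS {1}e exprVn mulVf ?eqxx ?expf_neq0.
Qed.

Lemma comm_FX n (E F Kp Km : 'M[K]_n) j :
  E *m F - F *m E = b *: (Kp - Km) ->
  Kp *m F = q^-1 ^+ 2 *: (F *m Kp) ->
  F *m Km = q^-1 ^+ 2 *: (Km *m F) ->
  E *m F ^+ j.+1 - F ^+ j.+1 *m E =
  acoef j *: (F ^+ j *m Kp - Km *m F ^+ j).
Proof.
move=> eEF eKp eKm; have hn0 := h_neq0.
have FKm i : F ^+ i *m Km = q^-1 ^+ i.*2 *: (Km *m F ^+ i).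
  elim: i => [|i IH]; first by rewrite !expr0 mul1mx mulmx1 scale1r.
  rewrite {1}exprS -[_ * _]/(_ *m _) -mulmxA IH -scalemxAr mulmxA eKm.
  rewrite -scalemxAl scalerA -exprD addn2 -mulmxA.
  by rewrite (exprS F).
elim: j => [|j IH].
  rewrite !expr1 expr0 mul1mx mulmx1 eEF; congr (_ *: _).
  by rewrite /acoef expr1 -/h /b; field.
have -> : E *m F ^+ j.+2 - F ^+ j.+2 *m E =
    (E *m F ^+ j.+1 - F ^+ j.+1 *m E) *m F + F ^+ j.+1 *m (E *m F - F *m E).
  rewrite mulmxBl mulmxBr (exprSr F j.+1) -[_ * F]/(_ *m F) !mulmxA.
  by rewrite addrA subrK.
rewrite IH eEF -scalemxAl mulmxBl -[in X in _ *: (X - _)]mulmxA eKp.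
rewrite -!scalemxAr !mulmxA mulmxBr FKm -[Km *m _ *m F]mulmxA.
have -> : F ^+ j *m F = F ^+ j.+1 by rewrite exprSr.
set X := _ *m Kp; set Y := Km *m _.
have eb : b = b ^+ 2 * (q - q^-1) by rewrite expr2 -mulrA /b mulVf ?mulr1.
have qp : q * q^-1 = 1 by rewrite mulfV.
have e1 : acoef j.+1 = acoef j * q^-1 ^+ 2 + b.
  rewrite [in RHS]eb /acoef doubleS 2!exprS expr2.
  by move: (q^-1) (q^-1 ^+ _) qp => p P qp; ring: qp.
have e2 : acoef j.+1 = acoef j + b * q^-1 ^+ j.+1.*2.
  rewrite eb /acoef doubleS 3!exprS.
  by move: (q^-1) (q^-1 ^+ _) qp => p P qp; ring: qp.
rewrite !scalerBr {1}e1 e2 !scalerDl !scalerA opprD addrACA.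
by rewrite [_ *: X + _]addrC addrAC.
Qed.

Lemma R0_exists (U V : uqmod) : exists A : 'M[K]_(udim U * udim V),
  in_Of V -> forall lam mu u v, weight_vector U lam u -> weight_vector V mu v ->
  A *m (u *t v) = q ^ wip lam mu *: (u *t v).
Proof.
have [oV|nV] := pselect (in_Of V); last by exists 0.
have /choice[m hm] : forall y : 'cV_(udim V), exists m : weight,
    (exists mu, weight_vector V mu y) -> weight_vector V m y.
  move=> y; have [[mu wy]|no] := pselect (exists mu, weight_vector V mu y).
    by exists mu.
  by exists 0 => /no.
have /choice[s hs] : forall j : 'I_(udim V), exists s : seq (K * 'cV_(udim V)),
    (forall y, y \in s -> exists mu, weight_vector V mu y.2) /\
    delta_mx j 0 = \sum_(y <- s) y.1 *: y.2.
  by move=> j; have [t ht] := oV (delta_mx j 0); exists t.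
exists (\sum_j \sum_(y <- s j)
  y.1 *: (actK U (m y.2) *t (y.2 *m (delta_mx 0 j : 'rV_(udim V))))).
move=> _ lam mu u v wu wv.
rewrite -tensZr -(wv lam).
have {2}-> : v = \sum_j v j 0 *: \sum_(y <- s j) y.1 *: y.2.
  rewrite [LHS](matrix_sum_delta v); apply: eq_bigr => j _.
  by rewrite big_ord_recl big_ord0 addr0 -(hs j).2.
have tsum (F : 'I_(udim V) -> 'cV_(udim V)) :
    u *t (\sum_j F j) = \sum_j (u *t F j).
  apply: (big_morph (fun x : 'cV_(udim V) => u *t x)); last exact: tensmx0.
  by move=> x y; rewrite tensDr.
rewrite mulmx_suml mulmx_sumr tsum; apply: eq_bigr => j _.
rewrite -scalemxAr tensZr -{2}[u]mul1mx -tensmx_mul tens_sumr mulmx_suml.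
rewrite mulmx_sumr scaler_sumr.
apply: eq_big_seq => y ys; have wy := hm _ ((hs j).1 y ys).
rewrite -scalemxAl tensmx_mul (wu (m y.2)) -mulmxA.
rewrite -scalemxAr tensmx_mul mul1mx wy.
have -> : (delta_mx 0 j : 'rV_(udim V)) *m v = (v j 0)%:M.
  by rewrite -rowE; apply/matrixP=> a c; rewrite !ord1 !mxE eqxx.
rewrite mul_mx_scalar tensZl !tensZr !scalerA.
by congr (_ *: _); rewrite (wipC _ lam); ring.
Qed.

Definition R0_sel (U V : uqmod) := sval (cid (R0_exists U V)).

Lemma R0_selE U V lam mu u v : in_Of U -> in_Of V ->
  weight_vector U lam u -> weight_vector V mu v ->
  R0_sel U V *m (u *t v) = q ^ wip lam mu *: (u *t v).
Proof. by move=> _ oV; apply: (svalP (cid (R0_exists U V))). Qed.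

Fixpoint ccoef i : K := if i is j.+1 then ccoef j / acoef j else 1.

Lemma ccoefS i : ccoef i.+1 * acoef i = ccoef i.
Proof. by rewrite /= divfK // acoef_neq0. Qed.

Section Intertwine.
Variables U V : uqmod.
Hypotheses (oU : in_Of U) (oV : in_Of V).

Lemma R0_tensE : tensE_op U V *m R0_sel U V =
  R0_sel U V *m (actK U (- alpha) *t actE V + actE U *t 1%:M).
Proof.
apply: weight_ext => // lam mu u v wu wv.
have wu' := weightE wu; have wv' := weightE wv.
rewrite -!mulmxA (R0_selE oU oV wu wv) -scalemxAr !mulmxDl mulmxDr.
rewrite !tensmx_mul !mul1mx wu wv tensZl !tensZr -scalemxAr.
rewrite (R0_selE oU oV wu wv') (R0_selE oU oV wu' wv).
rewrite scalerDr !scalerA; congr (_ *: _ + _ *: _).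
  rewrite -(expfzDr _ _ q_neq0); congr (q ^ _).
  by rewrite /wip /=; ring.
by rewrite -(expfzDr _ _ q_neq0); congr (q ^ _); rewrite /wip /=; ring.
Qed.

Lemma R0_tensF : tensF_op U V *m R0_sel U V =
  R0_sel U V *m (1%:M *t actF V + actF U *t actK V alpha).
Proof.
apply: weight_ext => // lam mu u v wu wv.
have wu' := weightF wu; have wv' := weightF wv.
rewrite -!mulmxA (R0_selE oU oV wu wv) -scalemxAr !mulmxDl mulmxDr.
rewrite !tensmx_mul !mul1mx wu wv tensZl !tensZr -scalemxAr.
rewrite (R0_selE oU oV wu wv') (R0_selE oU oV wu' wv).
rewrite scalerDr !scalerA; congr (_ *: _ + _ *: _).
  rewrite -(expfzDr _ _ q_neq0); congr (q ^ _).
  by rewrite /wip /=; ring.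
by rewrite -(expfzDr _ _ q_neq0); congr (q ^ _); rewrite /wip /=; ring.
Qed.

Lemma weightEX mu v j : weight_vector V mu v ->
  weight_vector V (mu + alpha *+ j) (actE V ^+ j *m v).
Proof.
move=> wv; elim: j => [|j IH]; first by rewrite mulr0n addr0 expr0 mul1mx.
by rewrite exprS -mulmxA mulrSr addrA; apply: weightE.
Qed.

Lemma tens_weight lam mu nu u v :
  weight_vector U lam u -> weight_vector V mu v ->
  tensK U V nu *m (u *t v) = q ^ wip nu (lam + mu) *: (u *t v).
Proof.
move=> wu wv; rewrite tensmx_mul wu wv tensZl tensZr scalerA.
by rewrite wipDr (expfzDr _ (wip nu mu) q_neq0).
Qed.

Lemma R_tensK nu :
  R0_sel U V *m R1_mx ccoef U V *m tensK U V nu =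
  tensK U V nu *m (R0_sel U V *m R1_mx ccoef U V).
Proof.
apply: weight_ext => // lam mu u v wu wv.
rewrite -!mulmxA (tens_weight nu wu wv) /R1_mx -!scalemxAr !mulmx_suml.
rewrite !mulmx_sumr scaler_sumr; apply: eq_bigr => i _.
rewrite -!scalemxAl tensmx_mul -!scalemxAr.
have wu' := weightFX i wu; have wv' := weightEX i wv.
rewrite (R0_selE oU oV wu' wv') -!scalemxAr (tens_weight nu wu' wv').
rewrite !scalerA; congr (_ *: _).
have -> : lam - alpha *+ i + (mu + alpha *+ i) = lam + mu.
  by rewrite addrACA addNr addr0.
by ring.
Qed.

Lemma K_E_comm (M : uqmod) : actK M alpha *m actE M = q ^+ 2 *: (actE M *m actK M alpha).
Proof. by rewrite actKE. Qed.

Lemma KN_E_comm (M : uqmod) :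
  actK M (- alpha) *m actE M = q^-1 ^+ 2 *: (actE M *m actK M (- alpha)).
Proof. by rewrite actKE exprVn. Qed.

Lemma comm_F i : actE U *m actF U ^+ i.+1 - actF U ^+ i.+1 *m actE U =
  acoef i *: (actF U ^+ i *m actK U alpha - actK U (- alpha) *m actF U ^+ i).
Proof.
apply: comm_FX; first exact: actEF.
  by rewrite actKF exprVn.
rewrite [in RHS]actKF scalerA.
have -> : q ^ (- wip alpha (- alpha)) = q ^+ 2 by [].
by rewrite -exprMn mulVf // expr1n scale1r.
Qed.

Lemma trmxX n (A : 'M[K]_n) i : A^T ^+ i = (A ^+ i)^T.
Proof.
elim: i => [|i IH]; first by rewrite !expr0 trmx1.
by rewrite exprSr exprS IH [in RHS]trmx_mul.
Qed.

Lemma comm_E i : actE V ^+ i.+1 *m actF V - actF V *m actE V ^+ i.+1 =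
  acoef i *: (actK V alpha *m actE V ^+ i - actE V ^+ i *m actK V (- alpha)).
Proof.
apply: trmx_inj; rewrite linearB linearZ /= linearB /= !trmx_mul -!trmxX.
apply: comm_FX.
- by rewrite -!trmx_mul -!linearB actEF linearZ.
- rewrite -!trmx_mul K_E_comm linearZ /= scalerA -exprMn mulVf //.
  by rewrite expr1n scale1r.
by rewrite -!trmx_mul KN_E_comm linearZ.
Qed.

Lemma R1_tensE : R1_mx ccoef U V *m tensE U V =
  (actK U (- alpha) *t actE V + actE U *t 1%:M) *m R1_mx ccoef U V.
Proof.
pose G i := ccoef i *:
  ((actE U *m actF U ^+ i - actF U ^+ i *m actE U) *t actE V ^+ i).
have GS i : G i.+1 = ccoef i *:
    ((actF U ^+ i *m actK U alpha - actK U (- alpha) *m actF U ^+ i)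
       *t actE V ^+ i.+1).
  by rewrite /G comm_F tensZl scalerA ccoefS.
apply/eqP; rewrite -subr_eq0; apply/eqP.
rewrite /R1_mx mulmx_suml mulmx_sumr -sumrB.
transitivity (\sum_(i < udim U) (G i.+1 - G i)).
  apply: eq_bigr => i _; rewrite GS /G /tensE -scalemxAl -scalemxAr.
  rewrite mulmxDr mulmxDl !tensmx_mul mulmx1 mul1mx -!scalerBr.
  congr (_ *: _); rewrite !tensBl.
  have -> : actE V ^+ i *m actE V = actE V ^+ i.+1 by rewrite exprSr.
  have -> : actE V *m actE V ^+ i = actE V ^+ i.+1 by rewrite exprS.
  move: (_ *t _) (_ *t _) (_ *t _) (_ *t _) => x y z t.
  by apply/matrixP=> ? ?; rewrite !mxE; ring.
rewrite -(big_mkord xpredT (fun i => G i.+1 - G i)) telescope_sumr //.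
rewrite /G (F_nil oU) mulmx0 mul0mx subr0 tens0mx scaler0.
by rewrite expr0 mulmx1 mul1mx subrr tens0mx scaler0 subr0.
Qed.

Lemma R1_tensF : R1_mx ccoef U V *m tensF U V =
  (1%:M *t actF V + actF U *t actK V alpha) *m R1_mx ccoef U V.
Proof.
pose G i := ccoef i *:
  (actF U ^+ i *t (actE V ^+ i *m actF V - actF V *m actE V ^+ i)).
have GS i : G i.+1 = ccoef i *: (actF U ^+ i.+1 *t
    (actK V alpha *m actE V ^+ i - actE V ^+ i *m actK V (- alpha))).
  by rewrite /G comm_E tensZr scalerA ccoefS.
apply/esym/eqP; rewrite -subr_eq0; apply/eqP.
rewrite /R1_mx mulmx_suml mulmx_sumr -sumrB.
transitivity (\sum_(i < udim U) (G i.+1 - G i)).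
  apply: eq_bigr => i _; rewrite GS /G /tensF -scalemxAl -scalemxAr.
  rewrite mulmxDr mulmxDl !tensmx_mul mulmx1 mul1mx -!scalerBr.
  congr (_ *: _); rewrite !tensBr.
  have -> : actF U ^+ i *m actF U = actF U ^+ i.+1 by rewrite exprSr.
  have -> : actF U *m actF U ^+ i = actF U ^+ i.+1 by rewrite exprS.
  move: (_ *t _) (_ *t _) (_ *t _) (_ *t _) => x y z t.
  by apply/matrixP=> ? ?; rewrite !mxE; ring.
rewrite -(big_mkord xpredT (fun i => G i.+1 - G i)) telescope_sumr //.
rewrite /G (F_nil oU) tens0mx scaler0.
by rewrite expr0 mulmx1 mul1mx subrr tensmx0 scaler0 subr0.
Qed.

End Intertwine.

Lemma universal_R_exists : inhabited (universal_R q).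
Proof.
constructor; apply: (@UniversalR _ _ R0_sel ccoef) => //.
  by move=> U V lam mu u v; apply: R0_selE.
move=> U V oU oV R; split.
- by rewrite /R -mulmxA R1_tensE // !mulmxA R0_tensE.
- by rewrite /R -mulmxA R1_tensF // !mulmxA R0_tensF.
by move=> nu; rewrite /R R_tensK.
Qed.

End Existence.

(* The hypothesis that a universal R-matrix is given is not vacuous.           *)
Lemma universal_R_Cq (C : fieldType) : inhabited (universal_R (qvar C)).
Proof.
by apply: universal_R_exists; [exact: qvar_neq0 | exact: qvar_free].
Qed.

(* Main.v *)
(* The submodule S^2_sigma V (x) V of V^(x)3 is the sum of the eigenspaces of
   the Casimir element C12 of the first two factors attached to the V_(2l-j,j)
   with j even, and V (x) S^2_sigma V is the same for C23; the parity of j is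
   read off the sign of the eigenvalue of the braiding, which only depends on
   the constant term of R_1.  On the space of highest weight vectors of weight
   (3l-m, m) both C12 and C23 have simple spectrum, indexed by an interval of
   values of j, and the problem is to compute the intersection of the span of
   the even eigenvectors of C12 with that of the even eigenvectors of C23, and
   likewise for odd ones.

   In the coordinates given by the component of a vector along the highest
   weight vector of the first factor, C12 is bidiagonal and C23 is tridiagonal.
   Their eigenvectors satisfy two- and three-term recursions, and after a
   rescaling by powers of q, the matrix pairing the eigenvectors of C12 with the
   eigenforms of C23 is regular at q = 0 and there triangular with nonzero
   entries on the diagonal and the subdiagonal.  Hence its block between
   opposite parities is injective, except possibly for a line when the numbers
   of even and odd eigenvalues differ; in that case a dimension count shows that
   the line occurs. *)

Require Import Defs.
From mathcomp Require Import all_boot all_order all_algebra.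
From mathcomp Require Import ring zify.
From mathcomp Require Import boolp reals.
From mathcomp.real_closed Require Import mxtens complex.

Set Implicit Arguments.
Unset Strict Implicit.
Unset Printing Implicit Defensive.

Import Order.TTheory GRing.Theory Num.Theory.
Local Open Scope ring_scope.

(** Why q = 0 and not q = 1: for l = m = 3 the classical symmetric cube contains V_(6,3) and the
    braided one does not, so the block between opposite parities is singular at q = 1 and no
    classical limit can prove injectivity. With t = min(l, m), s = max(0, m - l) and d = max(0, l -
    m), the indices j of both Casimir spectra run from s to t - s. The eigenform of C23 belonging to
    V_(2l-j,j) is given the reversed index k = t - j: near q = 0 its eigenvalue has the order of the
    diagonal coefficient of FE at b = k, exceeds the diagonal below k and is exceeded by it above k.
    So the three-term recursion splits into a two-term one on each side of k, up to factors 1 +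
    o(1), and the form tends to one supported on b <= k. Asking for t - k to have the parity
    opposite to j makes k and j of equal parity when t is odd, and then the diagonal decides; when t
    is even their parities differ and the subdiagonal k = j + 1 decides. In the second case the
    column j = t - s has no row k = j + 1; it has parity p exactly when s has, and this is the
    exceptional line. *)

Section Spans.
Variables (K : fieldType) (n : nat).
Implicit Types (S P : 'cV[K]_n -> Prop) (A : 'M[K]_n).

(** * Linear spans and spectral projectors *)

Definition subspace S := S 0 /\ forall a x y, S x -> S y -> S (a *: x + y).

Lemma subspaceZ S a x : subspace S -> S x -> S (a *: x).
Proof. by move=> [S0 SD] Sx; rewrite -[_ *: _]addr0; apply: SD. Qed.

Lemma subspaceD S x y : subspace S -> S x -> S y -> S (x + y).
Proof. by move=> [S0 SD] Sx Sy; rewrite -[x]scale1r; apply: SD. Qed.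

Lemma subspaceB S x y : subspace S -> S x -> S y -> S (x - y).
Proof. move=> sS Sx Sy; rewrite addrC -scaleN1r; exact: (proj2 sS). Qed.

Lemma subspace_sum S (I : eqType) (r : seq I) (p : pred I) (F : I -> 'cV[K]_n) :
  subspace S -> (forall i, i \in r -> p i -> S (F i)) ->
  S (\sum_(i <- r | p i) F i).
Proof.
move=> sS h; rewrite big_seq_cond; apply: (big_ind S) => [|x y|i /andP[ir pi]].
- exact: sS.1.
- exact: subspaceD.
- exact: h.
Qed.

Lemma subspace_lspan P : subspace (lspan P).
Proof.
split=> [|a x y [s [hs ->]] [t [ht ->]]]; first by exists [::]; rewrite big_nil.
exists ([seq (a * z.1, z.2) | z <- s] ++ t); split=> [z|].
  by rewrite mem_cat => /orP[/mapP[u us ->]|zt]; [exact: (hs u us)|exact: ht].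
rewrite big_cat big_map scaler_sumr; congr (_ + _).
by apply: eq_bigr => u _; rewrite scalerA.
Qed.

Lemma lspan_gen P x : P x -> lspan P x.
Proof.
move=> Px; exists [:: (1, x)]; split=> [y|]; last by rewrite big_seq1 scale1r.
by rewrite inE => /eqP ->.
Qed.

Lemma lspan_min P S x : subspace S -> (forall y, P y -> S y) -> lspan P x -> S x.
Proof.
move=> sS h [s [hs ->]]; apply: subspace_sum => // y ys _.
by apply: subspaceZ => //; apply: h; apply: hs.
Qed.

Definition mstable A S := forall x, S x -> S (A *m x).

Lemma subspace_eqmx m (A B : 'M[K]_(m, n)) : subspace (fun x => A *m x = B *m x).
Proof.
split=> [|a x y ex ey]; first by rewrite !mulmx0.
by rewrite !mulmxDr -!scalemxAr ex ey.
Qed.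

Lemma subspace_ker m (A : 'M[K]_(m, n)) : subspace (fun x => A *m x = 0).
Proof.
split=> [|a x y ex ey]; first by rewrite mulmx0.
by rewrite mulmxDr -scalemxAr ex ey scaler0 addr0.
Qed.

Lemma mstable_exp A S k : mstable A S -> mstable (A ^+ k) S.
Proof.
move=> sA; elim: k => [|k IH] x Sx; first by rewrite expr0 mul1mx.
by rewrite exprS -mulmxA; apply/sA/IH.
Qed.

Definition speci A (r : seq K) a : 'M[K]_n :=
  \big[mulmx/1%:M]_(b <- r | b != a) ((a - b)^-1 *: (A - b%:M)).

Lemma speci_eig A r a c (y : 'cV_n) : A *m y = c *: y ->
  speci A r a *m y = (\prod_(b <- r | b != a) ((c - b) / (a - b))) *: y.
Proof.
move=> e; rewrite /speci; elim: r => [|b r IH].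
  by rewrite !big_nil mul1mx scale1r.
rewrite !big_cons; case: ifP => // _; rewrite -mulmxA IH -scalemxAr -scalemxAl.
rewrite mulmxBl e mul_scalar_mx -scalerBl !scalerA; congr (_ *: _).
by rewrite [RHS]mulrC -?mulrA; congr (_ * _); rewrite mulrC.
Qed.

Lemma speci_id A r a (y : 'cV_n) : A *m y = a *: y -> speci A r a *m y = y.
Proof.
move=> e; rewrite (speci_eig _ _ e) big1 ?scale1r // => b nb.
by rewrite divff // subr_eq0 eq_sym.
Qed.

Lemma speci_0 A r a c (y : 'cV_n) : c \in r -> c != a -> A *m y = c *: y ->
  speci A r a *m y = 0.
Proof.
move=> cr ca e; rewrite (speci_eig _ _ e) (big_rem c) //= ca subrr.
by rewrite !mul0r scale0r.
Qed.

Lemma speci_stable A r a S : subspace S -> mstable A S -> mstable (speci A r a) S.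
Proof.
move=> sS sA; rewrite /speci; elim: r => [|b r IH] x Sx.
  by rewrite big_nil mul1mx.
rewrite big_cons; case: ifP => _; last exact: IH.
rewrite -mulmxA -scalemxAl; apply: subspaceZ => //.
rewrite mulmxBl mul_scalar_mx; apply: subspaceB => //; first exact/sA/IH.
by apply: subspaceZ => //; apply: IH.
Qed.

Definition diagz A (r : seq K) := uniq r /\
  forall x, lspan (fun y => exists2 a, a \in r & A *m y = a *: y) x.

Lemma sum_speci A r (x : 'cV_n) : diagz A r -> \sum_(a <- r) speci A r a *m x = x.
Proof.
move=> [ur dA]; move: (dA x).
apply: (@lspan_min _ (fun x => \sum_(a <- r) speci A r a *m x = x)) => [|y [a ar e]].
  split=> [|a y z ey ez]; first by rewrite big1 // => i _; rewrite mulmx0.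
  rewrite -[in RHS]ey -[in RHS]ez scaler_sumr -big_split; apply: eq_bigr => b _.
  by rewrite mulmxDr -scalemxAr.
rewrite (bigD1_seq a) //= (speci_id _ e) big1 ?addr0 // => b ba.
by rewrite (speci_0 ar _ e) // eq_sym.
Qed.

Lemma speci_sub A r a (x : 'cV_n) : diagz A r -> a \in r ->
  A *m (speci A r a *m x) = a *: (speci A r a *m x).
Proof.
move=> [ur dA] ar; move: (dA x).
apply: (@lspan_min _ (fun x => A *m (speci A r a *m x) = a *: (speci A r a *m x))).
  split=> [|b y z ey ez]; first by rewrite !mulmx0 scaler0.
  by rewrite !mulmxDr -!scalemxAr scalerDr ey ez !scalerA mulrC.
move=> y [b br e]; have [ab|ab] := eqVneq a b.
  by rewrite ab in ar *; rewrite !speci_id.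
by rewrite (speci_0 br _ e) 1?eq_sym // mulmx0 scaler0.
Qed.

End Spans.

Lemma speci_comm (K : fieldType) m n (A : 'M[K]_m) (A' : 'M[K]_n) (B : 'M_(m, n)) r a :
  A *m B = B *m A' -> speci A r a *m B = B *m speci A' r a.
Proof.
move=> e; rewrite /speci; elim: r => [|b r IH].
  by rewrite !big_nil mul1mx mulmx1.
rewrite !big_cons; case: ifP => // _; rewrite -mulmxA IH !mulmxA.
congr (_ *m _); rewrite -scalemxAl -scalemxAr mulmxBl mulmxBr e.
by rewrite mul_scalar_mx mul_mx_scalar.
Qed.

Definition wd (mu : weight) : int := mu.1 - mu.2.

Lemma wdE mu : wip alpha mu = wd mu.
Proof. by rewrite /wip /wd /= mul1r mulN1r. Qed.

Lemma wdDn mu k : wd (mu + alpha *+ k) = wd mu + k%:Z *+ 2.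
Proof.
rewrite -!wdE wipDr; congr (_ + _).
elim: k => [|k IH]; first by rewrite mulr0n.
rewrite mulrSr wipDr IH; have -> : wip alpha alpha = 2 by [].
by lia.
Qed.

Lemma wdBn mu k : wd (mu - alpha *+ k) = wd mu - k%:Z *+ 2.
Proof.
have e := wdDn 0 k; rewrite add0r -wdE in e.
by rewrite -!wdE wipDr wipNr e /wd /= add0r.
Qed.

(** * Highest weight vectors *)

Section Modules.
Variables (K : fieldType) (q : K).
Hypothesis q_neq0 : q != 0.
Hypothesis q_free : forall n, (0 < n)%N -> q ^+ n != 1.
Implicit Types (M W : uqmod q) (mu nu lam : weight).
Local Notation h := (q - q^-1).

Let h0 : h != 0. Proof. exact: h_neq0. Qed.
Let h0' : q * q - 1 != 0.
Proof. by rewrite -expr2 subr_eq0 q_free. Qed.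

Lemma qz_neq0 (z : int) : q ^ z != 0.
Proof. by rewrite expfz_neq0. Qed.

Lemma qzD (a b : int) : q ^ (a + b) = q ^ a * q ^ b.
Proof. exact: expfzDr. Qed.

Lemma qzI (a b : int) : q ^ a = q ^ b -> a = b.
Proof. exact: expq_inj. Qed.

Lemma weight_vector0 M mu : weight_vector M mu 0.
Proof. by move=> lam; rewrite mulmx0 scaler0. Qed.

Lemma subspace_weight M mu : subspace (weight_vector M mu).
Proof.
split; first exact: weight_vector0.
move=> a x y wx wy lam; rewrite mulmxDr -scalemxAr wx wy scalerDr !scalerA.
by rewrite mulrC.
Qed.

(* The Casimir element FE + (q K_alpha + q^-1 K_-alpha) / (q - q^-1)^2. *)
Definition cas M : 'M[K]_(udim M) := actF M *m actE M +
  h ^- 2 *: (q *: actK M alpha + q^-1 *: actK M (- alpha)).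

Definition cval (d : int) : K := h ^- 2 * (q ^ (d + 1) + q ^ (- d - 1)).

(** [cval] is invariant under d -> - d - 2, whence the sign conditions: the equation factors as [(q
    ^ (d + 1) - q ^ (e + 1)) * (1 - q ^ (- d - e - 2)) = 0], and the second factor is nonzero for
    nonnegative [d] and [e]. *)
Lemma cval_inj (d e : int) : 0 <= d -> 0 <= e -> cval d = cval e -> d = e.
Proof.
move=> d0 e0 /(mulfI _) => /(_ _)/wrap[|E]; first by rewrite invr_neq0 // expf_neq0.
have : (q ^ (d + 1) - q ^ (e + 1)) * (1 - q ^ (- d - e - 2)) = 0.
  rewrite mulrBr mulr1 mulrBl -!qzD.
  have -> : d + 1 + (- d - e - 2) = - e - 1 by lia.
  have -> : e + 1 + (- d - e - 2) = - d - 1 by lia.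
  have -> : q ^ (d + 1) = q ^ (e + 1) + q ^ (- e - 1) - q ^ (- d - 1).
    by rewrite -E addrK.
  by ring.
move/eqP; rewrite mulf_eq0 !subr_eq0 => /orP[/eqP /qzI|/eqP].
  by lia.
by rewrite -[1]/(q ^ 0) => /qzI; lia.
Qed.

Lemma FK M lam : actF M *m actK M lam = q ^ wip alpha lam *: (actK M lam *m actF M).
Proof. by rewrite actKF scalerA -qzD addrN scale1r. Qed.

Lemma EK M lam : actE M *m actK M lam = q ^ (- wip alpha lam) *: (actK M lam *m actE M).
Proof. by rewrite actKE scalerA -qzD addNr scale1r. Qed.

Lemma cas_E M : cas M *m actE M = actE M *m cas M.
Proof.
rewrite /cas mulmxDl mulmxDr mulmxA.
have -> : actE M *m actF M = actF M *m actE M +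
    h^-1 *: (actK M alpha - actK M (- alpha)).
  by rewrite -actEF addrC subrK.
rewrite -!scalemxAl -!scalemxAr !mulmxDl !mulmxDr -!scalemxAl -!scalemxAr.
rewrite !actKE -[_ *m _ *m _]mulmxA -addrA; congr (_ + _).
rewrite mulmxBl !actKE.
have -> : wip alpha alpha = 2 by [].
have -> : wip alpha (- alpha) = - 2 by [].
move: (actE M *m _) (actE M *m _) => X Y.
rewrite -exprnN -exprnP.
apply/matrixP=> i j; rewrite !mxE; field.
by rewrite q_neq0 h0'.
Qed.

Lemma cas_F M : cas M *m actF M = actF M *m cas M.
Proof.
rewrite /cas mulmxDl mulmxDr -!mulmxA.
have -> : actE M *m actF M = actF M *m actE M +
    h^-1 *: (actK M alpha - actK M (- alpha)).
  by rewrite -actEF addrC subrK.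
rewrite mulmxDr -addrA; congr (_ + _).
rewrite -!scalemxAl -!scalemxAr !mulmxDl mulmxBr !mulmxDr -!scalemxAl -!scalemxAr.
rewrite !actKF.
have -> : wip alpha alpha = 2 by [].
have -> : wip alpha (- alpha) = - 2 by [].
rewrite opprK; move: (actF M *m _) (actF M *m _) => X Y.
rewrite -exprnN -exprnP.
apply/matrixP=> i j; rewrite !mxE; field.
by rewrite q_neq0 h0'.
Qed.

Lemma cas_K M lam : cas M *m actK M lam = actK M lam *m cas M.
Proof.
rewrite /cas mulmxDl mulmxDr; congr (_ + _).
  rewrite -mulmxA EK -scalemxAr (mulmxA (actF M)) FK -scalemxAl scalerA.
  by rewrite -qzD addNr scale1r mulmxA.
rewrite -!scalemxAl -!scalemxAr !mulmxDl !mulmxDr -!scalemxAl -!scalemxAr.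
by rewrite !(actKC M lam).
Qed.

Lemma casE M mu v : weight_vector M mu v ->
  cas M *m v = actF M *m (actE M *m v) + cval (wd mu) *: v.
Proof.
move=> wv; rewrite /cas mulmxDl -mulmxA -!scalemxAl mulmxDl -!scalemxAl.
rewrite !wv wipNl !wdE !scalerA -scalerDl scalerA; congr (_ + _ *: _).
by rewrite /cval opprD !qzD exprN1 expr1z; ring.
Qed.

Section HighestWeight.
Variables (M : uqmod q) (mu : weight) (v : 'cV[K]_(udim M)).
Hypotheses (wv : weight_vector M mu v) (Ev : actE M *m v = 0).
Local Notation F := (actF M).
Local Notation E := (actE M).

Lemma EF_hw k : E *m (F ^+ k.+1 *m v) =
  (acoef q k * (q ^ wd mu - q ^ (k%:Z *+ 2 - wd mu))) *: (F ^+ k *m v).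
Proof.
have := comm_F q_neq0 q_free M k => /(congr1 (mulmx^~ v)).
rewrite mulmxBl -scalemxAl mulmxBl -!mulmxA Ev mulmx0 subr0 => ->.
rewrite wv (weightFX q_neq0 k wv) -scalemxAr -scalerBl scalerA.
congr (_ * (q ^ _ - q ^ _) *: _); first by rewrite wdE.
by rewrite wipNl wdE wdBn; lia.
Qed.

Lemma cas_hw k : cas M *m (F ^+ k *m v) = cval (wd mu) *: (F ^+ k *m v).
Proof.
rewrite mulmxA; have -> : cas M *m F ^+ k = F ^+ k *m cas M.
  elim: k => [|k IH]; first by rewrite !expr0 mulmx1 mul1mx.
  by rewrite exprS -[_ * _]/(_ *m _) mulmxA cas_F -!mulmxA IH.
by rewrite -mulmxA (casE wv) Ev mulmx0 add0r scalemxAr.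
Qed.

Lemma hw_coef_neq0 k : k%:Z != wd mu ->
  acoef q k * (q ^ wd mu - q ^ (k%:Z *+ 2 - wd mu)) != 0.
Proof.
move=> kd; rewrite mulf_neq0 ?acoef_neq0 // subr_eq0.
by apply/eqP => /qzI; lia.
Qed.

(** The coefficient in [EF_hw] vanishes only at [k = wd mu], so the string of the [F ^+ k *m v]
    cannot stop earlier. When [wd mu] is negative it never stops, against the nilpotence of [F];
    this is how [hw_ge0] uses the conditional bound. *)
Lemma FX_hw_neq0 k : v != 0 -> (0 <= wd mu -> (k%:Z <= wd mu)) ->
  F ^+ k *m v != 0.
Proof.
move=> v0; elim: k => [|k IH] kd; first by rewrite expr0 mul1mx.
apply/eqP=> e; have := EF_hw k; rewrite e mulmx0 => /esym/eqP.
rewrite scaler_eq0 => /orP[|].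
  by apply/negP/hw_coef_neq0/eqP => ke; move: kd; rewrite -ke; lia.
by apply/negP/IH => d0; have := kd d0; lia.
Qed.

Lemma EXFX_hw k : (0 <= wd mu -> k%:Z <= wd mu) ->
  exists2 c : K, c != 0 & E ^+ k *m (F ^+ k *m v) = c *: v.
Proof.
elim: k => [|k IH] kd; first by exists 1; rewrite ?oner_neq0 // !expr0 !mul1mx scale1r.
have [c c0 e] := IH (fun d0 => ltac:(have := kd d0; lia)).
exists (acoef q k * (q ^ wd mu - q ^ (k%:Z *+ 2 - wd mu)) * c).
  rewrite mulf_neq0 //; apply/hw_coef_neq0/eqP => ke.
  by move: kd; rewrite -ke; lia.
by rewrite exprSr -mulmxA EF_hw -scalemxAr e scalerA.
Qed.

Hypothesis oM : in_Of M.

Lemma hw_ge0 : v != 0 -> 0 <= wd mu.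
Proof.
move=> v0; rewrite leNgt; apply/negP => dlt.
have := @FX_hw_neq0 (udim M) v0 (fun d0 => ltac:(lia)).
by rewrite (F_nil q_neq0 q_free oM) mul0mx eqxx.
Qed.

End HighestWeight.

(** With d = [wd mu], the coefficient of [EF_hw] vanishes at d, so the vector after F^d v in the
    string is again of highest weight, with negative [wd]; by [hw_ge0] it is zero. *)
Lemma FX_hw_eq0 M mu v k : in_Of M -> weight_vector M mu v -> actE M *m v = 0 ->
  wd mu < k%:Z -> actF M ^+ k *m v = 0.
Proof.
move=> oM wv Ev dk; have [->|v0] := eqVneq v 0; first by rewrite mulmx0.
have d0 := hw_ge0 wv Ev oM v0.
have [d ed] : exists d : nat, wd mu = d%:Z by exists `|wd mu|%N; lia.
suff z : actF M ^+ d.+1 *m v = 0.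
  have -> : k = (k - d.+1 + d.+1)%N by lia.
  by rewrite exprD -[_ * _]/(_ *m _) -mulmxA z mulmx0.
apply/eqP/negPn/negP => /(hw_ge0 (weightFX q_neq0 d.+1 wv)) h.
have : 0 <= wd (mu - alpha *+ d.+1).
  apply: h => //; rewrite (EF_hw wv Ev) ed.
  have -> : d%:Z *+ 2 - d%:Z = d%:Z by lia.
  by rewrite subrr mulr0 scale0r.
by rewrite wdBn ed; lia.
Qed.

Fact twist_KD M lam mu : actK M (- lam) *m actK M (- mu) = actK M (- (lam + mu)).
Proof. by rewrite actKD opprD. Qed.
Fact twist_K0 M : actK M (- 0) = 1%:M.
Proof. by rewrite oppr0 actK0. Qed.
Fact twist_KE M lam : actK M (- lam) *m actF M =
  q ^ wip alpha lam *: (actF M *m actK M (- lam)).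
Proof. by rewrite actKF wipNr opprK. Qed.
Fact twist_KF M lam : actK M (- lam) *m actE M =
  q ^ (- wip alpha lam) *: (actE M *m actK M (- lam)).
Proof. by rewrite actKE wipNr. Qed.
Fact twist_EF M : actF M *m actE M - actE M *m actF M =
  h^-1 *: (actK M (- alpha) - actK M (- - alpha)).
Proof. by rewrite opprK -opprB actEF -scalerN opprB. Qed.

(* M pulled back along the Chevalley involution, exchanging highest and        *)
(* lowest weight vectors.                                                      *)
Definition twist M : uqmod q := UqMod (twist_KD M) (twist_K0 M) (twist_KE M)
  (twist_KF M) (twist_EF M).

Lemma twist_weight M mu v : weight_vector M mu v -> weight_vector (twist M) (- mu) v.
Proof. by move=> wv lam; rewrite /= wv wipNl wipNr. Qed.

Lemma twist_Of M : in_Of M -> in_Of (twist M).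
Proof.
move=> oM v; apply: lspan_min (oM v) => [|y [mu wy]]; first exact: subspace_lspan.
by apply: lspan_gen; exists (- mu); apply: twist_weight.
Qed.

Lemma E_nil M : in_Of M -> actE M ^+ udim M = 0.
Proof. by move=> oM; apply: (F_nil q_neq0 q_free (twist_Of oM)). Qed.

Definition hw_in M (S : 'cV[K]_(udim M) -> Prop) mu (v : 'cV[K]_(udim M)) :=
  [/\ S v, weight_vector M mu v & actE M *m v = 0].

Definition hw_span M S := lspan (fun y => exists k mu v,
  hw_in (M := M) S mu v /\ y = actF M ^+ k *m v).

Lemma hw_span_F M S : mstable (actF M) (hw_span S).
Proof.
move=> x; apply: (@lspan_min _ _ _ (fun x => hw_span S (actF M *m x))).
  split=> [|a y z sy sz]; first by rewrite mulmx0; apply: (subspace_lspan _).1.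
  by rewrite mulmxDr -scalemxAr; apply: (subspace_lspan _).2.
move=> y [k [mu [v [hv ->]]]]; apply: lspan_gen; exists k.+1, mu, v.
by rewrite exprS -mulmxA.
Qed.

Lemma hw_span_E M S : mstable (actE M) (hw_span S).
Proof.
move=> x; apply: (@lspan_min _ _ _ (fun x => hw_span S (actE M *m x))).
  split=> [|a y z sy sz]; first by rewrite mulmx0; apply: (subspace_lspan _).1.
  by rewrite mulmxDr -scalemxAr; apply: (subspace_lspan _).2.
move=> y [k [mu [v [[Sv wv Ev] ->]]]].
case: k => [|k]; first by rewrite expr0 mul1mx Ev; apply: (subspace_lspan _).1.
rewrite (EF_hw wv Ev); apply: subspaceZ; first exact: subspace_lspan.
by apply: lspan_gen; exists k, mu, v.
Qed.

Lemma hw_spanX M S (A : 'M[K]_(udim M)) k : mstable A (hw_span S) ->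
  mstable (A ^+ k) (hw_span S).
Proof. exact: mstable_exp. Qed.

(** Induction on the order of nilpotency of E on x. If E^(n+1) kills x, then y = E^n x is a highest
    weight vector in S, and subtracting a multiple of F^n y leaves a vector killed by E^n. The
    multiple exists because E^n F^n y is a nonzero multiple of y: [wd] of y is at least 2n. *)
Lemma hw_span_pos M S mu x : subspace S -> mstable (actE M) S ->
  mstable (actF M) S -> in_Of M -> S x -> weight_vector M mu x -> 0 <= wd mu ->
  hw_span (M := M) S x.
Proof.
move=> sS sE sF oM + + d0; have [N eN] : exists N, actE M ^+ N *m x = 0.
  by exists (udim M); rewrite E_nil ?mul0mx.
elim: N x eN => [|n IH] x ex Sx wx.
  by move: ex; rewrite expr0 mul1mx => ->; apply: (subspace_lspan _).1.
pose y := actE M ^+ n *m x.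
have wy : weight_vector M (mu + alpha *+ n) y by apply: weightEX.
have Ey : actE M *m y = 0 by rewrite mulmxA -[RHS]ex exprS.
have Sy : S y by apply: mstable_exp.
have [c c0 ec] : exists2 c : K, c != 0 &
    actE M ^+ n *m (actF M ^+ n *m y) = c *: y.
  by apply: (EXFX_hw wy Ey) => _; rewrite wdDn; lia.
have -> : x = c^-1 *: (actF M ^+ n *m y) + (x - c^-1 *: (actF M ^+ n *m y)).
  by rewrite addrC subrK.
apply: (subspace_lspan _).2.
  by apply: lspan_gen; exists n, (mu + alpha *+ n), y.
apply: IH.
- by rewrite mulmxBr -scalemxAr ec scalerA mulVf // scale1r subrr.
- apply: subspaceB => //; apply: subspaceZ => //; exact: mstable_exp.
apply: (subspaceB (@subspace_weight M mu)) => //.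
apply: (subspaceZ _ (@subspace_weight M mu)).
by have := weightFX q_neq0 n wy; rewrite addrK.
Qed.

(* The twist reduces a vector of negative weight to one of positive weight. *)
Lemma hw_spanP M S mu x : subspace S -> mstable (actE M) S ->
  mstable (actF M) S -> in_Of M -> S x -> weight_vector M mu x ->
  hw_span (M := M) S x.
Proof.
move=> sS sE sF oM Sx wx.
have [d0|dlt] := leP 0 (wd mu); first exact: hw_span_pos wx d0.
have : hw_span (M := twist M) S x.
  apply: (hw_span_pos (mu := - mu)) => //; first exact: twist_Of.
    exact: twist_weight.
  by move: dlt; rewrite /wd /=; lia.
apply: lspan_min => [|y [k [nu [v [[Sv wv Ev] ->]]]]]; first exact: subspace_lspan.
apply: (hw_spanX (A := actE M)); first exact: hw_span_E.
have [->|v0] := eqVneq v 0; first exact: (subspace_lspan _).1.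
have d0 := hw_ge0 wv Ev (twist_Of oM) v0.
have [d ed] : exists d : nat, wd nu = d%:Z by exists `|wd nu|%N; lia.
(* In [M] itself [v] is a lowest weight vector. It is recovered, up to [c], by applying F^d to E^d
   v, whose weight is nonnegative, so the previous lemma applies to that vector. *)
have [c c0 ec] := EXFX_hw wv Ev (k := d) (fun _ => ltac:(lia)).
rewrite -[v](scalerK c0) -ec; apply: subspaceZ; first exact: subspace_lspan.
apply: (hw_spanX (A := actF M)); first exact: hw_span_F.
have wE := weightFX q_neq0 d wv.
apply: (hw_span_pos (mu := - (nu - alpha *+ d))) => //.
- exact: mstable_exp.
- by move=> lam; have := wE (- lam); rewrite /= opprK wipNl wipNr.
by rewrite -wdE wipNr wdE wdBn; lia.
Qed.

End Modules.

(** * Tensor products *)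

Section Slices.
Variable K : fieldType.

(* The contractions r (x) 1 and 1 (x) r of a tensor by a linear form r. *)
Definition lsl m n (r : 'rV[K]_m) (x : 'cV[K]_(m * n)) : 'cV[K]_n :=
  \col_k \sum_a r 0 a * x (mxtens_index (a, k)) 0.

Definition rsl m n (r : 'rV[K]_n) (x : 'cV[K]_(m * n)) : 'cV[K]_m :=
  \col_k \sum_a r 0 a * x (mxtens_index (k, a)) 0.

Lemma sum_tens m n (F : 'I_(m * n) -> K) :
  \sum_i F i = \sum_a \sum_b F (mxtens_index (a, b)).
Proof.
rewrite pair_big (reindex (@mxtens_index m n)) /=; last first.
  by exists (@mxtens_unindex m n) => i _; rewrite ?mxtens_indexK ?mxtens_unindexK.
by apply: eq_bigr => -[].
Qed.

Variables m n : nat.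
Implicit Types (x y : 'cV[K]_(m * n)).

Lemma lsl_tens p s (r : 'rV[K]_m) (A : 'M_(m, p)) (B : 'M_(n, s)) (x : 'cV_(p * s)) :
  lsl r ((A *t B) *m x) = B *m lsl (r *m A) x.
Proof.
apply/matrixP=> k j; rewrite !mxE.
under eq_bigr => a _ do rewrite mxE sum_tens mulr_sumr.
under [RHS]eq_bigr => b _ do rewrite mxE mulr_sumr.
rewrite [RHS]exchange_big [LHS]exchange_big; apply: eq_bigr => c _ /=.
under eq_bigr => a _ do rewrite mulr_sumr.
rewrite exchange_big; apply: eq_bigr => b _; rewrite mxE mulr_suml mulr_sumr.
by apply: eq_bigr => a _; rewrite tensmxE; ring.
Qed.

Lemma rsl_tens p s (r : 'rV[K]_n) (A : 'M_(m, p)) (B : 'M_(n, s)) (x : 'cV_(p * s)) :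
  rsl r ((A *t B) *m x) = A *m rsl (r *m B) x.
Proof.
apply/matrixP=> k j; rewrite !mxE.
under eq_bigr => a _ do rewrite mxE sum_tens mulr_sumr.
under [RHS]eq_bigr => b _ do rewrite mxE mulr_sumr.
rewrite [LHS]exchange_big; apply: eq_bigr => c _ /=.
under eq_bigr => a _ do rewrite mulr_sumr.
rewrite exchange_big; apply: eq_bigr => b _; rewrite mxE mulr_suml mulr_sumr.
by apply: eq_bigr => a _; rewrite tensmxE; ring.
Qed.

Lemma lslD (r : 'rV[K]_m) x y : lsl r (x + y) = lsl r x + lsl r y.
Proof.
apply/matrixP=> k j; rewrite !mxE -big_split.
by apply: eq_bigr => a _; rewrite mxE mulrDr.
Qed.

Lemma lslZ (r : 'rV[K]_m) c x : lsl r (c *: x) = c *: lsl r x.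
Proof.
apply/matrixP=> k j; rewrite !mxE mulr_sumr.
by apply: eq_bigr => a _; rewrite mxE mulrCA.
Qed.

Lemma lslZl (r : 'rV[K]_m) c x : lsl (c *: r) x = c *: lsl r x.
Proof.
apply/matrixP=> k j; rewrite !mxE mulr_sumr.
by apply: eq_bigr => a _; rewrite mxE mulrA.
Qed.

Lemma lsl0 (r : 'rV[K]_m) : lsl r (0 : 'cV_(m * n)) = 0.
Proof. by rewrite -(scale0r 0) lslZ scale0r. Qed.

Lemma rslD (r : 'rV[K]_n) x y : rsl r (x + y) = rsl r x + rsl r y.
Proof.
apply/matrixP=> k j; rewrite !mxE -big_split.
by apply: eq_bigr => a _; rewrite mxE mulrDr.
Qed.

Lemma rslZ (r : 'rV[K]_n) c x : rsl r (c *: x) = c *: rsl r x.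
Proof.
apply/matrixP=> k j; rewrite !mxE mulr_sumr.
by apply: eq_bigr => a _; rewrite mxE mulrCA.
Qed.

Lemma rslZl (r : 'rV[K]_n) c x : rsl (c *: r) x = c *: rsl r x.
Proof.
apply/matrixP=> k j; rewrite !mxE mulr_sumr.
by apply: eq_bigr => a _; rewrite mxE mulrA.
Qed.

Lemma rsl0 (r : 'rV[K]_n) : rsl r (0 : 'cV_(m * n)) = 0.
Proof. by rewrite -(scale0r 0) rslZ scale0r. Qed.

Lemma rsl_sum (r : 'rV[K]_n) (I : Type) (s : seq I) (p : pred I) (f : I -> 'cV_(m * n)) :
  rsl r (\sum_(i <- s | p i) f i) = \sum_(i <- s | p i) rsl r (f i).
Proof. by apply: (big_morph (rsl r)); [exact: rslD | exact: rsl0]. Qed.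

Lemma lsl_tensv (r : 'rV[K]_m) (u : 'cV_m) (v : 'cV_n) :
  lsl r (u *t v) = (r *m u) 0 0 *: v.
Proof.
apply/matrixP=> k j; rewrite !mxE mulr_suml.
by apply: eq_bigr => a _; rewrite tensvE ord1 mulrA.
Qed.

Lemma rsl_tensv (r : 'rV[K]_n) (u : 'cV_m) (v : 'cV_n) :
  rsl r (u *t v) = (r *m v) 0 0 *: u.
Proof.
apply/matrixP=> k j; rewrite !mxE mulr_suml.
by apply: eq_bigr => a _; rewrite tensvE ord1 mulrAC mulrA.
Qed.

Lemma lsl_delta a k x : lsl (delta_mx 0 a) x k 0 = x (mxtens_index (a, k)) 0.
Proof.
rewrite mxE (bigD1 a) //= mxE !eqxx mul1r big1 ?addr0 // => b ba.
by rewrite mxE (negbTE ba) andbF mul0r.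
Qed.

Lemma rsl_delta a k x : rsl (delta_mx 0 a) x k 0 = x (mxtens_index (k, a)) 0.
Proof.
rewrite mxE (bigD1 a) //= mxE !eqxx mul1r big1 ?addr0 // => b ba.
by rewrite mxE (negbTE ba) andbF mul0r.
Qed.

Lemma tens_sum_delta x : x = \sum_a \sum_b x (mxtens_index (a, b)) 0 *:
  ((delta_mx a 0 : 'cV_m) *t (delta_mx b 0 : 'cV_n)).
Proof.
apply/matrixP=> i j; case: (mxtens_indexP i) => a b; rewrite ord1.
rewrite summxE (bigD1 a) //= summxE (bigD1 b) //= mxE tensvE !mxE !eqxx !mulr1.
rewrite big1 => [|c cb]; last first.
  by rewrite mxE tensvE !mxE (eq_sym b) (negbTE cb) !mulr0.
rewrite addr0 big1 ?addr0 // => c ca; rewrite summxE big1 // => d _.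
by rewrite mxE tensvE !mxE (eq_sym a) (negbTE ca) mul0r mulr0.
Qed.

Lemma tens_ind (S : 'cV[K]_(m * n) -> Prop) : subspace S ->
  (forall (u : 'cV_m) (v : 'cV_n), S (u *t v)) -> forall x, S x.
Proof.
move=> sS h x; rewrite (tens_sum_delta x).
by do 2! (apply: subspace_sum => // ? _ _); apply: subspaceZ.
Qed.

Lemma eqmx_tens p (A B : 'M[K]_(p, m * n)) :
  (forall (u : 'cV_m) (v : 'cV_n), A *m (u *t v) = B *m (u *t v)) -> A = B.
Proof.
move=> e; have ex : forall x, A *m x = B *m x.
  by apply: tens_ind; first exact: subspace_eqmx.
apply/matrixP=> i j; have /matrixP/(_ i 0) := ex (delta_mx j 0).
by rewrite -!colE !mxE.
Qed.

End Slices.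

(* [tensmx_mul] for vectors, whose tensor product has 1 rather than 1 * 1      *)
(* columns.                                                                    *)
Lemma tensv_mul (K : fieldType) m n p r (A : 'M[K]_(m, n)) (B : 'M[K]_(p, r))
    (u : 'cV_n) (v : 'cV_r) :
  (A *t B) *m (u *t v : 'cV_(n * r)) = (A *m u) *t (B *m v) :> 'cV_(m * p).
Proof. exact: (tensmx_mul A B u v). Qed.

Lemma swap_tensv (K : fieldType) m n (u : 'cV[K]_m) (v : 'cV[K]_n) :
  swap_mx K m n *m (u *t v : 'cV_(m * n)) = v *t u :> 'cV_(n * m).
Proof. exact: swap_mxE. Qed.

Lemma swap_tens (K : fieldType) n (A B : 'M[K]_n) :
  swap_mx K n n *m (A *t B) = (B *t A) *m swap_mx K n n.
Proof.
apply: eqmx_tens => u v.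
by rewrite -!mulmxA swap_tensv !tensv_mul swap_tensv.
Qed.

Section CastA.
Variables (K : fieldType) (n : nat).
Definition castA (x : 'cV[K]_(n * n * n)) : 'cV[K]_(n * (n * n)) :=
  castmx (esym (mulnA n n n), erefl 1%N) x.

Lemma castAD a x y : castA (a *: x + y) = a *: castA x + castA y.
Proof. by apply/matrixP=> i j; rewrite !(castmxE, mxE). Qed.

Lemma castA0 : castA 0 = 0.
Proof. by apply/matrixP=> i j; rewrite !(castmxE, mxE). Qed.

Lemma castA_eq0 x : castA x = 0 -> x = 0.
Proof.
move=> e; rewrite -(castmxK (esym (mulnA n n n)) (erefl 1%N) x).
rewrite -/(castA x) e; apply/matrixP=> i j; by rewrite !(castmxE, mxE).
Qed.

Lemma castA_tens (A B C : 'M[K]_n) x :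
  castA ((A *t B *t C) *m x) = (A *t (B *t C)) *m castA x.
Proof.
move: x; apply: tens_ind.
  split=> [|a x y ex ey]; first by rewrite !(castA0, mulmx0).
  by rewrite mulmxDr -scalemxAr !castAD ex ey mulmxDr -scalemxAr.
move=> u w; move: u; apply: tens_ind.
  split=> [|a x y ex ey]; first by rewrite tens0mx !(castA0, mulmx0).
  by rewrite tensDl tensZl mulmxDr -scalemxAr !castAD ex ey mulmxDr -scalemxAr.
by move=> u v; rewrite !tensv_mul /castA !tens_castA !tensv_mul.
Qed.

(** Both sides contract the tensor with r, s and t in its three factors; on pure tensors they are
    the same product of three scalars. *)
Lemma rsl_lsl_castA (r s t : 'rV[K]_n) x :
  (s *m lsl r (rsl t x)) 0 0 = (t *m lsl s (lsl r (castA x))) 0 0.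
Proof.
move: x; apply: tens_ind.
  split=> [|a x y ex ey]; first by rewrite !(castA0, rsl0, lsl0, mulmx0).
  rewrite castAD !(rslD, lslD, rslZ, lslZ) !mulmxDr -!scalemxAr.
  by rewrite 2!mxE ex ey !mxE.
move=> u w; move: u; apply: tens_ind.
  split=> [|a x y ex ey]; first by rewrite tens0mx !(castA0, rsl0, lsl0, mulmx0).
  rewrite tensDl tensZl castAD !(rslD, lslD, rslZ, lslZ) !mulmxDr -!scalemxAr.
  by rewrite 2!mxE ex ey !mxE.
move=> u v; rewrite /castA tens_castA.
have Z a (A : 'M[K]_1) : (a *: A) 0 0 = a * A 0 0 by rewrite mxE.
rewrite !(rsl_tensv, lsl_tensv, lslZ) -!scalemxAr !Z.
by ring.
Qed.

End CastA.

Lemma subspace_tensl (K : fieldType) m n (S : 'cV[K]_(m * n) -> Prop) (v : 'cV_n) :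
  subspace S -> subspace (fun u : 'cV[K]_m => S (u *t v)).
Proof.
move=> sS; split=> [|a x y Sx Sy]; first by rewrite tens0mx; apply: sS.1.
by rewrite tensDl tensZl; apply: sS.2.
Qed.

Lemma subspace_tensr (K : fieldType) m n (S : 'cV[K]_(m * n) -> Prop) (u : 'cV_m) :
  subspace S -> subspace (fun v : 'cV[K]_n => S (u *t v)).
Proof.
move=> sS; split=> [|a x y Sx Sy]; first by rewrite tensmx0; apply: sS.1.
by rewrite tensDr tensZr; apply: sS.2.
Qed.

(** Replaces the span defining W (x) V by a linear equation: the slices of x along a basis of the
    second factor are killed by [P] one by one. *)
Lemma tens_sub_kerP (K : fieldType) m n (A : 'cV[K]_m -> Prop) (P : 'M[K]_m) :
  (forall u, A u <-> P *m u = 0) -> forall x : 'cV[K]_(m * n),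
  tens_sub A (fun _ => True) x <-> (P *t 1%:M) *m x = 0.
Proof.
move=> AP x; split.
  apply: (lspan_min (subspace_ker _)) => y [a [b [/AP Pa _ ->]]].
  by rewrite tensv_mul Pa tens0mx.
move=> e; have -> : x = \sum_(b < n) rsl (delta_mx 0 b) x *t (delta_mx b 0 : 'cV_n).
  apply/matrixP=> i j; case: (mxtens_indexP i) => a b; rewrite ord1 summxE.
  rewrite (bigD1 b) //= tensvE rsl_delta !mxE !eqxx mulr1 big1 ?addr0 // => c cb.
  by rewrite tensvE !mxE (eq_sym b) (negbTE cb) mulr0.
apply: (subspace_sum (subspace_lspan _)) => b _ _.
apply: lspan_gen; exists (rsl (delta_mx 0 b) x), (delta_mx b 0); split => //.
by apply/AP; rewrite -[delta_mx 0 b]mulmx1 -rsl_tens e rsl0.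
Qed.

Lemma tens_sub_kerPr (K : fieldType) m n (A : 'cV[K]_n -> Prop) (P : 'M[K]_n) :
  (forall u, A u <-> P *m u = 0) -> forall x : 'cV[K]_(m * n),
  tens_sub (fun _ => True) A x <-> (1%:M *t P) *m x = 0.
Proof.
move=> AP x; split.
  apply: (lspan_min (subspace_ker _)) => y [a [b [_ /AP Pb ->]]].
  by rewrite tensv_mul Pb tensmx0.
move=> e; have -> : x = \sum_(a < m) (delta_mx a 0 : 'cV_m) *t lsl (delta_mx 0 a) x.
  apply/matrixP=> i j; case: (mxtens_indexP i) => a b; rewrite ord1 summxE.
  rewrite (bigD1 a) //= tensvE lsl_delta !mxE !eqxx mul1r big1 ?addr0 // => c ca.
  by rewrite tensvE !mxE (eq_sym a) (negbTE ca) mul0r.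
apply: (subspace_sum (subspace_lspan _)) => a _ _.
apply: lspan_gen; exists (delta_mx a 0), (lsl (delta_mx 0 a) x); split => //.
by apply/AP; rewrite -[delta_mx 0 a]mulmx1 -lsl_tens e lsl0.
Qed.

Section Generic.
Variables (K : fieldType) (q : K).
Hypothesis q_neq0 : q != 0.
Hypothesis q_free : forall n, (0 < n)%N -> q ^+ n != 1.
Implicit Types (M U V W : uqmod q) (mu nu lam : weight).

Lemma in_Of_tens U V : in_Of U -> in_Of V -> in_Of (tens U V).
Proof.
move=> oU oV; apply: tens_ind; first exact: subspace_lspan.
move=> u v; move: (oU u).
apply: (lspan_min (subspace_tensl v (subspace_lspan _))) => x [mu wx].
move: (oV v); apply: (lspan_min (subspace_tensr x (subspace_lspan _))) => y [nu wy].
by apply: lspan_gen; exists (mu + nu) => lam; apply: tens_weight.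
Qed.

Lemma weight_tens U V mu nu u v : weight_vector U mu u -> weight_vector V nu v ->
  weight_vector (tens U V) (mu + nu) (u *t v).
Proof. by move=> wu wv lam; apply: tens_weight. Qed.

Lemma twist_cas M : cas (twist M) = cas M.
Proof.
rewrite /cas /= opprK.
have -> : actE M *m actF M = actF M *m actE M +
    (q - q^-1)^-1 *: (actK M alpha - actK M (- alpha)).
  by rewrite -actEF addrC subrK.
have h0 : q * q - 1 != 0 by rewrite -expr2 subr_eq0 q_free.
by apply/matrixP=> i j; rewrite !mxE; field; rewrite q_neq0 h0.
Qed.

Lemma cas_wd_le M mu d z : in_Of M -> weight_vector M mu z -> z != 0 ->
  0 <= d -> cas M *m z = cval q d *: z -> wd mu <= d.
Proof.
move=> oM wz z0 d0 cz.
have [n [nz e]] : exists n, actE M ^+ n *m z != 0 /\ actE M *m (actE M ^+ n *m z) = 0.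
  have ex : exists n, actE M ^+ n *m z == 0.
    by exists (udim M); rewrite (E_nil q_neq0 q_free oM) mul0mx.
  case: (ex_minnP ex) => -[|n] hn mn.
    by move: hn; rewrite expr0 mul1mx (negbTE z0).
  exists n; split; first by apply/negP => /mn; rewrite ltnn.
  by apply/eqP; rewrite mulmxA; move: hn; rewrite exprS.
have wE := weightEX q_neq0 n wz.
have := hw_ge0 q_neq0 q_free wE e oM nz.
have := cas_hw q_neq0 q_free wE e 0; rewrite expr0 !mul1mx.
have -> : cas M *m (actE M ^+ n *m z) = cval q d *: (actE M ^+ n *m z).
  rewrite mulmxA; have -> : cas M *m actE M ^+ n = actE M ^+ n *m cas M.
    elim: (n) => [|k IH]; first by rewrite !expr0 mulmx1 mul1mx.
    by rewrite exprS -[_ * _]/(_ *m _) mulmxA (cas_E q_neq0 q_free) -!mulmxA IH.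
  by rewrite -mulmxA cz scalemxAr.
move/eqP; rewrite -subr_eq0 -scalerBl scaler_eq0 (negbTE nz) orbF subr_eq0.
by move=> /eqP/(cval_inj q_neq0 q_free d0) + w0 => /(_ w0) ->; rewrite wdDn; lia.
Qed.

(** The lower bound is the upper bound in the twisted module, where the Casimir element acts by the
    same matrix. *)
Lemma cas_wd M mu d z : in_Of M -> weight_vector M mu z -> z != 0 ->
  0 <= d -> cas M *m z = cval q d *: z -> - d <= wd mu <= d.
Proof.
move=> oM wz z0 d0 cz; apply/andP; split; last exact: (cas_wd_le oM wz).
have := cas_wd_le (twist_Of oM) (twist_weight wz) z0 d0.
rewrite twist_cas => /(_ cz); rewrite -[wd (- mu)]wdE wipNr wdE; lia.
Qed.

End Generic.

(** * The tensor powers of V_l *)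

Section Cube.
Variables (K : fieldType) (q : K).
Hypothesis q_neq0 : q != 0.
Hypothesis q_free : forall n, (0 < n)%N -> q ^+ n != 1.
Variable l : nat.
Local Notation V := (simple_mod q_neq0 (l%:Z, 0)).
Local Notation VV := (tens V V).
Local Notation n := (udim V).
Local Notation qi := (qint q).

Lemma dimE : `|(l%:Z, 0 : int).1 - (l%:Z, 0 : int).2|%N = l.
Proof. by rewrite /=; lia. Qed.

Lemma dimZ : (`|(l%:Z, 0 : int).1 - (l%:Z, 0 : int).2|%N)%:Z = l%:Z.
Proof. by rewrite dimE. Qed.

Lemma ord_le (i : 'I_n) : (i <= l)%N.
Proof. by have := ltn_ord i; rewrite /=; lia. Qed.

Lemma qi0 : qi 0 = 0.
Proof. by rewrite /qint oppr0 subrr mul0r. Qed.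

Lemma qi_neq0 (a : int) : a != 0 -> qi a != 0.
Proof.
move=> a0; rewrite mulf_neq0 ?invr_neq0 ?(h_neq0 q_neq0) // subr_eq0.
by apply/eqP => /(qzI q_neq0 q_free) e; move: a0; lia.
Qed.

(** Indexing by all integers, with value 0 out of range, spares the boundary cases: in [E_bv] and
    [F_bv] the q-integer vanishes exactly where the shifted index re-enters the range. *)
Definition bv (b : int) : 'cV[K]_n := \col_i ((nat_of_ord i)%:Z == b)%:R.
Definition rv (b : int) : 'rV[K]_n := (bv b)^T.

Lemma bv_out b : ~~ (0 <= b <= l%:Z) -> bv b = 0.
Proof.
move=> hb; apply/colP => i; rewrite !mxE; case: eqP => // e.
by move: hb; rewrite -e; have := ord_le i; lia.
Qed.

Lemma rv_out b : ~~ (0 <= b <= l%:Z) -> rv b = 0.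
Proof. by move=> hb; rewrite /rv bv_out // trmx0. Qed.

Lemma bv_ord (i : 'I_n) : bv (nat_of_ord i)%:Z = delta_mx i 0.
Proof. by apply/matrixP=> j k; rewrite !mxE ord1 andbT eqz_nat. Qed.

Lemma rv_ord (i : 'I_n) : rv (nat_of_ord i)%:Z = delta_mx 0 i.
Proof. by rewrite /rv bv_ord trmx_delta. Qed.

Lemma ord_of (b : int) : 0 <= b <= l%:Z -> exists i : 'I_n, b = (nat_of_ord i)%:Z.
Proof.
move=> hb; have lt : (`|b|%N < n)%N by rewrite /=; lia.
by exists (Ordinal lt) => /=; lia.
Qed.

Lemma rv_bv a b : rv a *m bv b = ((a == b) && (0 <= a <= l%:Z))%:R%:M.
Proof.
have [ha|ha] := boolP (0 <= a <= l%:Z); last first.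
  by rewrite rv_out // mul0mx andbF raddf0.
have [hb|hb] := boolP (0 <= b <= l%:Z); last first.
  rewrite bv_out // mulmx0 andbT; case: eqP => e; last by rewrite raddf0.
  by move: hb; rewrite -e ha.
have [i ei] := ord_of ha; have [j ej] := ord_of hb.
rewrite ei ej rv_ord bv_ord mul_delta_mx_cond eqz_nat andbT val_eqE.
by apply/matrixP=> x y; rewrite !ord1; case: eqP => _; rewrite !mxE.
Qed.

Lemma E_bv b : actE V *m bv b = qi (l%:Z - b + 1) *: bv (b - 1).
Proof.
have [hb|hb] := boolP (0 <= b <= l%:Z); last first.
  rewrite (bv_out hb) mulmx0; have [->|ne] := eqVneq b (l%:Z + 1).
    have -> : l%:Z - (l%:Z + 1) + 1 = 0 by lia.
    by rewrite qi0 scale0r.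
  by rewrite bv_out ?scaler0 //; move: hb ne; lia.
have [i ei] := ord_of hb; rewrite ei bv_ord -colE.
apply/colP => j; rewrite !mxE dimZ.
have -> : (i == j.+1 :> nat) = (j%:Z == i%:Z - 1) by lia.
case: eqP => [e|_]; last by rewrite mulr0.
have aux (a c : nat) : a%:Z = c%:Z - 1 -> l%:Z - a%:Z = l%:Z - c%:Z + 1 by lia.
by rewrite mulr1 (aux _ _ e).
Qed.

Lemma F_bv b : actF V *m bv b = qi (b + 1) *: bv (b + 1).
Proof.
have [hb|hb] := boolP (0 <= b <= l%:Z); last first.
  rewrite (bv_out hb) mulmx0; have [->|ne] := eqVneq b (- 1).
    by rewrite addNr qi0 scale0r.
  by rewrite bv_out ?scaler0 //; move: hb ne; lia.
have [i ei] := ord_of hb; rewrite ei bv_ord -colE.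
apply/colP => j; rewrite !mxE.
have -> : (j == i.+1 :> nat) = (j%:Z == i%:Z + 1) by lia.
case: eqP => [e|_]; last by rewrite mulr0.
by rewrite mulr1 e.
Qed.

Definition wt0 (b : int) : weight := (l%:Z - b, b).

Lemma K_bv lam b : actK V lam *m bv b = q ^ wip lam (wt0 b) *: bv b.
Proof.
have [hb|hb] := boolP (0 <= b <= l%:Z); last by rewrite bv_out // mulmx0 scaler0.
have [i ei] := ord_of hb; rewrite ei bv_ord.
have := simple_weight_vector q_neq0 i lam; rewrite /= => ->.
by congr (q ^ wip _ _ *: _); rewrite /simple_weight /wt0 dimZ /= !add0r.
Qed.

Lemma weight_bv b : weight_vector V (wt0 b) (bv b).
Proof. by move=> lam; apply: K_bv. Qed.

Lemma rv_ext m (A B : 'M[K]_(m, n)) :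
  (forall b, 0 <= b <= l%:Z -> A *m bv b = B *m bv b) -> A = B.
Proof.
move=> e; apply/matrixP=> i j.
have /e : 0 <= (nat_of_ord j)%:Z <= l%:Z.
  by have := ord_le j; lia.
by rewrite bv_ord -!colE => /matrixP/(_ i 0); rewrite !mxE.
Qed.

(** For the dual basis the bound matters: at b = -1 the left side is 0 while the right side is a
    nonzero multiple of [rv 0]. *)
Lemma rv_E b : 0 <= b -> rv b *m actE V = qi (l%:Z - b) *: rv (b + 1).
Proof.
move=> b0; apply: rv_ext => c hc; rewrite -mulmxA E_bv -scalemxAr -scalemxAl !rv_bv.
have [e|ne] := eqVneq b (c - 1).
  have -> : (b + 1 == c) by lia.
  have [h1|h1] := boolP (0 <= b <= l%:Z); last by move: h1; lia.
  have -> : 0 <= b + 1 <= l%:Z by lia.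
  by congr (qi _ *: _); lia.
have -> : (b + 1 == c) = false by lia.
by rewrite /= !raddf0.
Qed.

Lemma rv_F b : b <= l%:Z -> rv b *m actF V = qi b *: rv (b - 1).
Proof.
move=> bl; apply: rv_ext => c hc; rewrite -mulmxA F_bv -scalemxAr -scalemxAl !rv_bv.
have [e|ne] := eqVneq b (c + 1).
  have -> : (b - 1 == c) by lia.
  have -> : 0 <= b <= l%:Z by lia.
  have -> : 0 <= b - 1 <= l%:Z by lia.
  by congr (qi _ *: _); lia.
have -> : (b - 1 == c) = false by lia.
by rewrite /= !raddf0.
Qed.

Lemma rv_K lam b : rv b *m actK V lam = q ^ wip lam (wt0 b) *: rv b.
Proof.
apply: rv_ext => c hc; rewrite -mulmxA K_bv -scalemxAr -scalemxAl !rv_bv.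
by have [->|ne] := eqVneq b c => //=; rewrite !raddf0.
Qed.

Lemma oV : in_Of V. Proof. exact: simple_in_Of. Qed.
Lemma oVV : in_Of VV. Proof. exact/(in_Of_tens q_neq0)/oV/oV. Qed.
Lemma oVVV : in_Of (tens VV V). Proof. exact/(in_Of_tens q_neq0)/oV/oVV. Qed.

Definition cf2 (b c : int) (x : 'cV[K]_(n * n)) : K := (rv b *m rsl (rv c) x) 0 0.
Definition cf3 (a b c : int) (x : 'cV[K]_(n * n * n)) : K := cf2 a b (rsl (rv c) x).

Lemma cf2D b c k x y : cf2 b c (k *: x + y) = k * cf2 b c x + cf2 b c y.
Proof. by rewrite /cf2 rslD rslZ mulmxDr -scalemxAr !mxE. Qed.

Lemma cf20 b c : cf2 b c 0 = 0.
Proof. by rewrite /cf2 rsl0 mulmx0 mxE. Qed.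

Lemma cf2Z b c k x : cf2 b c (k *: x) = k * cf2 b c x.
Proof. by rewrite -[k *: x]addr0 cf2D cf20 addr0. Qed.

Lemma cf2A b c x y : cf2 b c (x + y) = cf2 b c x + cf2 b c y.
Proof. by rewrite -[x]scale1r cf2D scale1r mul1r. Qed.

Lemma cf2_sum b c (I : Type) (r : seq I) (P : pred I) (f : I -> 'cV_(n * n)) :
  cf2 b c (\sum_(i <- r | P i) f i) = \sum_(i <- r | P i) cf2 b c (f i).
Proof.
by apply: (big_morph (cf2 b c)); [exact: cf2A | exact: cf20].
Qed.

Lemma cf2_out b c x : ~~ ((0 <= b <= l%:Z) && (0 <= c <= l%:Z)) -> cf2 b c x = 0.
Proof.
rewrite negb_and /cf2 => /orP[h|h]; first by rewrite rv_out // mul0mx mxE.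
by rewrite (rv_out h) -(scale0r (0 : 'rV_n)) rslZl scale0r mulmx0 mxE.
Qed.

Lemma cf2_ord (i j : 'I_n) x :
  cf2 (nat_of_ord i)%:Z (nat_of_ord j)%:Z x = x (mxtens_index (i, j)) 0.
Proof. by rewrite /cf2 !rv_ord -rowE mxE rsl_delta. Qed.

Lemma cf2_ext x y : (forall b c, 0 <= b <= l%:Z -> 0 <= c <= l%:Z ->
  cf2 b c x = cf2 b c y) -> x = y.
Proof.
move=> e; apply/matrixP=> i j; case: (mxtens_indexP i) => a b; rewrite ord1.
by rewrite -!cf2_ord; apply: e; [have := ord_le a | have := ord_le b]; lia.
Qed.

Lemma cf2_tens b c (A B : 'M[K]_n) x r s b' c' :
  rv b *m A = r *: rv b' -> rv c *m B = s *: rv c' ->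
  cf2 b c ((A *t B) *m x) = r * s * cf2 b' c' x.
Proof.
move=> eA eB; rewrite /cf2 rsl_tens mulmxA eA eB rslZl -!scalemxAl -scalemxAr.
by rewrite mxE [in LHS]mxE mulrA.
Qed.

Lemma cf2_bv b c b' c' : cf2 b c (bv b' *t bv c') =
  ((b == b') && (0 <= b <= l%:Z) && ((c == c') && (0 <= c <= l%:Z)))%:R.
Proof.
rewrite /cf2 rsl_tensv -scalemxAr mxE !rv_bv !mxE eqxx !mulr1n.
by case: (_ && _); case: (_ && _); rewrite ?mulr0 ?mul0r ?mulr1.
Qed.

Definition wt2 (m : int) : weight := (l%:Z *+ 2 - m, m).
Definition wt3 (m : int) : weight := (l%:Z *+ 3 - m, m).

Lemma rv1 b : rv b *m 1%:M = 1 *: rv b.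
Proof. by rewrite mulmx1 scale1r. Qed.

Lemma cf2_E b c x : 0 <= b -> 0 <= c -> cf2 b c (tensE V V *m x) =
  qi (l%:Z - b) * cf2 (b + 1) c x + q ^ (l%:Z - b *+ 2) * qi (l%:Z - c) * cf2 b (c + 1) x.
Proof.
move=> b0 c0; rewrite mulmxDl -[_ *m x]scale1r cf2D mul1r.
rewrite (cf2_tens _ (rv_E b0) (rv1 c)) mulr1.
rewrite (cf2_tens _ (rv_K alpha b) (rv_E c0)); congr (_ + q ^ _ * _ * _).
by rewrite /wip /wt0 /=; lia.
Qed.

Lemma cf2_K b c lam x : cf2 b c (actK VV lam *m x) = q ^ wip lam (wt2 (b + c)) * cf2 b c x.
Proof.
rewrite (cf2_tens _ (rv_K lam b) (rv_K lam c)) -(qzD q_neq0) -wipDr; congr (q ^ wip _ _ * _).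
by congr (_, _); rewrite /=; lia.
Qed.

Lemma cf2_F b c x : b <= l%:Z -> c <= l%:Z -> cf2 b c (tensF V V *m x) =
  q ^ (c *+ 2 - l%:Z) * qi b * cf2 (b - 1) c x + qi c * cf2 b (c - 1) x.
Proof.
move=> bl cl; rewrite mulmxDl -[_ *m x]scale1r cf2D mul1r.
rewrite (cf2_tens _ (rv_F bl) (rv_K (- alpha) c)).
rewrite (cf2_tens _ (rv1 b) (rv_F cl)) mul1r [_ * q ^ _]mulrC; congr (q ^ _ * _ * _ + _).
by rewrite /wip /wt0 /=; lia.
Qed.

Lemma cf2_cas b c x : cf2 b c (cas VV *m x) =
  cf2 b c (tensF V V *m (tensE V V *m x)) + cval q ((l%:Z - b - c) *+ 2) * cf2 b c x.
Proof.
rewrite /cas mulmxDl -[_ *m x]scale1r cf2D mul1r mulmxA; congr (_ + _).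
rewrite -scalemxAl cf2Z mulmxDl -!scalemxAl cf2D cf2Z !cf2_K /cval -mulrA; congr (_ * _).
rewrite !mulrA -mulrDl; congr (_ * _); rewrite -{1}[q]expr1z -[q^-1]exprN1 -!(qzD q_neq0).
by congr (q ^ _ + q ^ _); rewrite /wip /=; lia.
Qed.

Lemma cf2_weight b c m x : weight_vector VV (wt2 m) x -> b + c != m -> cf2 b c x = 0.
Proof.
move=> wx ne; have := cf2_K b c (0, 1) x; rewrite wx cf2Z => /eqP.
rewrite -subr_eq0 -mulrBl mulf_eq0 => /orP[|/eqP//].
rewrite subr_eq0 => /eqP/(qzI q_neq0 q_free); rewrite /wip /=.
by move: ne; lia.
Qed.

Lemma weight_wt2 mu x : weight_vector VV mu x -> x != 0 ->
  exists2 m : int, mu = wt2 m & 0 <= m <= l%:Z *+ 2.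
Proof.
move=> wx /matrix0Pn[i [j]]; case: (mxtens_indexP i) => b c.
rewrite (ord1 j) -cf2_ord; move: (ord_le b) (ord_le c).
move: (nat_of_ord b) (nat_of_ord c) => {}b {}c bl cl ne.
exists (b%:Z + c%:Z); last lia.
have e lam : wip lam mu = wip lam (wt2 (b%:Z + c%:Z)).
  apply: (qzI q_neq0 q_free); have := cf2_K b%:Z c%:Z lam x; rewrite wx cf2Z.
  exact: mulIf.
have := e (1, 0); have := e (0, 1).
rewrite /wip /= !mul0r !mul1r !add0r !addr0.
by case: mu {wx e} => u v /= -> ->.
Qed.

End Cube.

Lemma lsl_rsl (K : fieldType) m n (r : 'rV[K]_m) (s : 'rV[K]_n) (x : 'cV_(m * n)) :
  (s *m lsl r x) 0 0 = (r *m rsl s x) 0 0.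
Proof.
move: x; apply: tens_ind.
  split=> [|a x y ex ey]; first by rewrite rsl0 lsl0 !mulmx0.
  by rewrite !(rslD, lslD, rslZ, lslZ) !mulmxDr -!scalemxAr 2!mxE ex ey !mxE.
move=> u v; rewrite lsl_tensv rsl_tensv -!scalemxAr mxE [in RHS]mxE.
by rewrite mulrC.
Qed.

(** * Highest weight vectors of a tensor product with V *)

Section Cube2.
Variables (K : fieldType) (q : K).
Hypothesis q_neq0 : q != 0.
Hypothesis q_free : forall n, (0 < n)%N -> q ^+ n != 1.
Variable l : nat.
Local Notation V := (simple_mod q_neq0 (l%:Z, 0)).
Local Notation VV := (tens V V).
Local Notation n := (udim V).
Local Notation qi := (qint q).
Local Notation bv := (bv q_neq0 l).
Local Notation rv := (rv q_neq0 l).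
Local Notation cf2 := (@cf2 K q q_neq0 l).
Local Notation wt0 := (wt0 l).
Local Notation wt2 := (wt2 l).

Section Lift.
Variables (U : uqmod q) (mu : weight) (u : 'cV[K]_(udim U)).
Hypotheses (wu : weight_vector U mu u) (Eu : actE U ^+ l.+1 *m u = 0).

(** The ratio of consecutive coefficients is forced by E x = 0: E (x) 1 on the term c and K_alpha
    (x) E on the term c + 1 must cancel. *)
Definition lift_coef (c : nat) : K :=
  \prod_(i < c) (- (qi (l%:Z - i%:Z))^-1 * q ^ (- (wd mu + (i%:Z + 1) *+ 2))).

Definition hw_lift : 'cV[K]_(udim U * n) :=
  \sum_(c < l.+1) (lift_coef c *: (actE U ^+ c *m u)) *t bv c%:Z.

Lemma hw_liftE : tensE U V *m hw_lift = 0.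
Proof.
pose A c : 'cV[K]_(udim U * n) := (lift_coef c *: (actE U ^+ c.+1 *m u)) *t bv c%:Z.
pose B c : 'cV[K]_(udim U * n) := (lift_coef c * q ^ (wd mu + c%:Z *+ 2) *
  qi (l%:Z - c%:Z + 1)) *: ((actE U ^+ c *m u) *t bv (c%:Z - 1)).
rewrite /hw_lift mulmx_sumr.
transitivity (\sum_(c < l.+1) (A c + B c)).
  apply: eq_bigr => c _; rewrite mulmxDl !tensv_mul mul1mx E_bv.
  rewrite -!scalemxAr mulmxA -[actE U *m _]/(_ * _) -exprS; congr (_ + _).
  rewrite (weightEX q_neq0 c wu) scalerA tensZl tensZr scalerA.
  by rewrite wdE wdDn.
(* The last [A] vanishes by [Eu] and the first [B] because its index is out of range; the others
   cancel in pairs [A c], [B c.+1]. *)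
rewrite big_split /= big_ord_recr [X in _ + X]big_ord_recl /=.
rewrite /A Eu scaler0 tens0mx addr0 /B (bv_out q_neq0 (b := 0 - 1)) // tensmx0.
rewrite scaler0 add0r -big_split big1 // => c _ /=.
rewrite /bump /= add1n tensZl.
have -> : c.+1%:Z - 1 = c%:Z by lia.
rewrite -scalerDl /lift_coef big_ord_recr /=.
have -> : l%:Z - c.+1%:Z + 1 = l%:Z - c%:Z by lia.
have -> : wd mu + c.+1%:Z *+ 2 = wd mu + (c%:Z + 1) *+ 2 by lia.
move: (wd mu + _) (\prod_(i < c) _) => z P.
have Q0 : qi (l%:Z - c%:Z) != 0.
  by apply: (qi_neq0 q_neq0 q_free); have := ltn_ord c; lia.
have XY := qzD q_neq0 (- z) z; rewrite addNr expr0z in XY.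
move: Q0 XY; move: (qi _) (q ^ (- z)) (q ^ z) => Q X Y Q0 XY.
have -> : P + P * (- Q^-1 * X) * Y * Q = P - P * (X * Y) * (Q^-1 * Q) by ring.
by rewrite -XY mulVf // !mulr1 subrr scale0r.
Qed.

Lemma hw_lift_weight : weight_vector (tens U V) (mu + (l%:Z, 0)) hw_lift.
Proof.
have sW := @subspace_weight K q (tens U V) (mu + (l%:Z, 0)).
rewrite /hw_lift; apply: (subspace_sum sW) => c _ _; rewrite tensZl.
apply: (subspaceZ _ sW).
have -> : mu + (l%:Z, 0) = (mu + alpha *+ c) + wt0 c%:Z.
  rewrite -addrA; congr (_ + _).
  have -> : alpha *+ c = (c%:Z, - c%:Z).
    elim: (nat_of_ord c) => // k IH; rewrite mulrSr IH; congr (_, _); rewrite /=; lia.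
  by congr (_, _); rewrite /=; lia.
by apply: weight_tens => //; [apply: weightEX | apply: weight_bv].
Qed.

Lemma rsl_hw_lift : rsl (rv 0) hw_lift = u.
Proof.
rewrite /hw_lift big_ord_recl rslD rsl_tensv rv_bv eqxx /= mxE eqxx scale1r.
rewrite /lift_coef big_ord0 expr0 mul1mx scale1r rsl_sum big1 ?addr0 // => c _.
rewrite rsl_tensv rv_bv.
have -> : (0 == (lift ord0 c : nat)%:Z :> int) = false by rewrite lift0.
by rewrite /= !mxE mul0rn scale0r.
Qed.

Lemma hw_lift_fix (P : 'M[K]_(udim U)) : P *m actE U = actE U *m P -> P *m u = u ->
  (P *t 1%:M) *m hw_lift = hw_lift.
Proof.
move=> PE Pu; rewrite mulmx_sumr; apply: eq_bigr => c _.
rewrite tensv_mul mul1mx -scalemxAr.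
suff e : P *m actE U ^+ c = actE U ^+ c *m P by rewrite mulmxA e -mulmxA Pu.
elim: (nat_of_ord c) => [|k IH]; first by rewrite !expr0 mulmx1 mul1mx.
by rewrite exprS -[_ * _]/(_ *m _) mulmxA PE -!mulmxA IH.
Qed.

End Lift.

Lemma rsl_rv_ext m (x : 'cV[K]_(m * n)) :
  (forall c : int, 0 <= c <= l%:Z -> rsl (rv c) x = 0) -> x = 0.
Proof.
move=> e; apply/matrixP=> i j; case: (mxtens_indexP i) => a b; rewrite ord1.
rewrite -rsl_delta -rv_ord e ?mxE //.
by have := ord_le b; lia.
Qed.

Lemma lsl_rv_ext m (x : 'cV[K]_(n * m)) :
  (forall c : int, 0 <= c <= l%:Z -> lsl (rv c) x = 0) -> x = 0.
Proof.
move=> e; apply/matrixP=> i j; case: (mxtens_indexP i) => a b; rewrite ord1.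
rewrite -lsl_delta -rv_ord e ?mxE //.
by have := ord_le a; lia.
Qed.

(** The equation E x = 0 expresses the slice of x along v_(k+1) by E and K_(-alpha) applied to the
    slice along v_k. Hence an operator commuting with E and K_alpha that kills the slice along v_0
    kills them all. *)
Lemma hw_right U (P : 'M[K]_(udim U)) x : P *m actE U = actE U *m P ->
  P *m actK U alpha = actK U alpha *m P -> tensE U V *m x = 0 ->
  P *m rsl (rv 0) x = 0 -> (P *t 1%:M) *m x = 0.
Proof.
move=> PE PK Ex P0; apply: rsl_rv_ext => c hc.
rewrite rsl_tens mulmx1; have [k ek] : exists k : nat, c = k%:Z by exists `|c|%N; lia.
move: hc; rewrite ek {c ek} => /andP[_]; elim: k => [//|k IH] hk.
have zk : P *m rsl (rv k%:Z) x = 0 by apply: IH; lia.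
have := congr1 (rsl (rv k%:Z)) Ex; rewrite mulmxDl rslD !rsl_tens rsl0 mulmx1.
rewrite rv_E // rslZl -scalemxAr; have -> : k%:Z + 1 = k.+1%:Z by lia.
move/(congr1 (mulmx (actK U (- alpha) *m P))); rewrite mulmx0 mulmxDr.
rewrite -!mulmxA [P *m (actE U *m _)]mulmxA PE -[actE U *m P *m _]mulmxA zk !mulmx0 add0r.
rewrite -!scalemxAr [P *m (actK _ _ *m _)]mulmxA PK !mulmxA actKD addNr actK0 mul1mx.
move/eqP; rewrite scaler_eq0 => /orP[|/eqP//].
by rewrite (negbTE (qi_neq0 q_neq0 q_free _)) //; lia.
Qed.

Lemma hw_left U (P : 'M[K]_(udim U)) x : P *m actE U = actE U *m P ->
  tensE V U *m x = 0 -> P *m lsl (rv 0) x = 0 -> (1%:M *t P) *m x = 0.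
Proof.
move=> PE Ex P0; apply: lsl_rv_ext => c hc.
rewrite lsl_tens mulmx1; have [k ek] : exists k : nat, c = k%:Z by exists `|c|%N; lia.
move: hc; rewrite ek {c ek} => /andP[_]; elim: k => [//|k IH] hk.
have zk : P *m lsl (rv k%:Z) x = 0 by apply: IH; lia.
have := congr1 (lsl (rv k%:Z)) Ex; rewrite mulmxDl lslD !lsl_tens lsl0 mul1mx.
rewrite rv_E // rv_K !lslZl; have -> : k%:Z + 1 = k.+1%:Z by lia.
move/(congr1 (mulmx P)); rewrite mulmx0 mulmxDr -!scalemxAr mulmxA PE -mulmxA zk.
rewrite mulmx0 scaler0 addr0 => /eqP; rewrite scaler_eq0 => /orP[|/eqP//].
by rewrite (negbTE (qi_neq0 q_neq0 q_free _)) //; lia.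
Qed.

Lemma hw_right0 U (x : 'cV_(udim U * n)) : tensE U V *m x = 0 -> rsl (rv 0) x = 0 -> x = 0.
Proof.
move=> Ex e; rewrite -[x]mul1mx -tens11.
by apply: hw_right; rewrite ?mul1mx ?mulmx1 ?e ?mulmx0.
Qed.

Lemma hw_left0 U (x : 'cV_(n * udim U)) : tensE V U *m x = 0 -> lsl (rv 0) x = 0 -> x = 0.
Proof.
move=> Ex e; rewrite -[x]mul1mx -tens11.
by apply: hw_left; rewrite ?mul1mx ?mulmx1 ?e ?mulmx0.
Qed.

Lemma hw2_unique (m : int) y : tensE V V *m y = 0 -> weight_vector VV (wt2 m) y ->
  cf2 0 m y = 0 -> y = 0.
Proof.
move=> Ey wy e; apply: (hw_left0 (U := V)) => //.
apply/colP => i; rewrite [RHS]mxE.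
have -> : lsl (rv 0) y i 0 = cf2 0 (nat_of_ord i)%:Z y.
  by rewrite /cf2 -lsl_rsl rv_ord -rowE [RHS]mxE.
have [->//|ne] := eqVneq ((nat_of_ord i)%:Z) m.
by rewrite (cf2_weight q_free wy) ?add0r.
Qed.

End Cube2.

Lemma R0_tensv (K : fieldType) (q : K) (Ru : universal_R q) (U W : uqmod q) lam mu u v :
  in_Of U -> in_Of W -> weight_vector U lam u -> weight_vector W mu v ->
  R0_mx Ru U W *m (u *t v : 'cV_(udim U * udim W)) = q ^ wip lam mu *: (u *t v).
Proof. by move=> oU oW wu wv; apply: R0_mxE. Qed.

(** * The decomposition of V (x) V *)

Section Cube3.
Variables (K : fieldType) (q : K).
Hypothesis q_neq0 : q != 0.
Hypothesis q_free : forall n, (0 < n)%N -> q ^+ n != 1.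
Variable l : nat.
Local Notation V := (simple_mod q_neq0 (l%:Z, 0)).
Local Notation VV := (tens V V).
Local Notation n := (udim V).
Local Notation qi := (qint q).
Local Notation bv := (bv q_neq0 l).
Local Notation rv := (rv q_neq0 l).
Local Notation cf2 := (@cf2 K q q_neq0 l).
Local Notation wt0 := (wt0 l).
Local Notation wt2 := (wt2 l).
Local Notation oVV := (@oVV K q q_neq0 l).
Local Notation oV := (@oV K q q_neq0 l).

Definition hw2 (j : int) (v : 'cV[K]_(n * n)) :=
  weight_vector VV (wt2 j) v /\ tensE V V *m v = 0.

Lemma wd_wt2 m : wd (wt2 m) = (l%:Z - m) *+ 2.
Proof. by rewrite /wd /=; lia. Qed.

(** Complete reducibility of V (x) V in the form of an induction principle; the bound on [j] is the
    condition [0 <= wd] on highest weights. *)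
Lemma VV_ind (S : 'cV[K]_(n * n) -> Prop) : subspace S ->
  (forall (k j : nat) v, (j <= l)%N -> hw2 j%:Z v -> S (actF VV ^+ k *m v)) ->
  forall x, S x.
Proof.
move=> sS h x; apply: lspan_min (oVV x) => // y [mu wy].
have sT : subspace (fun _ : 'cV[K]_(n * n) => True) by [].
have : hw_span (M := VV) (fun _ => True) y.
  by apply: (hw_spanP q_neq0 q_free) wy => //; exact: oVV.
apply: lspan_min => // z [k [nu [v [[_ wv Ev] ->]]]].
have [->|v0] := eqVneq v 0; first by rewrite mulmx0; apply: sS.1.
have [j ej j0] := weight_wt2 q_free wv v0.
have := hw_ge0 q_neq0 q_free wv Ev oVV v0; rewrite ej wd_wt2 => jl.
have ej' : j = `|j|%N%:Z by lia.
apply: (h _ `|j|%N); first by lia.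
by split=> //; rewrite -ej' -ej.
Qed.

Definition theta (j : int) : K := cval q ((l%:Z - j) *+ 2).

Lemma theta_inj (i j : nat) : (i <= l)%N -> (j <= l)%N ->
  theta i%:Z = theta j%:Z -> i = j.
Proof. by move=> il jl /(cval_inj q_neq0 q_free); lia. Qed.

Definition nodes := [seq theta j%:Z | j <- iota 0 l.+1].

Lemma mem_nodes (j : nat) : (j <= l)%N -> theta j%:Z \in nodes.
Proof. by move=> jl; apply/mapP; exists j; rewrite // mem_iota. Qed.

Lemma cas_hw2 j v k : hw2 j v -> cas VV *m (actF VV ^+ k *m v) = theta j *: (actF VV ^+ k *m v).
Proof. by case=> wv Ev; rewrite (cas_hw q_neq0 q_free wv Ev) wd_wt2. Qed.

Lemma cas_diagz : diagz (cas VV) nodes.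
Proof.
split.
  rewrite map_inj_in_uniq ?iota_uniq // => i j; rewrite !mem_iota => hi hj.
  by apply: theta_inj; lia.
apply: VV_ind; first exact: subspace_lspan.
move=> k j v jl hv; apply: lspan_gen; exists (theta j%:Z); first exact: mem_nodes.
exact: cas_hw2.
Qed.

(** For [j <= l], the projector onto the submodule V_(2l-j,j) of V (x) V. *)
Definition proj2 (j : nat) : 'M[K]_(n * n) := speci (cas VV) nodes (theta j%:Z).

Implicit Types x y : 'cV[K]_(n * n).

Lemma sum_proj2 x : \sum_(j < l.+1) proj2 j *m x = x.
Proof.
rewrite -[RHS](sum_speci x cas_diagz) /nodes big_map -[iota 0 l.+1]/(index_iota 0 l.+1).
by rewrite big_mkord.
Qed.

Lemma cas_proj2 (j : nat) x : (j <= l)%N ->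
  cas VV *m (proj2 j *m x) = theta j%:Z *: (proj2 j *m x).
Proof. by move=> jl; apply: speci_sub; [exact: cas_diagz | exact: mem_nodes]. Qed.

Lemma proj2_eig (i j : nat) x : (i <= l)%N -> (j <= l)%N ->
  cas VV *m x = theta i%:Z *: x -> proj2 j *m x = if i == j then x else 0.
Proof.
move=> il jl e; case: eqP => [ij|ne]; first by apply: speci_id; rewrite -ij.
apply: speci_0 e; first exact: mem_nodes.
by apply/eqP => /(theta_inj il jl).
Qed.

Lemma proj2_proj2 (i j : nat) x : (i <= l)%N -> (j <= l)%N ->
  proj2 j *m (proj2 i *m x) = if i == j then proj2 i *m x else 0.
Proof. by move=> il jl; apply: proj2_eig => //; apply: cas_proj2. Qed.

Lemma proj2_E j : proj2 j *m tensE V V = tensE V V *m proj2 j.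
Proof. exact: (speci_comm _ _ (cas_E q_neq0 q_free VV)). Qed.
Lemma proj2_F j : proj2 j *m tensF V V = tensF V V *m proj2 j.
Proof. exact: (speci_comm _ _ (cas_F q_neq0 q_free VV)). Qed.
Lemma proj2_K j lam : proj2 j *m tensK V V lam = tensK V V lam *m proj2 j.
Proof. exact: (speci_comm _ _ (cas_K q_neq0 VV lam)). Qed.

Lemma proj2_weight j mu x : weight_vector VV mu x -> weight_vector VV mu (proj2 j *m x).
Proof. by move=> wx lam; rewrite mulmxA -proj2_K -mulmxA wx -scalemxAr. Qed.

Lemma proj2_range (j : nat) (m : int) x : (j <= l)%N -> weight_vector VV (wt2 m) x ->
  proj2 j *m x != 0 -> j%:Z <= m <= l%:Z *+ 2 - j%:Z.
Proof.
move=> jl wx x0.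
have := cas_wd q_neq0 q_free oVV (proj2_weight j wx) x0 _ (cas_proj2 x jl).
by rewrite wd_wt2 => /(_ ltac:(lia)); lia.
Qed.

Lemma E_bv_nil (b k : nat) : (b < k)%N -> actE V ^+ k *m bv b%:Z = 0.
Proof.
elim: k b => // k IH [|b] bk; rewrite exprSr -mulmxA E_bv.
  by rewrite bv_out // scaler0 mulmx0.
have -> : b.+1%:Z - 1 = b%:Z by lia.
by rewrite -scalemxAr IH ?scaler0.
Qed.

Lemma bv_neq0 (b : int) : 0 <= b <= l%:Z -> bv b != 0.
Proof.
move=> hb; apply/eqP=> e; have := rv_bv q_neq0 l b b; rewrite e mulmx0 eqxx hb.
by move/matrixP/(_ 0 0); rewrite !mxE /= => /esym/eqP; rewrite oner_eq0.
Qed.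

Lemma hw2_exists (j : nat) : (j <= l)%N -> exists2 v, v != 0 & hw2 j%:Z v.
Proof.
move=> jl; have wb := @weight_bv K q q_neq0 l j%:Z.
have En := @E_bv_nil j l.+1 jl.
exists (hw_lift (U := V) q_neq0 l (wt0 j%:Z) (bv j%:Z)).
  apply/eqP => e; have := rsl_hw_lift (U := V) q_neq0 l (wt0 j%:Z) (bv j%:Z).
  by rewrite e rsl0 => /esym/eqP; rewrite (negbTE (bv_neq0 _)) //; lia.
split; last exact: (hw_liftE (U := V) q_neq0 q_free wb En).
have -> : wt2 j%:Z = wt0 j%:Z + (l%:Z, 0).
  by congr (_, _); rewrite /=; lia.
exact: (hw_lift_weight (U := V) q_neq0 l wb).
Qed.

Lemma proj2_exists (j : nat) (m : int) : (j <= l)%N -> j%:Z <= m <= l%:Z *+ 2 - j%:Z ->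
  exists z, [/\ z != 0, weight_vector VV (wt2 m) z & proj2 j *m z = z].
Proof.
move=> jl hm; have [v v0 hv] := hw2_exists jl.
have [k ek] : exists k : nat, m = j%:Z + k%:Z by exists `|m - j%:Z|%N; lia.
exists (actF VV ^+ k *m v); split.
- apply: (FX_hw_neq0 q_neq0 q_free hv.1 hv.2 v0) => _.
  by rewrite wd_wt2; lia.
- have := weightFX q_neq0 k hv.1.
  have -> // : wt2 j%:Z - alpha *+ k = wt2 m.
  have -> : alpha *+ k = (k%:Z, - k%:Z).
    by elim: (k) => // i IH; rewrite mulrSr IH; congr (_, _); rewrite /=; lia.
  by congr (_, _); rewrite /=; lia.
by rewrite (proj2_eig (i := j)) ?eqxx //; apply: cas_hw2.
Qed.

(** * The eigenvalues of the braiding *)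

Section Braiding.
Variable Ru : universal_R q.
Local Notation Rh := (braiding Ru V V).

Lemma bv_ind (S : 'cV[K]_(n * n) -> Prop) : subspace S ->
  (forall b c : int, 0 <= b <= l%:Z -> 0 <= c <= l%:Z -> S (bv b *t bv c)) ->
  forall x, S x.
Proof.
move=> sS h x; rewrite (tens_sum_delta x).
apply: (subspace_sum sS) => b _ _; apply: (subspace_sum sS) => c _ _.
apply: (subspaceZ _ sS); rewrite -!bv_ord.
by apply: h; [have := ord_le b | have := ord_le c]; lia.
Qed.

Lemma cf2_swap b c x : cf2 b c (swap_mx K n n *m x) = cf2 c b x.
Proof.
move: x; apply: tens_ind.
  split=> [|a x y ex ey]; first by rewrite mulmx0 !cf20.
  by rewrite mulmxDr -scalemxAr !cf2D ex ey.
move=> u v; rewrite swap_tensv /cf2 !rsl_tensv -!scalemxAr mxE [in RHS]mxE.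
by rewrite mulrC.
Qed.

Lemma cf2_R0 b c x :
  cf2 b c (R0_mx Ru V V *m x) = q ^ wip (wt0 b) (wt0 c) * cf2 b c x.
Proof.
move: x; apply: bv_ind.
  split=> [|a x y ex ey]; first by rewrite mulmx0 cf20 mulr0.
  by rewrite mulmxDr -scalemxAr !cf2D ex ey mulrDr mulrCA.
move=> b' c' hb hc; rewrite (R0_tensv Ru oV oV (weight_bv _ _ _) (weight_bv _ _ _)).
rewrite cf2Z !cf2_bv; case: eqP => [->|_] /=; last by rewrite !mulr0.
by case: eqP => [->|_] /=; rewrite ?andbF ?mulr0.
Qed.

(** The terms of R_1 other than the constant one have a factor F acting first, and the image of F
    has no component along v_0. *)
Lemma cf2_R1 c x : cf2 0 c (R1_mx (R1_coef Ru) V V *m x) = cf2 0 c x.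
Proof.
rewrite /R1_mx mulmx_suml cf2_sum big_ord_recl big1 => [|i _].
  rewrite addr0 R1_coef0 scale1r !expr0.
  have -> : (1 *t 1 : 'M[K]_(n * n)) = 1%:M by exact: tens11.
  by rewrite mul1mx.
rewrite -scalemxAl cf2Z lift0 exprS.
have e0 : rv 0 *m (actF V * actF V ^+ i) = 0 *: rv 0.
  by rewrite mulmxA rv_F // qi0 !scale0r mul0mx.
rewrite /cf2 rsl_tens mulmxA e0 scale0r mul0mx mxE.
by rewrite mulr0.
Qed.

Lemma cf2_Rh (j : int) x : cf2 j 0 (Rh *m x) = q ^ wip (wt0 0) (wt0 j) * cf2 0 j x.
Proof. by rewrite /braiding -!mulmxA cf2_swap cf2_R0 cf2_R1. Qed.

Lemma Rh_E : Rh *m tensE V V = tensE V V *m Rh.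
Proof.
have [eE _ _] := R_intertwines Ru oV oV.
rewrite /braiding -mulmxA eE !mulmxA; congr (_ *m _ *m _).
by rewrite /tensE_op /tensE mulmxDr mulmxDl !swap_tens.
Qed.

Lemma Rh_F : Rh *m tensF V V = tensF V V *m Rh.
Proof.
have [_ eF _] := R_intertwines Ru oV oV.
rewrite /braiding -mulmxA eF !mulmxA; congr (_ *m _ *m _).
by rewrite /tensF_op /tensF mulmxDr mulmxDl !swap_tens addrC.
Qed.

Lemma Rh_K lam : Rh *m tensK V V lam = tensK V V lam *m Rh.
Proof.
have [_ _ eK] := R_intertwines Ru oV oV.
rewrite /braiding -mulmxA eK !mulmxA; congr (_ *m _ *m _).
by rewrite /tensK !swap_tens.
Qed.

Lemma hw2_ratio (j a : nat) y : (a <= j)%N -> hw2 j%:Z y ->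
  cf2 a%:Z (j%:Z - a%:Z) y * \prod_(i < a) qi (l%:Z - i%:Z) =
  (- 1) ^+ a * q ^ (a%:Z * l%:Z - a%:Z * (a%:Z - 1)) *
    \prod_(i < a) qi (l%:Z - j%:Z + 1 + i%:Z) * cf2 0 j%:Z y.
Proof.
move=> + [wy Ey]; elim: a => [|a IH] aj.
  by rewrite !big_ord0 subr0 !mul0r subr0 expr0z mulr1 !mul1r.
have := congr1 (cf2 a%:Z (j%:Z - a.+1%:Z)) Ey; rewrite cf20 cf2_E; [|lia|lia].
have -> : a%:Z + 1 = a.+1%:Z by lia.
have -> : j%:Z - a.+1%:Z + 1 = j%:Z - a%:Z by lia.
have -> : l%:Z - (j%:Z - a.+1%:Z) = l%:Z - j%:Z + 1 + a%:Z by lia.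
move/eqP; rewrite addr_eq0 => /eqP e.
rewrite !big_ord_recr /= mulrA [LHS]mulrAC [_ * qi (l%:Z - a%:Z)]mulrC e.
have -> : a.+1%:Z * l%:Z - a.+1%:Z * (a.+1%:Z - 1) =
  (a%:Z * l%:Z - a%:Z * (a%:Z - 1)) + (l%:Z - a%:Z *+ 2) by lia.
rewrite (qzD q_neq0 (a%:Z * l%:Z - _)) exprS.
have := IH (ltnW aj).
move: (cf2 a _ y) (cf2 0 j y) (\prod_(i < a) _) (\prod_(i < a) _) => c c0 Q P E.
transitivity (- (q ^ (l%:Z - a%:Z *+ 2) * qi (l%:Z - j%:Z + 1 + a%:Z)) * (c * P)).
  by ring.
by rewrite E; ring.
Qed.

Definition braid_exp (j : nat) : int := j%:Z * l%:Z - j%:Z * (j%:Z - 1).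

(** For a = j the two products of [hw2_ratio] contain the same q-integers in opposite order and
    cancel; the sign left over is what separates symmetric from exterior. *)
Lemma hw2_flip (j : nat) y : (j <= l)%N -> hw2 j%:Z y ->
  cf2 j%:Z 0 y = (- 1) ^+ j * q ^ braid_exp j * cf2 0 j%:Z y.
Proof.
move=> jl hy; have := hw2_ratio (leqnn j) hy; rewrite subrr -/(braid_exp j).
have -> : \prod_(i < j) qi (l%:Z - j%:Z + 1 + i%:Z) = \prod_(i < j) qi (l%:Z - i%:Z).
  rewrite (reindex_inj rev_ord_inj); apply: eq_bigr => i _ /=; congr (qi _).
  by have := ltn_ord i; lia.
rewrite [X in _ = X]mulrAC; apply: mulIf.
apply/prodf_neq0 => i _; apply: (qi_neq0 q_neq0 q_free).
by have := ltn_ord i; lia.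
Qed.

Definition braid_val (j : nat) : K :=
  (- 1) ^+ j * q ^ (wip (wt0 0) (wt0 j%:Z) - braid_exp j).

(** By [hw2_unique] it suffices to compare coordinates at v_0 (x) v_j. The braiding carries that
    coordinate of y to the one at v_j (x) v_0 of its image, and [hw2_flip], applied to the image,
    leads back. *)
Lemma Rh_hw (j : nat) y : (j <= l)%N -> hw2 j%:Z y -> Rh *m y = braid_val j *: y.
Proof.
move=> jl hy; apply/eqP; rewrite -subr_eq0; apply/eqP.
have hRy : hw2 j%:Z (Rh *m y).
  split=> [lam|]; last by rewrite mulmxA -Rh_E -mulmxA hy.2 mulmx0.
  by rewrite mulmxA -[actK _ _ *m _]Rh_K -mulmxA hy.1 -scalemxAr.
apply: (hw2_unique q_free (m := j%:Z)).
- by rewrite mulmxBr hRy.2 -scalemxAr hy.2 scaler0 subrr.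
- have sW := @subspace_weight K q VV (wt2 j%:Z).
  by apply: (subspaceB sW); [exact: hRy.1 | apply: (subspaceZ _ sW); exact: hy.1].
rewrite addrC -scaleNr cf2D mulNr addrC; apply/eqP; rewrite subr_eq0; apply/eqP.
apply: (@mulfI _ ((- 1) ^+ j * q ^ braid_exp j)).
  by rewrite mulf_neq0 ?signr_eq0 ?qz_neq0.
rewrite -(hw2_flip jl hRy) cf2_Rh /braid_val (qzD q_neq0).
have e : q ^ braid_exp j * q ^ (- braid_exp j) = 1 by rewrite -(qzD q_neq0) subrr.
have s : (-1) ^+ j * (-1) ^+ j = 1 :> K by rewrite -expr2 sqrr_sign.
set c := q ^ wip _ _; set a := q ^ braid_exp j in e *; set b := q ^ (- _) in e *.
set t := (-1) ^+ j in s *.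
by transitivity (t * t * (a * b) * c * cf2 0 j%:Z y); [rewrite s e !mul1r | ring].
Qed.

Lemma Rh_proj2 (j : nat) x : (j <= l)%N ->
  Rh *m (proj2 j *m x) = braid_val j *: (proj2 j *m x).
Proof.
move=> jl; move: x; apply: VV_ind.
  split=> [|a x y ex ey]; first by rewrite !mulmx0 scaler0.
  by rewrite !mulmxDr -!scalemxAr ex ey scalerDr !scalerA mulrC.
move=> k i v il hv; rewrite (proj2_eig il jl (cas_hw2 k hv)).
case: eqP => [ij|_]; last by rewrite mulmx0 scaler0.
have RF : Rh *m actF VV ^+ k = actF VV ^+ k *m Rh by exact: (commrX k Rh_F).
by rewrite mulmxA RF -mulmxA (Rh_hw il hv) -scalemxAr ij.
Qed.

Hypothesis char2 : (2%:R : K) != 0.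

(* p = false for the symmetric square and p = true for the exterior square. *)
Definition sq2 (p : bool) (x : 'cV[K]_(n * n)) := lspan (fun x =>
  exists z : int, Rh *m x = ((- 1) ^+ p * q ^ z) *: x) x.

(** The projector onto the components of the unwanted parity, so that the p-square is its kernel and
    the p-cube an intersection of two kernels. *)
Definition proj_odd (p : bool) : 'M[K]_(n * n) :=
  \sum_(j < l.+1 | odd j != p) proj2 j.

Lemma proj_odd_eq0 p x : proj_odd p *m x = 0 <->
  forall j : nat, (j <= l)%N -> odd j != p -> proj2 j *m x = 0.
Proof.
rewrite mulmx_suml; split=> [e j jl op|h]; last first.
  by apply: big1 => j op; apply: h => //; rewrite -ltnS.
have := congr1 (mulmx (proj2 j)) e; rewrite mulmx0 mulmx_sumr.
have jl' : (j < l.+1)%N by [].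
rewrite (bigD1 (Ordinal jl')) //= proj2_proj2 // eqxx big1 ?addr0 // => i /andP[_ ij].
have il : (i <= l)%N by rewrite -ltnS.
by rewrite proj2_proj2 //; case: eqP => // e'; rewrite -val_eqE /= e' eqxx in ij.
Qed.

Lemma sq2P p x : sq2 p x <-> proj_odd p *m x = 0.
Proof.
rewrite proj_odd_eq0; split=> [|h]; last first.
  rewrite -[x]sum_proj2; apply: (subspace_sum (subspace_lspan _)) => j _ _.
  have jl : (j <= l)%N by rewrite -ltnS.
  have [/eqP op|op] := boolP (odd j == p); last first.
    by rewrite h //; apply: (subspace_lspan _).1.
  apply: lspan_gen; exists (wip (wt0 0) (wt0 j%:Z) - braid_exp j).
  by rewrite Rh_proj2 // /braid_val -op signr_odd.
move=> + j jl op; apply: (lspan_min (subspace_ker _)) => y [z e].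
have := Rh_proj2 y jl.
have -> : Rh *m (proj2 j *m y) = ((- 1) ^+ p * q ^ z) *: (proj2 j *m y).
  rewrite mulmxA; have -> : Rh *m proj2 j = proj2 j *m Rh.
    rewrite -[RHS]mulmx1 -[LHS]mul1mx.
    apply: eqmx_tens => u v; move: (u *t v : 'cV[K]_(n * n)).
    apply: VV_ind; first exact: subspace_eqmx.
    move=> k i w il hw; rewrite mul1mx mulmx1 -[LHS]mulmxA -[RHS]mulmxA.
    have c := cas_hw2 k hw.
    rewrite (proj2_eig il jl c).
    have e1 : Rh *m (actF VV ^+ k *m w) = braid_val i *: (actF VV ^+ k *m w).
      by have := Rh_proj2 (actF VV ^+ k *m w) il; rewrite (proj2_eig il il c) eqxx.
    rewrite e1 -scalemxAr (proj2_eig il jl c).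
    by case: eqP => _; rewrite ?e1 // mulmx0 scaler0.
  by rewrite -mulmxA e -scalemxAr.
move/eqP; rewrite -subr_eq0 -scalerBl scaler_eq0 => /orP[|/eqP//].
rewrite subr_eq0 /braid_val -(signr_odd K j).
have -> : odd j = ~~ p by move: op; case: (odd j); case: (p).
move/eqP => E.
have sgn : (-1) ^+ (~~ p) = - (-1) ^+ p :> K by case: (p); rewrite ?opprK ?expr0 ?expr1.
have sn0 : (-1) ^+ p != 0 :> K by rewrite signr_eq0.
move: E; rewrite sgn mulNr -mulrN => /(mulfI sn0).
move: (wip _ _ - _) => z' E.
(* Here [q ^ z = - q ^ z']. Squaring gives [z = z'], and then twice a power of q would be zero. *)
have zz : z = z'.
  have : q ^ (z *+ 2) = q ^ (z' *+ 2) by rewrite !mulr2n !(qzD q_neq0) E mulrNN.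
  by move/(qzI q_neq0 q_free); lia.
rewrite zz in E; have : 2%:R * q ^ z' = 0 by rewrite mulr_natl mulr2n {1}E addNr.
by move/eqP; rewrite mulf_eq0 (negbTE char2) (negbTE (qz_neq0 q_neq0 _)).
Qed.

End Braiding.

End Cube3.

(** * Highest weight vectors of the cubes *)

Section Cube4.
Variables (K : fieldType) (q : K).
Hypothesis q_neq0 : q != 0.
Hypothesis q_free : forall n, (0 < n)%N -> q ^+ n != 1.
Variable l : nat.
Local Notation V := (simple_mod q_neq0 (l%:Z, 0)).
Local Notation VV := (tens V V).
Local Notation W := (tens VV V).
Local Notation n := (udim V).
Local Notation qi := (qint q).
Local Notation bv := (bv q_neq0 l).
Local Notation rv := (rv q_neq0 l).
Local Notation cf2 := (@cf2 K q q_neq0 l).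
Local Notation cf3 := (@cf3 K q q_neq0 l).
Local Notation wt0 := (wt0 l).
Local Notation wt2 := (wt2 l).
Local Notation wt3 := (wt3 l).
Local Notation oVV := (@oVV K q q_neq0 l).
Local Notation oV := (@oV K q q_neq0 l).
Local Notation proj2 := (proj2 q_neq0 l).
Local Notation proj_odd := (proj_odd q_neq0 l).
Local Notation theta := (theta q l).
Implicit Types (x : 'cV[K]_(n * n * n)) (y z : 'cV[K]_(n * n)).

Definition cube (p : bool) x :=
  (proj_odd p *t 1%:M) *m x = 0 /\ (1%:M *t proj_odd p) *m castA x = 0.

Definition hw3 (m : int) x := weight_vector W (wt3 m) x /\ tensE VV V *m x = 0.

Lemma castAa x x' : castA (x + x') = castA x + castA x'.
Proof. by rewrite -[x]scale1r castAD !scale1r. Qed.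

Lemma castA_E x : castA (tensE VV V *m x) = tensE V VV *m castA x.
Proof.
rewrite {1}/tensE /= [X in X *t 1%:M]/tensE tensDl !mulmxDl !castAa /tensK.
rewrite !castA_tens tens11 -addrA -[X in _ + X]mulmxDl -tensDr.
by [].
Qed.

Lemma castA_F x : castA (tensF VV V *m x) = tensF V VV *m castA x.
Proof.
rewrite {1}/tensF /= [X in X *t _]/tensF tensDl -tens11 !mulmxDl !castAa.
rewrite !castA_tens -addrA -[X in _ + X]mulmxDl -tensDr.
by [].
Qed.

Lemma castA_K lam x : castA (tensK VV V lam *m x) = tensK V VV lam *m castA x.
Proof. by rewrite {1}/tensK /= /tensK castA_tens. Qed.

Lemma proj_odd_comm p (A : 'M[K]_(n * n)) :
  (forall j, proj2 j *m A = A *m proj2 j) -> proj_odd p *m A = A *m proj_odd p.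
Proof. by move=> h; rewrite mulmx_suml mulmx_sumr; apply: eq_bigr. Qed.

Lemma cube_E p : mstable (tensE VV V) (cube p).
Proof.
move=> x [h1 h2]; split.
  rewrite mulmxA; have -> : (proj_odd p *t 1%:M) *m tensE VV V =
      tensE VV V *m (proj_odd p *t 1%:M).
    rewrite mulmxDr mulmxDl !tensmx_mul !mul1mx !mulmx1.
    by congr (_ *t _ + _ *t _); apply: proj_odd_comm => j;
      [exact: proj2_E | exact: proj2_K].
  by rewrite -mulmxA h1 mulmx0.
rewrite castA_E mulmxA; have -> : (1%:M *t proj_odd p) *m tensE V VV =
    tensE V VV *m (1%:M *t proj_odd p).
  rewrite mulmxDr mulmxDl !tensmx_mul !mul1mx !mulmx1.
  by congr (_ *t _ + _ *t _); apply: proj_odd_comm => j; exact: proj2_E.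
by rewrite -mulmxA h2 mulmx0.
Qed.

Lemma cube_F p : mstable (tensF VV V) (cube p).
Proof.
move=> x [h1 h2]; split.
  rewrite mulmxA; have -> : (proj_odd p *t 1%:M) *m tensF VV V =
      tensF VV V *m (proj_odd p *t 1%:M).
    rewrite mulmxDr mulmxDl !tensmx_mul !mul1mx !mulmx1.
    by congr (_ *t _ + _ *t _); apply: proj_odd_comm => j; exact: proj2_F.
  by rewrite -mulmxA h1 mulmx0.
rewrite castA_F mulmxA; have -> : (1%:M *t proj_odd p) *m tensF V VV =
    tensF V VV *m (1%:M *t proj_odd p).
  rewrite mulmxDr mulmxDl !tensmx_mul !mul1mx !mulmx1.
  by congr (_ *t _ + _ *t _); apply: proj_odd_comm => j;
    [exact: proj2_K | exact: proj2_F].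
by rewrite -mulmxA h2 mulmx0.
Qed.

Lemma cube_K p lam : mstable (tensK VV V lam) (cube p).
Proof.
move=> x [h1 h2]; split.
  rewrite mulmxA; have -> : (proj_odd p *t 1%:M) *m tensK VV V lam =
      tensK VV V lam *m (proj_odd p *t 1%:M).
    rewrite !tensmx_mul !mul1mx !mulmx1.
    by congr (_ *t _); apply: proj_odd_comm => j; exact: proj2_K.
  by rewrite -mulmxA h1 mulmx0.
rewrite castA_K mulmxA; have -> : (1%:M *t proj_odd p) *m tensK V VV lam =
    tensK V VV lam *m (1%:M *t proj_odd p).
  rewrite !tensmx_mul !mul1mx !mulmx1.
  by congr (_ *t _); apply: proj_odd_comm => j; exact: proj2_K.
by rewrite -mulmxA h2 mulmx0.
Qed.

Lemma subspace_cube p : subspace (cube p).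
Proof.
split=> [|a x y [x1 x2] [y1 y2]]; first by split; rewrite ?castA0 mulmx0.
split; first by rewrite mulmxDr -scalemxAr x1 y1 scaler0 addr0.
by rewrite castAD mulmxDr -scalemxAr x2 y2 scaler0 addr0.
Qed.

(* The components of a highest weight vector of V (x) V (x) V along the        *)
(* highest weight vector of the first, resp. last, factor determine it; the    *)
(* two bracketings are compared through them.                                  *)
Definition fstc x : 'cV[K]_(n * n) := lsl (rv 0) (castA x).
Definition lstc x : 'cV[K]_(n * n) := rsl (rv 0) x.

Lemma cf2_fstc b c x : cf2 b c (fstc x) = cf3 0 b c x.
Proof. by rewrite /cf3 /cf2 -lsl_rsl -rsl_lsl_castA lsl_rsl. Qed.

Lemma fstcD a x x' : fstc (a *: x + x') = a *: fstc x + fstc x'.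
Proof. by rewrite /fstc castAD lslD lslZ. Qed.

Lemma fstc0 : fstc 0 = 0.
Proof. by rewrite /fstc castA0 lsl0. Qed.

Lemma fstc_sum (I : Type) (r : seq I) (P : pred I) (f : I -> 'cV_(n * n * n)) :
  fstc (\sum_(i <- r | P i) f i) = \sum_(i <- r | P i) fstc (f i).
Proof.
apply: (big_morph fstc); last exact: fstc0.
by move=> x y; rewrite -[x]scale1r fstcD !scale1r.
Qed.

Lemma fstc_eq0 x : tensE VV V *m x = 0 -> fstc x = 0 -> x = 0.
Proof.
move=> Ex e; apply: castA_eq0; apply: (hw_left0 q_free (U := VV)) => //.
by rewrite -castA_E Ex castA0.
Qed.

Lemma lstc_eq0 x : tensE VV V *m x = 0 -> lstc x = 0 -> x = 0.
Proof. by move=> Ex e; apply: (hw_right0 q_free (U := VV)). Qed.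

(** By [hw_left], membership of a highest weight vector in the second half of the cube is a
    condition on a single vector of V (x) V. *)
Lemma fstc_cube p x : tensE VV V *m x = 0 ->
  (1%:M *t proj_odd p) *m castA x = 0 <-> proj_odd p *m fstc x = 0.
Proof.
move=> Ex; split=> [e|e].
  by rewrite /fstc -[rv 0]mulmx1 -lsl_tens e lsl0.
apply: (hw_left q_free (U := VV)) => //; first exact/proj_odd_comm/proj2_E.
by rewrite -castA_E Ex castA0.
Qed.

Lemma fstc_weight m x : weight_vector W (wt3 m) x -> weight_vector VV (wt2 m) (fstc x).
Proof.
move=> wx lam; have := congr1 fstc (wx lam); rewrite /fstc [LHS]/= castA_K.
rewrite -[_ *: x]addr0 castAD castA0 addr0 lslZ lsl_tens rv_K lslZl -scalemxAr.
move/(congr1 ( *:%R (q ^ (- wip lam (wt0 0))))); rewrite !scalerA -!(qzD q_neq0).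
rewrite addNr scale1r => ->; congr (q ^ _ *: _).
by rewrite /wip /=; lia.
Qed.

Lemma lstc_weight m x : weight_vector W (wt3 m) x -> weight_vector VV (wt2 m) (lstc x).
Proof.
move=> wx lam; have := congr1 lstc (wx lam); rewrite /lstc.
rewrite rslZ rsl_tens rv_K rslZl -scalemxAr.
move/(congr1 ( *:%R (q ^ (- wip lam (wt0 0))))); rewrite !scalerA -!(qzD q_neq0).
rewrite addNr scale1r => ->; congr (q ^ _ *: _).
by rewrite /wip /=; lia.
Qed.

Lemma weight_wt3 mu x : weight_vector W mu x -> x != 0 ->
  exists2 m : nat, mu = wt3 m%:Z & (m <= l * 3)%N.
Proof.
move=> wx /matrix0Pn[i [j]]; case: (mxtens_indexP i) => a c.
rewrite (ord1 j) -rsl_delta -rv_ord => ne.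
have ne' : rsl (rv (nat_of_ord c)%:Z) x != 0.
  by apply: contraNneq ne => ->; rewrite mxE.
have wz : weight_vector VV (mu - wt0 (nat_of_ord c)%:Z) (rsl (rv (nat_of_ord c)%:Z) x).
  move=> lam; have := congr1 (rsl (rv (nat_of_ord c)%:Z)) (wx lam).
  rewrite rslZ rsl_tens rv_K rslZl -scalemxAr.
  move/(congr1 ( *:%R (q ^ (- wip lam (wt0 (nat_of_ord c)%:Z))))).
  rewrite !scalerA -!(qzD q_neq0) addNr scale1r => ->; congr (q ^ _ *: _).
  by rewrite wipDr wipNr addrC.
have [k e k0] := weight_wt2 q_free wz ne'.
have cl := ord_le c.
exists (absz (k + (nat_of_ord c)%:Z)); last by lia.
rewrite -[mu](subrK (wt0 (nat_of_ord c)%:Z)) e.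
by congr (_, _); rewrite /=; lia.
Qed.

(** Along v_0 only the part 1 (x) F of the coproduct of F contributes, and the highest weight
    equation trades E on the first two factors for E on the third. So only one neighbouring
    coordinate survives, which makes C12 bidiagonal. *)
Lemma fstc_cas b c x : tensE VV V *m x = 0 -> 0 <= b <= l%:Z -> 0 <= c ->
  cf2 b c (fstc ((cas VV *t 1%:M) *m x)) = theta b * cf2 b c (fstc x)
   - q ^ ((l%:Z - b + 1) *+ 2) * qi b * qi (l%:Z - c) * cf2 (b - 1) (c + 1) (fstc x).
Proof.
move=> Ex hb c0; rewrite !cf2_fstc /cf3 rsl_tens mulmx1 cf2_cas cf2_F; [|lia|lia].
rewrite qi0 mulr0 mul0r add0r subr0 addrC; congr (_ + _).
have := congr1 (rsl (rv c)) Ex; rewrite mulmxDl rslD !rsl_tens rsl0 mulmx1.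
rewrite rv_E // rslZl -scalemxAr addrC => /eqP; rewrite addr_eq0 => /eqP e.
rewrite -[tensE V V *m _]opprK -e -scaleN1r !cf2Z cf2_K mulN1r mulrN; congr (- _).
have -> : wip alpha (wt2 (0 + (b - 1))) = (l%:Z - b + 1) *+ 2.
  by rewrite /wip /=; lia.
by ring.
Qed.

Definition isoc (j : nat) x := (proj2 j *t 1%:M) *m x.

Lemma isoc_hw m j x : hw3 m x -> hw3 m (isoc j x).
Proof.
move=> [wx Ex]; split=> [lam|].
  rewrite mulmxA; have -> : actK W lam *m (proj2 j *t 1%:M) =
      (proj2 j *t 1%:M) *m actK W lam.
    by rewrite !tensmx_mul mul1mx mulmx1 /= -proj2_K.
  by rewrite -mulmxA wx -scalemxAr.
rewrite mulmxA; have -> : tensE VV V *m (proj2 j *t 1%:M) =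
    (proj2 j *t 1%:M) *m tensE VV V.
  rewrite mulmxDr mulmxDl !tensmx_mul !mul1mx !mulmx1 proj2_E //.
  by rewrite -[actK VV alpha *m _](proj2_K q_neq0 l j alpha).
by rewrite -mulmxA Ex mulmx0.
Qed.

Lemma sum_isoc x : \sum_(j < l.+1) isoc j x = x.
Proof.
move: x; apply: tens_ind => [|u v].
  split=> [|a x y ex ey]; first by rewrite big1 // => j _; rewrite /isoc mulmx0.
  rewrite -[in RHS]ex -[in RHS]ey scaler_sumr -big_split; apply: eq_bigr => j _.
  by rewrite /isoc mulmxDr -scalemxAr.
rewrite -[in RHS](sum_proj2 q_free u).
rewrite (big_morph (fun w => w *t v) (id1 := 0) (op1 := +%R)); last 2 first.
- by move=> ? ?; rewrite tensDl.
- by rewrite tens0mx.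
by apply: eq_bigr => j _; rewrite /isoc tensv_mul mul1mx.
Qed.

Lemma isoc_isoc (i j : nat) x : (i <= l)%N -> (j <= l)%N ->
  isoc j (isoc i x) = if i == j then isoc i x else 0.
Proof.
move=> il jl; rewrite /isoc mulmxA tensmx_mul mulmx1.
have -> : proj2 j *m proj2 i = if i == j then proj2 i else 0.
  rewrite -[LHS]mulmx1 -[RHS]mulmx1; apply: eqmx_tens => u v.
  rewrite !mulmx1 -mulmxA (proj2_proj2 q_free) //.
  by case: eqP => _ //; rewrite mul0mx.
by case: eqP => _ //; rewrite tens0mx mul0mx.
Qed.

Lemma cas_isoc (j : nat) x : (j <= l)%N ->
  (cas VV *t 1%:M) *m isoc j x = theta j%:Z *: isoc j x.
Proof.
move=> jl; move: x; apply: tens_ind => [|u v].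
  split=> [|a x y ex ey]; first by rewrite /isoc !mulmx0 scaler0.
  by rewrite /isoc !mulmxDr -!scalemxAr ex ey scalerDr !scalerA mulrC.
by rewrite /isoc !tensv_mul !mul1mx (cas_proj2 q_free) // tensZl.
Qed.

Lemma lstc_isoc j x : lstc (isoc j x) = proj2 j *m lstc x.
Proof. by rewrite /lstc rsl_tens mulmx1. Qed.

Lemma isoc_range m (j : nat) x : (j <= l)%N -> hw3 m x -> isoc j x != 0 ->
  j%:Z <= m <= l%:Z *+ 2 - j%:Z.
Proof.
move=> jl hx ne; apply: (proj2_range q_free jl (lstc_weight hx.1)).
apply: contraNneq ne => e; rewrite -lstc_isoc in e.
by rewrite (lstc_eq0 _ e) //; case: (isoc_hw j hx).
Qed.

Lemma isoc_cube (p : bool) (j : nat) x : (j <= l)%N ->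
  (proj_odd p *t 1%:M) *m x = 0 -> odd j != p -> isoc j x = 0.
Proof.
move=> jl e op.
have -> : isoc j x = (proj2 j *t 1%:M) *m ((proj_odd p *t 1%:M) *m x).
  rewrite mulmxA tensmx_mul mulmx1 /isoc; congr ((_ *t _) *m _).
  rewrite mulmx_sumr.
  have jl' : (j < l.+1)%N by [].
  rewrite (bigD1 (Ordinal jl')) //= [X in _ + X]big1 => [|i /andP[_ ij]].
    rewrite addr0 -[LHS]mulmx1 -[RHS]mulmx1; apply: eqmx_tens => u v.
    by rewrite !mulmx1 -mulmxA (proj2_proj2 q_free) // eqxx.
  have il : (i <= l)%N by rewrite -ltnS.
  rewrite -[LHS]mulmx1 -[RHS]mulmx1; apply: eqmx_tens => u v.
  rewrite !mulmx1 -mulmxA (proj2_proj2 q_free) // mul0mx; case: eqP => // e'.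
  by rewrite -val_eqE /= e' eqxx in ij.
by rewrite e mulmx0.
Qed.

(* In the coordinates of [fstc x] on the v_b (x) v_(m-b), the Casimir element  *)
(* of the first two factors is lower bidiagonal.                               *)
Lemma fstc_rec (m : int) (j : nat) x (b : int) : hw3 m x ->
  (cas VV *t 1%:M) *m x = theta j%:Z *: x -> 0 <= b <= l%:Z -> b <= m ->
  (theta j%:Z - theta b) * cf2 b (m - b) (fstc x) =
  - (q ^ ((l%:Z - b + 1) *+ 2) * qi b * qi (l%:Z - m + b) *
     cf2 (b - 1) (m - (b - 1)) (fstc x)).
Proof.
move=> hx ex hb bm; have := @fstc_cas b (m - b) x hx.2 hb ltac:(lia).
rewrite ex -[theta _ *: x]addr0 fstcD fstc0 addr0 cf2Z mulrBl => ->.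
have -> : l%:Z - (m - b) = l%:Z - m + b by lia.
have -> : m - b + 1 = m - (b - 1) by lia.
by ring.
Qed.

Lemma fstc_low (m : int) (j b : nat) x : (j <= l)%N -> j%:Z <= m -> hw3 m x ->
  (cas VV *t 1%:M) *m x = theta j%:Z *: x -> (b < j)%N ->
  cf2 b%:Z (m - b%:Z) (fstc x) = 0.
Proof.
move=> jl jm hx ex; elim: b => [|b IH] bj.
  have := fstc_rec (b := 0) hx ex; rewrite qi0 mulr0 !mul0r !oppr0.
  move=> /(_ ltac:(lia) ltac:(lia)) /eqP; rewrite mulf_eq0 => /orP[|/eqP//].
  by rewrite subr_eq0 => /eqP/(theta_inj q_neq0 q_free jl (leq0n l)); lia.
have := fstc_rec (b := b.+1%:Z) hx ex ltac:(lia) ltac:(lia).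
have -> : b.+1%:Z - 1 = b%:Z by lia.
rewrite IH; last lia.
rewrite mulr0 oppr0 => /eqP; rewrite mulf_eq0 => /orP[|/eqP//].
have kl' : (b.+1 <= l)%N by lia.
by rewrite subr_eq0 => /eqP/(theta_inj q_neq0 q_free jl kl'); lia.
Qed.

(** The recursion [fstc_rec] degenerates only at b = j, where [theta] takes the eigenvalue, so the
    coordinate there is the only free one. This gives the simplicity of the spectrum of C12. *)
Lemma fstc_lead (m : int) (j : nat) x : (j <= l)%N -> j%:Z <= m -> hw3 m x ->
  (cas VV *t 1%:M) *m x = theta j%:Z *: x ->
  cf2 j%:Z (m - j%:Z) (fstc x) = 0 -> x = 0.
Proof.
move=> jl jm hx ex e0; apply: (fstc_eq0 hx.2).
apply: cf2_ext => b c hb hc; rewrite cf20.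
have [ebc|ne] := eqVneq (b + c) m; last first.
  by rewrite (cf2_weight q_free (fstc_weight hx.1)).
have -> : c = m - b by lia.
have [k ek] : exists k : nat, b = k%:Z by exists `|b|%N; lia.
have : k%:Z <= l%:Z by lia.
have : k%:Z <= m by lia.
rewrite ek {b c hb hc ebc ek}; elim: k => [|k IH] km kl.
  have [j0|j0] := eqVneq j 0%N; first by rewrite -[RHS]e0 j0.
  by rewrite (fstc_low jl jm hx ex) // lt0n.
have [lt|gt|eq] := ltngtP k.+1 j; last by rewrite eq.
  exact: (fstc_low jl jm hx ex).
have := fstc_rec (b := k.+1%:Z) hx ex ltac:(lia) km.
have -> : k.+1%:Z - 1 = k%:Z by lia.
rewrite IH; [|lia|lia]; rewrite mulr0 oppr0 => /eqP; rewrite mulf_eq0 => /orP[|/eqP//].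
have kl' : (k.+1 <= l)%N by lia.
by rewrite subr_eq0 => /eqP/(theta_inj q_neq0 q_free jl kl'); lia.
Qed.

(** For j < m - l the free coordinate would sit at v_j (x) v_(m-j) with m - j > l, which is out of
    range. *)
Lemma isoc_low (m : int) (j : nat) x : (j <= l)%N -> hw3 m x -> isoc j x != 0 ->
  m - l%:Z <= j%:Z.
Proof.
move=> jl hx ne; have r := isoc_range jl hx ne.
rewrite leNgt; apply/negP => lt; move/eqP: ne; apply.
apply: (fstc_lead jl _ (isoc_hw j hx) (cas_isoc x jl)); first lia.
by apply: cf2_out; lia.
Qed.

(** Each application of E moves, up to a scalar, from the slice along v_k of the first factor to the
    one along v_(k+1), and there is none beyond v_l. *)
Lemma EX_fstc x : tensE VV V *m x = 0 -> actE VV ^+ l.+1 *m fstc x = 0.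
Proof.
move=> Ex; have {}Ex : tensE V VV *m castA x = 0 by rewrite -castA_E Ex castA0.
have rec (k : nat) : tensE V V *m lsl (rv k%:Z) (castA x) =
    - (q ^ (- wip alpha (wt0 k%:Z)) * qi (l%:Z - k%:Z)) *: lsl (rv k.+1%:Z) (castA x).
  have := congr1 (lsl (rv k%:Z)) Ex; rewrite mulmxDl lslD !lsl_tens lsl0 mul1mx.
  rewrite rv_E // rv_K !lslZl; have -> : k%:Z + 1 = k.+1%:Z by lia.
  move/eqP; rewrite addr_eq0 => /eqP/(congr1 ( *:%R (q ^ (- wip alpha (wt0 k%:Z))))).
  rewrite scalerN -scalemxAr !scalerA -(qzD q_neq0) addNr scale1r.
  by rewrite scaleNr => ->; rewrite opprK.
have [c ->] : exists c : K, actE VV ^+ l.+1 *m fstc x = c *: (tensE V V *m lsl (rv l%:Z) (castA x)).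
  suff h k : exists c : K, actE VV ^+ k *m fstc x = c *: lsl (rv k%:Z) (castA x).
    by have [c e] := h l; exists c; rewrite exprS -mulmxA e -scalemxAr.
  elim: k => [|k [c IH]]; first by exists 1; rewrite expr0 mul1mx scale1r.
  by eexists; rewrite exprS -mulmxA IH -scalemxAr [actE VV *m _]rec scalerA.
by rewrite rec subrr qi0 mulr0 oppr0 scale0r scaler0.
Qed.

(** Reaching the highest weight vector of the component j from weight m takes m - j applications of
    E, and by [EX_fstc] at most l of them are possible. *)
Lemma fstc_range (m : int) (j : nat) x : (j <= l)%N -> hw3 m x ->
  proj2 j *m fstc x != 0 -> m - l%:Z <= j%:Z.
Proof.
move=> jl hx ne.
have wy := fstc_weight hx.1; have wz := proj2_weight j wy.
set z := proj2 j *m _ in ne wz.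
have Ez : actE VV ^+ l.+1 *m z = 0.
  have PE : proj2 j *m actE VV ^+ l.+1 = actE VV ^+ l.+1 *m proj2 j.
    exact: (commrX l.+1 (proj2_E q_neq0 q_free l j)).
  by rewrite mulmxA -PE -mulmxA EX_fstc ?mulmx0 //; case: hx.
have ex : exists k, actE VV ^+ k *m z == 0 by exists l.+1; apply/eqP.
case: (ex_minnP ex) => -[|k] hk mk.
  by move: hk; rewrite expr0 mul1mx (negbTE ne).
have kl : (k <= l)%N by have := mk _ (introT eqP Ez); lia.
have nz : actE VV ^+ k *m z != 0 by apply/negP => /mk; rewrite ltnn.
have Ek : tensE V V *m (actE VV ^+ k *m z) = 0.
  by apply/eqP; rewrite mulmxA; move: hk; rewrite exprS.
have wk := weightEX q_neq0 k wz.
have := cas_hw q_neq0 q_free wk Ek 0; rewrite expr0 !mul1mx.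
have -> : cas VV *m (actE VV ^+ k *m z) = theta j%:Z *: (actE VV ^+ k *m z).
  have CE : cas VV *m actE VV ^+ k = actE VV ^+ k *m cas VV.
    exact: (commrX k (cas_E q_neq0 q_free VV)).
  by rewrite mulmxA CE -mulmxA /z (cas_proj2 q_free) // -scalemxAr.
move/eqP; rewrite -subr_eq0 -scalerBl scaler_eq0 (negbTE nz) orbF subr_eq0.
have w0 := hw_ge0 q_neq0 q_free wk Ek oVV nz.
move/eqP/(cval_inj q_neq0 q_free) => /(_ ltac:(lia) w0).
by rewrite wdDn (wd_wt2 q_neq0); lia.
Qed.

End Cube4.

(** * Behaviour at q = 0 *)

Section Identities.
Variables (K : fieldType) (q : K).
Hypothesis q_neq0 : q != 0.
Hypothesis q_free : forall n, (0 < n)%N -> q ^+ n != 1.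

Let d0 : 1 - q ^ 2%:Z != 0.
Proof. by rewrite subr_eq0 eq_sym q_free. Qed.
Let e a : q ^ a * q ^ (- a) = 1.
Proof. by rewrite -(qzD q_neq0) subrr. Qed.
Let e1 a : q ^ (- (1 - a)) = q ^ a * q^-1.
Proof. by rewrite -[q^-1]exprN1 -(qzD q_neq0); congr (_ ^ _); lia. Qed.
Let e2 : q * q^-1 = 1. Proof. by rewrite mulfV. Qed.

Lemma qint_regular (a : int) :
  q ^ (- (1 - a)) * qint q a = (1 - q ^ (a *+ 2)) / (1 - q ^ 2%:Z).
Proof.
have -> : q ^ (a *+ 2) = q ^ a * q ^ a by rewrite -(qzD q_neq0) -mulr2n.
apply/eqP; rewrite e1 /qint mulrA eqr_div ?(h_neq0 q_neq0) //; apply/eqP.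
have -> : q ^ 2%:Z = q * q by [].
have := e a; have := e2; move: (q ^ a) (q ^ (- a)) (q^-1) => A B Q E1 E2.
by ring: E1 E2.
Qed.

Lemma cval_regular (a : int) :
  q ^ (- (1 - a)) * cval q a = (1 + q ^ (a *+ 2 + 2)) / ((1 - q ^ 2%:Z) ^+ 2).
Proof.
have -> : q ^ (a *+ 2 + 2) = q ^ a * q ^ a * (q * q).
  by rewrite (qzD q_neq0) -(qzD q_neq0 a a) -mulr2n.
have E1 := e a; have E2 := e2; rewrite e1 /cval.
have -> : q ^ (a + 1) = q ^ a * q by rewrite (qzD q_neq0) expr1z.
have -> : q ^ (- a - 1) = q ^ (- a) * q^-1 by rewrite (qzD q_neq0) exprN1.
apply/eqP; rewrite [_ ^- 2 * _]mulrC mulrA eqr_div ?expf_neq0 ?(h_neq0 q_neq0) //; apply/eqP.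
have -> : q ^ 2%:Z = q * q by [].
move: E1 E2; move: (q ^ a) (q ^ (- a)) (q^-1) => A B Q E1 E2.
by ring: E1 E2.
Qed.

End Identities.

(** * Values and orders at q = 0 *)

Section Reg.
Variable C : fieldType.
Local Notation K := (Cq C).
Local Notation q := (qvar C).
Implicit Types (x y : K) (a b c d : C).

(* x has no pole at q = 0 and takes the value c there. *)
Definition reg x c := exists f g : {poly C},
  [/\ g.[0] != 0, x = tofrac f / tofrac g & f.[0] = c * g.[0]].

Lemma reg_neq0 x c : reg x c -> c != 0 -> x != 0.
Proof.
move=> [f [g [g0 -> e]]] c0; rewrite mulf_neq0 ?invr_neq0 //= tofrac_eq0.
  by apply: contraNneq (mulf_neq0 c0 g0) => f0; rewrite -e f0 horner0.
by apply: contraNneq g0 => ->; rewrite horner0.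
Qed.

Let frac_neq0 (g : {poly C}) : g.[0] != 0 -> tofrac g != 0 :> K.
Proof. by rewrite tofrac_eq0; apply: contraNneq => ->; rewrite horner0. Qed.

Lemma reg_poly (f : {poly C}) : reg (tofrac f) f.[0].
Proof. by exists f, 1; rewrite hornerC oner_neq0 tofrac1 invr1 !mulr1. Qed.

Lemma reg0 : reg 0 0.
Proof. by have := reg_poly 0; rewrite tofrac0 horner0. Qed.

Lemma reg1 : reg 1 1.
Proof. by have := reg_poly 1; rewrite tofrac1 hornerC. Qed.

Lemma regD x y c d : reg x c -> reg y d -> reg (x + y) (c + d).
Proof.
move=> [f [g [g0 -> e]]] [f' [g' [g0' -> e']]].
exists (f * g' + f' * g), (g * g'); split.
- by rewrite hornerM mulf_neq0.
- rewrite tofracD !tofracM addf_div //; exact: frac_neq0.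
by rewrite hornerD !hornerM e e'; ring.
Qed.

Lemma regM x y c d : reg x c -> reg y d -> reg (x * y) (c * d).
Proof.
move=> [f [g [g0 -> e]]] [f' [g' [g0' -> e']]].
exists (f * f'), (g * g'); split.
- by rewrite hornerM mulf_neq0.
- by rewrite !tofracM invfM mulrACA.
by rewrite !hornerM e e'; ring.
Qed.

Lemma regN x c : reg x c -> reg (- x) (- c).
Proof.
move=> [f [g [g0 -> e]]]; exists (- f), g; split=> //.
  by rewrite tofracN mulNr.
by rewrite hornerN e mulNr.
Qed.

Lemma regB x y c d : reg x c -> reg y d -> reg (x - y) (c - d).
Proof. by move=> rx ry; apply/regD/regN. Qed.

Lemma regV x c : c != 0 -> reg x c -> reg x^-1 c^-1.
Proof.
move=> c0 [f [g [g0 -> e]]]; exists g, f; split.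
- by rewrite e mulf_neq0.
- by rewrite invf_div.
by rewrite e mulKf.
Qed.

Lemma reg_sum (I : Type) (r : seq I) (P : pred I) (F : I -> K) (G : I -> C) :
  (forall i, P i -> reg (F i) (G i)) ->
  reg (\sum_(i <- r | P i) F i) (\sum_(i <- r | P i) G i).
Proof. by move=> h; apply: (big_ind2 reg) => // [|*]; [exact: reg0 | exact: regD]. Qed.

Lemma reg_prod (I : Type) (r : seq I) (P : pred I) (F : I -> K) (G : I -> C) :
  (forall i, P i -> reg (F i) (G i)) ->
  reg (\prod_(i <- r | P i) F i) (\prod_(i <- r | P i) G i).
Proof. by move=> h; apply: (big_ind2 reg) => // [|*]; [exact: reg1 | exact: regM]. Qed.

Lemma reg_det n (A : 'M[K]_n) (B : 'M[C]_n) :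
  (forall i j, reg (A i j) (B i j)) -> reg (\det A) (\det B).
Proof.
move=> h; apply: reg_sum => s _; apply: regM; last by apply: reg_prod.
elim: (nat_of_bool _) => [|k IH]; first by rewrite !expr0; apply: reg1.
by rewrite !exprS; apply: regM => //; apply/regN/reg1.
Qed.

(** The determinant is regular at q = 0, and its value there is the product of the diagonal
    values. *)
Lemma reg_trig_inj n (A : 'M[K]_n) (w : 'cV_n) :
  (forall i j, exists r, [/\ reg (A i j) r, (i < j)%N -> r = 0 & i = j -> r != 0]) ->
  A *m w = 0 -> w = 0.
Proof.
move=> h e; pose B := \matrix_(i, j) sval (cid (h i j)).
have hB i j : [/\ reg (A i j) (B i j), (i < j)%N -> B i j = 0 & i = j -> B i j != 0].
  by rewrite mxE; apply: (svalP (cid (h i j))).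
have uA : A \in unitmx.
  rewrite unitmxE unitfE; apply: (@reg_neq0 _ (\det B)).
    by apply: reg_det => i j; case: (hB i j).
  rewrite det_trig; first by apply/prodf_neq0 => i _; case: (hB i i) => _ _; exact.
  by apply/is_trig_mxP => i j ij; case: (hB i j) => _ /(_ ij).
by rewrite -(mulKmx uA w) e mulmx0.
Qed.

Lemma regq (z : int) : 0 <= z -> reg (q ^ z) (z == 0)%:R.
Proof.
case: z => // z _; rewrite -exprnP /qvar -tofracXn.
have := reg_poly ('X^z); rewrite hornerXn; congr reg.
by case: z => [|z]; rewrite ?expr0 // expr0n.
Qed.

(* x ~ c q^z at q = 0, or x = o(q^z) when c = 0. *)
Definition asy x (z : int) c := reg (q ^ (- z) * x) c.

Let q0 : q != 0. Proof. exact: qvar_neq0. Qed.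
Let qf : forall n, (0 < n)%N -> q ^+ n != 1. Proof. exact: qvar_free. Qed.

Lemma asyM x y z w c d : asy x z c -> asy y w d -> asy (x * y) (z + w) (c * d).
Proof.
move=> hx hy; rewrite /asy opprD (qzD q0).
by rewrite mulrACA; apply: regM.
Qed.

Lemma asyV x z c : c != 0 -> asy x z c -> asy x^-1 (- z) c^-1.
Proof.
move=> c0 /(regV c0); rewrite /asy invfM.
suff -> : (q ^ (- z))^-1 = q ^ (- - z) by [].
by rewrite opprK invr_expz opprK.
Qed.

Lemma asyq z : asy (q ^ z) z 1.
Proof. by rewrite /asy -(qzD q0) addNr; exact: reg1. Qed.

Lemma asyN x z c : asy x z c -> asy (- x) z (- c).
Proof. by rewrite /asy mulrN; exact: regN. Qed.

Lemma asyD x y z c d : asy x z c -> asy y z d -> asy (x + y) z (c + d).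
Proof. by rewrite /asy mulrDr; exact: regD. Qed.

Lemma asyW x (z w : int) c : asy x z c -> w <= z -> asy x w ((z == w)%:R * c).
Proof.
rewrite /asy => hx wz; have -> : q ^ (- w) = q ^ (z - w) * q ^ (- z).
  by rewrite -(qzD q0); congr (_ ^ _); lia.
rewrite -mulrA; apply: regM => //.
by rewrite -subr_eq0; apply: regq; lia.
Qed.

Lemma asy_lt x (z w : int) c : asy x z c -> w < z -> asy x w 0.
Proof.
move=> hx wz; have := asyW hx (ltW wz).
have -> : (z == w) = false by lia.
by rewrite mulr0n mul0r.
Qed.

Lemma asy_neq0 x z c : asy x z c -> c != 0 -> x != 0.
Proof.
by move=> /reg_neq0 h /h; apply: contra_neq => ->; rewrite mulr0.
Qed.

Lemma asy_reg x c : asy x 0 c <-> reg x c.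
Proof. by rewrite /asy oppr0 expr0z mul1r. Qed.

Let n0 (z : int) : 0 < z -> (z == 0) = false. Proof. lia. Qed.

Lemma asy_qint (a : int) : 0 < a -> asy (qint q a) (1 - a) 1.
Proof.
move=> a0; rewrite /asy (qint_regular q0 qf).
have := regM (regB reg1 (regq (z := a *+ 2) ltac:(lia)))
  (regV _ (regB reg1 (regq (z := 2%:Z) isT))).
rewrite !n0; [|lia|lia]; rewrite !mulr0n subr0 invr1 mulr1; apply.
exact: oner_neq0.
Qed.

Lemma asy_cval (a : int) : 0 <= a -> asy (cval q a) (1 - a) 1.
Proof.
move=> a0; rewrite /asy (cval_regular q0 qf).
have dr : reg ((1 - q ^ 2%:Z) ^+ 2) 1.
  have := regB reg1 (regq (z := 2%:Z) isT); rewrite n0 // subr0 => r.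
  by have := regM r r; rewrite mulr1 expr2.
have := regM (regD reg1 (regq (z := a *+ 2 + 2) ltac:(lia))) (regV (oner_neq0 _) dr).
by rewrite n0; [rewrite addr0 invr1 mulr1|lia].
Qed.

End Reg.

(** * The matrix coefficients of FE and single steps of its recursion *)

Section Coefficients.
Variables (K : fieldType) (q : K) (l m : nat).
Local Notation qi := (qint q).

(* On v_b (x) v_(m-b) the operator FE has diagonal coefficient fe1 b + fe2 b   *)
(* and off-diagonal coefficients feU b (to v_(b+1) (x) v_(m-b-1)) and feL b    *)
(* (to v_(b-1) (x) v_(m-b+1)); its eigenvalues are the feV j.                  *)
Definition fe1 (b : int) : K :=
  qi b * qi (l%:Z - b + 1) * q ^ ((m%:Z - b) *+ 2 - l%:Z).
Definition fe2 (b : int) : K :=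
  q ^ (l%:Z - b *+ 2) * qi (m%:Z - b) * qi (l%:Z - m%:Z + b + 1).
Definition feU (b : int) : K :=
  q ^ ((m%:Z - b) *+ 2 - b *+ 2 - 2) * qi (b + 1) * qi (l%:Z - m%:Z + b + 1).
Definition feL (b : int) : K := qi (l%:Z - b + 1) * qi (m%:Z - b + 1).
Definition feV (j : int) : K := qi (m%:Z - j) * qi (l%:Z *+ 2 - m%:Z - j + 1).

Hypothesis q_neq0 : q != 0.

(** All four coefficients pass through v_b (x) v_(m-b-1): both products consist of the same four
    one-step factors of E and F. *)
Lemma feU_feL b : feU b * feL (b + 1) = fe2 b * fe1 (b + 1).
Proof.
rewrite /feU /feL /fe1 /fe2.
have -> : l%:Z - (b + 1) + 1 = l%:Z - b by lia.
have -> : m%:Z - (b + 1) + 1 = m%:Z - b by lia.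
have -> : (m%:Z - b) *+ 2 - b *+ 2 - 2 =
  (l%:Z - b *+ 2) + ((m%:Z - (b + 1)) *+ 2 - l%:Z) by lia.
by rewrite (qzD q_neq0); ring.
Qed.

(** One step of a continued fraction: the ratio a1 / a0 of the previous step is substituted, and
    [feU_feL], as the last premise, turns the product of off-diagonal coefficients into a product of
    diagonal ones. The new error is then built from quotients of diagonal coefficients by v.
    [backward_step] is the same from the other end, with U in the place of v. *)
Lemma forward_step (v T S B B0 C S0 a0 a1 a2 e : K) : v != 0 -> 1 + e != 0 ->
  B0 * a1 = v * (1 + e) * a0 -> v * a1 = (T + S) * a1 + B * a2 + C * a0 ->
  B0 * C = S0 * T ->
  B * a2 = v * (1 + (- ((T + S) / v) - S0 / v * (T / v) / (1 + e))) * a1.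
Proof.
move=> v0 e0 E0 E1 E2.
have Ca0 : C * a0 = S0 * T / (v * (1 + e)) * a1.
  have ve0 : v * (1 + e) != 0 by rewrite mulf_neq0.
  apply: (mulfI ve0).
  transitivity (C * (v * (1 + e) * a0)); first by ring.
  by rewrite -E0 -E2; field; rewrite e0 v0.
have -> : B * a2 = v * a1 - (T + S) * a1 - C * a0 by rewrite E1; ring.
by rewrite Ca0; field; rewrite e0 v0.
Qed.

Lemma backward_step (v T S B C C1 T1 U U1 a0 a1 a2 e : K) :
  U != 0 -> U1 != 0 -> 1 + e != 0 ->
  C1 * a1 = - (U1 * (1 + e) * a2) -> v * a1 = (T + S) * a1 + B * a2 + C * a0 ->
  B * C1 = S * T1 ->
  C * a0 = - (U * (1 + (- 1 - v / U + (T + S) / U - S * T1 / (U * U1) / (1 + e))) * a1).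
Proof.
move=> U0 U10 e0 E0 E1 E2.
have Ba2 : B * a2 = - (S * T1 / (U1 * (1 + e)) * a1).
  have ve0 : U1 * (1 + e) != 0 by rewrite mulf_neq0.
  apply: (mulfI ve0).
  transitivity (B * - (- (U1 * (1 + e) * a2))); first by ring.
  by rewrite -E0 mulrN mulrA E2; field; rewrite e0 U10.
have -> : C * a0 = v * a1 - (T + S) * a1 - B * a2 by rewrite E1; ring.
by rewrite Ba2; field; rewrite e0 U0 U10.
Qed.

Lemma first_step (v T S B a1 a2 : K) : v != 0 -> v * a1 = (T + S) * a1 + B * a2 ->
  B * a2 = v * (1 + - ((T + S) / v)) * a1.
Proof.
move=> v0 E; have -> : B * a2 = v * a1 - (T + S) * a1 by rewrite E; ring.
by field.
Qed.

Lemma last_step (v T S C U a0 a1 : K) : U != 0 -> v * a1 = (T + S) * a1 + C * a0 ->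
  C * a0 = - (U * (1 + (- 1 - v / U + (T + S) / U)) * a1).
Proof.
move=> U0 E; have -> : C * a0 = v * a1 - (T + S) * a1 by rewrite E; ring.
by field.
Qed.

Lemma solve_step (x h a0 a1 : K) : h != 0 -> x * a1 = h * a0 -> a0 = x / h * a1.
Proof. by move=> h0 E; apply: (mulfI h0); rewrite -E; field. Qed.

Lemma solve_stepN (x h a0 a1 : K) : h != 0 -> x * a1 = - (h * a0) ->
  a0 = - (x / h) * a1.
Proof. by move=> h0 E; apply: (mulfI h0); rewrite -[LHS]opprK -E; field. Qed.

End Coefficients.

(** * Eigenforms of C23 and eigenvectors of C12 near q = 0 *)

Section Asymptotics.
Variables (C : fieldType) (l m t s d : nat).
Local Notation K := (Cq C).
Local Notation q := (qvar C).
Hypotheses (ltd : l = (t + d)%N) (mts : m = (t + s)%N) (sd : (s == 0%N) || (d == 0%N)).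
Hypothesis st : (s.*2 <= t)%N.
Local Notation T := (fe1 q l m).
Local Notation S := (fe2 q l m).
Local Notation B := (feU q l m).
Local Notation L := (feL q l m).
Local Notation v := (feV q l m).

Let q0 : q != 0. Proof. exact: qvar_neq0. Qed.

Lemma asy_eq (x : K) (z w : int) (c e : C) : asy x z c -> z = w -> c = e -> asy x w e.
Proof. by move=> h <- <-. Qed.

Lemma asy_fe1 (b : nat) : (0 < b <= t)%N ->
  asy (T b%:Z) (1 - b%:Z *+ 2 + s%:Z *+ 2 - d%:Z *+ 2) 1.
Proof.
move=> hb; rewrite /fe1; apply: asy_eq (asyM (asyM (asy_qint _ _) (asy_qint _ _)) (asyq _ _)) _ _;
  [lia|lia|lia|by rewrite !mulr1].
Qed.

Lemma fe1_0 : T 0 = 0.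
Proof. by rewrite /fe1 qi0 !mul0r. Qed.

Lemma asy_fe2 (b : nat) : (s <= b)%N -> (b < t + s)%N -> asy (S b%:Z) (1 - b%:Z *+ 2) 1.
Proof.
move=> sb bt; rewrite /fe2; apply: asy_eq (asyM (asyM (asyq _ _) (asy_qint _ _)) (asy_qint _ _)) _ _;
  [lia|lia|lia|by rewrite !mulr1].
Qed.

Lemma fe2_top : s = 0%N -> S t%:Z = 0.
Proof.
move=> s0; rewrite /fe2; have -> : m%:Z - t%:Z = 0 by lia.
by rewrite qi0 mulr0 mul0r.
Qed.

Lemma asy_feL (b : nat) : (b <= t)%N ->
  asy (L b%:Z) (b%:Z *+ 2 - t%:Z *+ 2 - d%:Z - s%:Z) 1.
Proof.
move=> bt; rewrite /feL; apply: asy_eq (asyM (asy_qint _ _) (asy_qint _ _)) _ _;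
  [lia|lia|lia|by rewrite !mulr1].
Qed.

Lemma asy_feU (b : nat) : (s <= b)%N ->
  asy (B b%:Z) (t%:Z *+ 2 + s%:Z *+ 3 - d%:Z - b%:Z *+ 6 - 2) 1.
Proof.
move=> sb; rewrite /feU; apply: asy_eq (asyM (asyM (asyq _ _) (asy_qint _ _)) (asy_qint _ _)) _ _;
  [lia|lia|lia|by rewrite !mulr1].
Qed.

Lemma asy_feV (k : nat) : (s <= k)%N -> (0 < k)%N ->
  asy (v (t%:Z - k%:Z)) (1 - k%:Z *+ 2 - d%:Z *+ 2) 1.
Proof.
move=> sk k0; rewrite /feV; apply: asy_eq (asyM (asy_qint _ _) (asy_qint _ _)) _ _;
  [lia|lia|lia|by rewrite !mulr1].
Qed.

Lemma asy0 z : @asy C 0 z 0.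
Proof. by rewrite /asy mulr0; apply: reg0. Qed.

Lemma asy_feV_weak (k : nat) : (s <= k)%N ->
  exists r, asy (v (t%:Z - k%:Z)) (1 - k%:Z *+ 2 - d%:Z *+ 2) r.
Proof.
move=> sk; have [k0|k0] := posnP k; last by exists 1; apply: asy_feV.
exists 0; rewrite /feV; have -> : m%:Z - (t%:Z - k%:Z) = 0 by lia.
by rewrite qi0 mul0r; apply: asy0.
Qed.

(** The diagonal term with the larger pole: [T] for s = 0, though [S] ties with it if also d = 0,
    and [S] for s > 0. Either way its order is 1 - 2b - 2d, that of the eigenvalue of index b. *)
Definition dom (b : int) : K := if s == 0%N then T b else S b.

Lemma asy_dom (b : nat) : (s <= b <= t)%N -> (0 < b)%N ->
  asy (dom b%:Z) (1 - b%:Z *+ 2 - d%:Z *+ 2) 1.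
Proof.
move=> hb b0; rewrite /dom; case: eqP => [s0|s0].
  by apply: asy_eq (asy_fe1 _) _ _; [lia|lia|].
by apply: asy_eq (asy_fe2 _ _) _ _; [lia|lia|lia|].
Qed.

Lemma asy_div (x y : K) (z w u : int) (c : C) : asy x z c -> asy y w 1 -> u = z - w ->
  asy (x / y) u c.
Proof.
move=> hx hy ->; have := asyM hx (asyV (oner_neq0 _) hy).
by rewrite invr1 mulr1.
Qed.

(* Rescaling v_b (x) v_(m-b) by q^(pot b) makes the eigenvectors of FE         *)
(* regular at q = 0, triangular there and with unit subdiagonal.               *)
Definition pot (i : int) : int :=
  (t%:Z *+ 2 + s%:Z *+ 3 + d%:Z - 1) * i - (i * (i - 1)) *+ 2.

Lemma one_reg (e : K) : reg e 0 -> reg (1 + e) 1.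
Proof. by move=> h; have := regD (reg1 C) h; rewrite addr0. Qed.

Lemma one_neq0 (e : K) : reg e 0 -> 1 + e != 0.
Proof. by move/one_reg/reg_neq0; apply; exact: oner_neq0. Qed.

Section Row.
Variables (k : nat) (al : int -> K).
Hypotheses (sk : (s <= k)%N) (kt : (k + s <= t)%N).
Hypothesis rec : forall b : nat, (s <= b <= t)%N ->
  v (t%:Z - k%:Z) * al b%:Z =
  (T b%:Z + S b%:Z) * al b%:Z + B b%:Z * al (b%:Z + 1) + L b%:Z * al (b%:Z - 1).
Hypotheses (al_low : al (s%:Z - 1) = 0) (al_high : al (t%:Z + 1) = 0).
Hypothesis al_nz : exists2 b : nat, (s <= b <= t)%N & al b%:Z != 0.
Local Notation vk := (v (t%:Z - k%:Z)).

Lemma fe1_small (i : nat) : (s <= i)%N -> (i < k)%N -> reg (T i%:Z / vk) 0.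
Proof.
move=> si ik; have [i0|i0] := posnP i; first by rewrite i0 fe1_0 mul0r; apply: reg0.
rewrite -asy_reg; apply: (@asy_lt _ _ ((k%:Z - i%:Z) *+ 2 + s%:Z *+ 2) _ 1); last lia.
by apply: asy_div (asy_fe1 _) (asy_feV _ _) _; lia.
Qed.

Lemma fe2_small (i : nat) : (s <= i)%N -> (i < k)%N -> reg (S i%:Z / vk) 0.
Proof.
move=> si ik.
rewrite -asy_reg; apply: (@asy_lt _ _ ((k%:Z - i%:Z) *+ 2 + d%:Z *+ 2) _ 1); last lia.
by apply: asy_div (asy_fe2 _ _) (asy_feV _ _) _; lia.
Qed.

Lemma fe_small (i : nat) : (s <= i)%N -> (i < k)%N ->
  reg (- ((T i%:Z + S i%:Z) / vk)) 0.
Proof.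
move=> si ik; rewrite mulrDl.
by have := regN (regD (fe1_small si ik) (fe2_small si ik)); rewrite addr0 oppr0.
Qed.

(** Below k the eigenvalue outweighs both diagonal terms, so all corrections vanish at q = 0. The
    start is the first row i = s, where [al_low] removes the lower neighbour. *)
Lemma forward (i : nat) : (s <= i)%N -> (i < k)%N -> exists2 e, reg e 0 &
  B i%:Z * al (i%:Z + 1) = vk * (1 + e) * al i%:Z.
Proof.
elim: i => [|i IH] si ik.
  have vk0 : vk != 0 by apply: (asy_neq0 (asy_feV sk _)); [lia | exact: oner_neq0].
  exists (- ((T 0 + S 0) / vk)); first exact: fe_small.
  have er := rec (b := 0) ltac:(lia).
  have i0 : 0%:Z - 1 = s%:Z - 1 by lia.
  rewrite i0 al_low mulr0 addr0 in er; exact: (first_step vk0 er).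
have vk0 : vk != 0 by apply: (asy_neq0 (asy_feV sk _)); [lia | exact: oner_neq0].
have rTS := fe_small si ik.
have [si'|si'] := leqP s i; last first.
  exists (- ((T i.+1%:Z + S i.+1%:Z) / vk)); first exact: rTS.
  have er := rec (b := i.+1) ltac:(lia).
  have i0 : i.+1%:Z - 1 = s%:Z - 1 by lia.
  rewrite i0 al_low mulr0 addr0 in er; exact: (first_step vk0 er).
have [e re ee] := IH si' (ltnW ik).
have i1 : i%:Z + 1 = i.+1%:Z by lia.
exists (- ((T i.+1%:Z + S i.+1%:Z) / vk) - S i%:Z / vk * (T i.+1%:Z / vk) / (1 + e)).
  have r1 := regM (fe2_small si' (ltnW ik)) (fe1_small si ik).
  have := regB rTS (regM r1 (regV (oner_neq0 _) (one_reg re))).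
  by rewrite !mul0r subr0.
have er := rec (b := i.+1) ltac:(lia).
have i2 : i.+1%:Z - 1 = i%:Z by lia.
rewrite i2 in er; rewrite i1 in ee.
have eB := feU_feL l m q0 i%:Z; rewrite i1 in eB.
exact: (forward_step vk0 (one_neq0 re) ee er eB).
Qed.

(** In the tie s = d = 0 both diagonal terms contribute and r is 1; otherwise it is 0. What matters
    is that the same r appears in both limits. *)
Lemma dom_ratio (i : nat) : (s <= i)%N -> (0 < i)%N -> (i < t)%N -> exists r,
  reg ((T i%:Z + S i%:Z) / dom i%:Z) (1 + r) /\
  reg (S i%:Z * T i.+1%:Z / (dom i%:Z * dom i.+1%:Z)) r.
Proof.
move=> si i0 it.
have di : dom i%:Z != 0 by apply: (asy_neq0 (asy_dom _ _)); [lia | lia | exact: oner_neq0].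
have di1 : dom i.+1%:Z != 0 by apply: (asy_neq0 (asy_dom _ _)); [lia | lia | exact: oner_neq0].
move: di di1; rewrite /dom; case: (s =P 0%N) => [s0|s0] di di1.
  have h : asy (S i%:Z / T i%:Z) (d%:Z *+ 2) 1.
    by apply: asy_div (asy_fe2 _ _) (asy_fe1 _) _; lia.
  have [r hr] : exists r, reg (S i%:Z / T i%:Z) r.
    by have := asyW h (w := 0) ltac:(lia); rewrite asy_reg => hr; eexists; exact: hr.
  exists r; split; first by rewrite mulrDl (divff di); apply: regD (reg1 C) hr.
  by rewrite -mulf_div (divff di1) mulr1.
have hT (b : nat) : (s <= b)%N -> (0 < b)%N -> (b <= t)%N -> reg (T b%:Z / S b%:Z) 0.
  move=> sb b0 bt; rewrite -asy_reg; apply: (@asy_lt _ _ (s%:Z *+ 2) _ 1); last lia.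
  by apply: asy_div (asy_fe1 _) (asy_fe2 _ _) _; lia.
exists 0; split.
  rewrite mulrDl (divff di) addrC; apply: regD (reg1 C) _; exact: hT (ltnW it).
by rewrite -mulf_div (divff di) mul1r; apply: hT; lia.
Qed.

(** No tie occurs in the top row: for s = 0 the coefficient [S] vanishes there, so the downward
    recursion starts with the limit 1. *)
Lemma dom_top : (0 < t)%N -> reg ((T t%:Z + S t%:Z) / dom t%:Z) 1.
Proof.
move=> t0; have dt : dom t%:Z != 0.
  by apply: (asy_neq0 (asy_dom _ _)); [lia | lia | exact: oner_neq0].
move: dt; rewrite /dom; case: (s =P 0%N) => [s0|s0] dt.
  by rewrite fe2_top // addr0 (divff dt); apply: reg1.
have h : reg (T t%:Z / S t%:Z) 0.
  rewrite -asy_reg; apply: (@asy_lt _ _ (s%:Z *+ 2) _ 1); last lia.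
  by apply: asy_div (asy_fe1 _) (asy_fe2 _ _) _; lia.
by have := regD (reg1 C) h; rewrite addr0 mulrDl (divff dt) addrC.
Qed.

Lemma feV_dom (i : nat) : (k < i <= t)%N -> reg (vk / dom i%:Z) 0.
Proof.
move=> ki; have [r hr] := asy_feV_weak sk.
rewrite -asy_reg; apply: (@asy_lt _ _ ((i%:Z - k%:Z) *+ 2) _ r); last lia.
by apply: asy_div hr (asy_dom _ _) _; lia.
Qed.

Lemma backward (i : nat) : (k < i <= t)%N -> exists2 e, reg e 0 &
  L i%:Z * al (i%:Z - 1) = - (dom i%:Z * (1 + e) * al i%:Z).
Proof.
have [n] := ubnP (t - i); elim: n i => // n IH i ni ki.
have di (b : nat) : (k < b <= t)%N -> dom b%:Z != 0.
  by move=> hb; apply: (asy_neq0 (asy_dom _ _)); [lia | lia | exact: oner_neq0].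
have m1v : reg (- 1 - vk / dom i%:Z) (- 1).
  by have := regB (regN (reg1 C)) (feV_dom ki); rewrite subr0.
have [it|it] := eqVneq i t.
  exists (- 1 - vk / dom i%:Z + (T i%:Z + S i%:Z) / dom i%:Z).
    rewrite -[X in reg _ X](addNr (1 : C)); apply: regD => //.
    by rewrite it; apply: dom_top; lia.
  have er := rec (b := i) ltac:(lia).
  have i0 : i%:Z + 1 = t%:Z + 1 by lia.
  rewrite i0 al_high mulr0 addr0 in er; exact: (last_step (di i ki) er).
have [e re ee] := IH i.+1 ltac:(lia) ltac:(lia).
have i1 : i%:Z + 1 = i.+1%:Z by lia.
have [r [h1 h2]] := @dom_ratio i ltac:(lia) ltac:(lia) ltac:(lia).
exists (- 1 - vk / dom i%:Z + (T i%:Z + S i%:Z) / dom i%:Z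
        - S i%:Z * T i.+1%:Z / (dom i%:Z * dom i.+1%:Z) / (1 + e)).
  (* The limits of the three groups of corrections; the two occurrences of [r] from [dom_ratio]
     cancel here, which settles the tie. *)
  have -> : 0 = - 1 + (1 + r) - r * 1^-1 :> C by rewrite invr1; ring.
  apply: regB; first exact: regD.
  by apply: regM h2 _; apply: regV; [exact: oner_neq0 | exact: one_reg].
have er := rec (b := i) ltac:(lia).
have i2 : i.+1%:Z - 1 = i%:Z by lia.
rewrite i1 in er; rewrite i2 in ee.
have eB := feU_feL l m q0 i%:Z; rewrite i1 in eB.
exact: (backward_step (di i ki) (di i.+1 ltac:(lia)) (one_neq0 re) ee er eB).
Qed.

Lemma vk_neq0 : (0 < k)%N -> vk != 0.
Proof. by move=> k0; apply: (asy_neq0 (asy_feV sk _)) => //; exact: oner_neq0. Qed.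

Lemma al_down (i : nat) : (s <= i)%N -> (i < k)%N -> exists2 e, reg e 0 &
  al i%:Z = B i%:Z / (vk * (1 + e)) * al i.+1%:Z.
Proof.
move=> si ik; have [e re ee] := forward si ik; exists e => //.
have i1 : i%:Z + 1 = i.+1%:Z by lia.
rewrite i1 in ee; apply: solve_step ee; apply: mulf_neq0 (one_neq0 re).
by apply: vk_neq0; lia.
Qed.

Lemma al_up (i : nat) : (k < i <= t)%N -> exists2 e, reg e 0 &
  al i%:Z = - (L i%:Z / (dom i%:Z * (1 + e))) * al i.-1%:Z.
Proof.
move=> ki; have [e re ee] := backward ki; exists e => //.
have i1 : i%:Z - 1 = i.-1%:Z by lia.
rewrite i1 in ee; apply: solve_stepN ee; apply: mulf_neq0 (one_neq0 re).
apply: (asy_neq0 (asy_dom _ _)); [lia | lia | exact: oner_neq0].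
Qed.

(** A zero at k would spread downwards by [al_down] and upwards by [al_up] to all of the form. *)
Lemma al_diag_neq0 : al k%:Z != 0.
Proof.
apply/eqP => ak; have [b hb /eqP[]] := al_nz.
have [bk|kb] := leqP b k.
  have e n : (s + n <= k)%N -> al (k - n)%N%:Z = 0.
    elim: n => [|n IH] h; first by rewrite subn0.
    have [e _ ->] := @al_down (k - n.+1)%N ltac:(lia) ltac:(lia).
    have -> : (k - n.+1).+1 = (k - n)%N by lia.
    by rewrite IH ?mulr0; [|lia].
  have -> : b = (k - (k - b))%N by lia.
  by apply: e; lia.
have e n : (k + n <= t)%N -> al (k + n)%N%:Z = 0.
  elim: n => [|n IH] h; first by rewrite addn0.
  have [e _ ->] := @al_up (k + n.+1)%N ltac:(lia).
  have -> : (k + n.+1).-1 = (k + n)%N by lia.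
  by rewrite IH ?mulr0; [|lia].
have -> : b = (k + (b - k))%N by lia.
by apply: e; lia.
Qed.

Definition row_scaled (i : int) : K := al i / al k%:Z * q ^ (pot i - pot k%:Z).

(** The slope [pot (b + 1) - pot b] is the order of B b divided by the eigenvalue of index b + 1. So
    the step from k to k - 1 keeps the value 1, the step from k - n to k - n - 1 gains the order 2n,
    and each step upwards from k gains 2(d + s + 1), hence a zero value. *)
Lemma row_regular (i : nat) : (s <= i <= t)%N -> exists r,
  [/\ reg (row_scaled i%:Z) r, i = k -> r = 1, i.+1 = k -> r = 1 & (k < i)%N -> r = 0].
Proof.
have row_k : row_scaled k%:Z = 1.
  by rewrite /row_scaled divff ?al_diag_neq0 // subrr expr0z mulr1.
move=> hi; have [ik|ki] := leqP i k.
  have e n : (s + n <= k)%N -> exists r, reg (row_scaled (k - n)%N%:Z) r /\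
      ((n <= 1)%N -> r = 1).
    elim: n => [|n IH] h.
      by exists 1; rewrite subn0 row_k; split=> //; apply: reg1.
    have [|r [hr r1]] := IH; first lia.
    have [e re ee] := @al_down (k - n.+1)%N ltac:(lia) ltac:(lia).
    have kn : (k - n.+1).+1 = (k - n)%N by lia.
    rewrite kn in ee.
    have f : asy (B (k - n.+1)%N%:Z / vk) (n%:Z *+ 2 + pot (k - n)%N%:Z - pot (k - n.+1)%N%:Z) 1.
      apply: asy_div (asy_feU _) (asy_feV sk _) _; rewrite ?/pot; lia.
    have := asyW (asy_eq (asyM f (asyq C (pot (k - n.+1)%N%:Z - pot (k - n)%N%:Z)))
      (w := n%:Z *+ 2) ltac:(lia) (mulr1 1)) (w := 0) ltac:(lia).
    rewrite asy_reg => hz.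
    exists (r * (((n%:Z *+ 2 == 0)%:R * 1) * 1^-1)); split; last first.
      move=> n0; rewrite r1 ?mul1r ?invr1 ?mulr1; last lia.
      by have -> : (n%:Z *+ 2 == 0) by lia.
    have -> : row_scaled (k - n.+1)%N%:Z = row_scaled (k - n)%N%:Z *
      (B (k - n.+1)%N%:Z / vk * q ^ (pot (k - n.+1)%N%:Z - pot (k - n)%N%:Z) * (1 + e)^-1).
      rewrite /row_scaled ee invfM.
      have -> : pot (k - n.+1)%N%:Z - pot k%:Z = (pot (k - n)%N%:Z - pot k%:Z) +
        (pot (k - n.+1)%N%:Z - pot (k - n)%N%:Z) by lia.
      by rewrite (qzD q0); ring.
    apply: regM => //; apply: regM => //.
    by apply: regV; [exact: oner_neq0 | exact: one_reg].
  have [|r [hr r1]] := e (k - i)%N; first lia.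
  have ki : (k - (k - i))%N = i by lia.
  rewrite ki in hr; exists r; split; first exact: hr.
  - by move=> h; apply: r1; lia.
  - by move=> h; apply: r1; lia.
  by move=> h; exfalso; lia.
have e n : (k + n <= t)%N -> exists r, reg (row_scaled (k + n)%N%:Z) r /\
    ((0 < n)%N -> r = 0).
  elim: n => [|n IH] h.
    by exists 1; rewrite addn0 row_k; split=> //; apply: reg1.
  have [|r [hr _]] := IH; first lia.
  have [e re ee] := @al_up (k + n.+1)%N ltac:(lia).
  have kn : (k + n.+1).-1 = (k + n)%N by lia.
  rewrite kn in ee.
  have kt1 : (s <= k + n.+1 <= t)%N by lia.
  have kt2 : (k + n.+1 <= t)%N by lia.
  have f := asy_div (asy_feL kt2) (asy_dom kt1 ltac:(lia)) erefl.
  have := asy_lt (asyM f (asyq C (pot (k + n.+1)%N%:Z - pot (k + n)%N%:Z)))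
    (w := 0) ltac:(rewrite /pot; lia).
  rewrite asy_reg => hz.
  exists 0; split=> //.
  have -> : row_scaled (k + n.+1)%N%:Z = row_scaled (k + n)%N%:Z *
    (- (L (k + n.+1)%N%:Z / dom (k + n.+1)%N%:Z *
      q ^ (pot (k + n.+1)%N%:Z - pot (k + n)%N%:Z)) * (1 + e)^-1).
    rewrite /row_scaled ee invfM.
    have -> : pot (k + n.+1)%N%:Z - pot k%:Z = (pot (k + n)%N%:Z - pot k%:Z) +
      (pot (k + n.+1)%N%:Z - pot (k + n)%N%:Z) by lia.
    by rewrite (qzD q0); ring.
  have := regM hr (regM (regN hz) (regV (oner_neq0 _) (one_reg re))).
  by rewrite oppr0 mul0r mulr0.
have [|r [hr r0]] := e (i - k)%N; first lia.
have ik : (k + (i - k))%N = i by lia.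
rewrite ik in hr; exists r; split; first exact: hr.
- by move=> h; exfalso; lia.
- by move=> h; exfalso; lia.
by move=> h; apply: r0; lia.
Qed.

End Row.

Section Column.
Variables (j : nat) (be : int -> K).
Hypotheses (sj : (s <= j)%N) (jt : (j + s <= t)%N).
Hypothesis rec : forall b : nat, (j < b <= t)%N ->
  (theta q l j%:Z - theta q l b%:Z) * be b%:Z =
  - (q ^ ((l%:Z - b%:Z + 1) *+ 2) * qint q b%:Z * qint q (l%:Z - m%:Z + b%:Z)
     * be (b%:Z - 1)).
Hypothesis be_lead : be j%:Z = 1.

Definition col_scaled (i : int) : K := be i * q ^ (pot j%:Z - pot i).

Lemma asy_theta (b : nat) : (b <= l)%N ->
  asy (theta q l b%:Z) (1 - (l%:Z - b%:Z) *+ 2) 1.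
Proof. by move=> bl; apply: asy_cval; lia. Qed.

Lemma asy_theta_sub (b : nat) : (j < b <= t)%N ->
  asy (theta q l j%:Z - theta q l b%:Z) (1 - (l%:Z - j%:Z) *+ 2) 1.
Proof.
move=> jb; have h1 := @asy_theta j ltac:(lia).
have h2 := asy_lt (@asy_theta b ltac:(lia)) (w := 1 - (l%:Z - j%:Z) *+ 2) ltac:(lia).
by have := asyD h1 (asyN h2); rewrite oppr0 addr0.
Qed.

(** After the same rescaling each step gains the order 2(t + d - s - j). It is zero for d = 0 and j
    = t - s, so this last column may keep nonzero values off its first entry; hence the proviso
    [j + s < t]. *)
Lemma col_regular (i : nat) : (j <= i <= t)%N -> exists r,
  [/\ reg (col_scaled i%:Z) r, i = j -> r = 1 & (j < i)%N -> (j + s < t)%N -> r = 0].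
Proof.
have col_j : col_scaled j%:Z = 1 by rewrite /col_scaled be_lead subrr expr0z mulr1.
have e n : (j + n <= t)%N -> exists r, reg (col_scaled (j + n)%N%:Z) r /\
    (n = 0%N -> r = 1) /\ ((0 < n)%N -> (j + s < t)%N -> r = 0).
  elim: n => [|n IH] h.
    by exists 1; rewrite addn0 col_j; split=> //; apply: reg1.
  have [|r [hr _]] := IH; first lia.
  have hb : (j < j + n.+1 <= t)%N by lia.
  have tb := asy_theta_sub hb.
  have jn : (j + n.+1)%N%:Z - 1 = (j + n)%N%:Z by lia.
  have ee : - (q ^ ((l%:Z - (j + n.+1)%N%:Z + 1) *+ 2) * qint q (j + n.+1)%N%:Z *
      qint q (l%:Z - m%:Z + (j + n.+1)%N%:Z)) * be (j + n)%N%:Z =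
      (theta q l j%:Z - theta q l (j + n.+1)%N%:Z) * be (j + n.+1)%N%:Z.
    by rewrite (rec hb) jn mulNr.
  have ee' := solve_step (asy_neq0 tb (oner_neq0 _)) ee.
  have f := asy_div (asyN (asyM (asyM (asyq C ((l%:Z - (j + n.+1)%N%:Z + 1) *+ 2))
    (@asy_qint C (j + n.+1)%N%:Z ltac:(lia)))
    (@asy_qint C (l%:Z - m%:Z + (j + n.+1)%N%:Z) ltac:(lia)))) tb erefl.
  have := asyW (asy_eq (asyM f (asyq C (pot (j + n)%N%:Z - pot (j + n.+1)%N%:Z)))
    (w := (t%:Z + d%:Z - s%:Z - j%:Z) *+ 2) ltac:(rewrite /pot; lia) erefl) (w := 0) ltac:(lia).
  rewrite asy_reg => hz.
  have -> : col_scaled (j + n.+1)%N%:Z = col_scaled (j + n)%N%:Z *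
    (- (q ^ ((l%:Z - (j + n.+1)%N%:Z + 1) *+ 2) * qint q (j + n.+1)%N%:Z *
      qint q (l%:Z - m%:Z + (j + n.+1)%N%:Z)) /
      (theta q l j%:Z - theta q l (j + n.+1)%N%:Z) *
      q ^ (pot (j + n)%N%:Z - pot (j + n.+1)%N%:Z)).
    rewrite /col_scaled ee'.
    have -> : pot j%:Z - pot (j + n.+1)%N%:Z = (pot j%:Z - pot (j + n)%N%:Z) +
      (pot (j + n)%N%:Z - pot (j + n.+1)%N%:Z) by lia.
    by rewrite (qzD q0); ring.
  eexists; split; first exact: (regM hr hz).
  split=> // _ js; have -> : ((t%:Z + d%:Z - s%:Z - j%:Z) *+ 2 == 0) = false by lia.
  by rewrite mulr0n mul0r mulr0.
move=> hi; have [|r [hr [r1 r0]]] := e (i - j)%N; first lia.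
have ij : (j + (i - j))%N = i by lia.
rewrite ij in hr; exists r; split; first exact: hr.
  by move=> h; apply: r1; lia.
by move=> h js; apply: r0; lia.
Qed.

End Column.

Definition is_row (k : nat) (al : int -> K) :=
  [/\ forall b : nat, (s <= b <= t)%N -> v (t%:Z - k%:Z) * al b%:Z =
    (T b%:Z + S b%:Z) * al b%:Z + B b%:Z * al (b%:Z + 1) + L b%:Z * al (b%:Z - 1),
    al (s%:Z - 1) = 0, al (t%:Z + 1) = 0 &
    exists2 b : nat, (s <= b <= t)%N & al b%:Z != 0].

Definition is_col (j : nat) (be : int -> K) :=
  [/\ forall b : nat, (j < b <= t)%N ->
    (theta q l j%:Z - theta q l b%:Z) * be b%:Z =
    - (q ^ ((l%:Z - b%:Z + 1) *+ 2) * qint q b%:Z * qint q (l%:Z - m%:Z + b%:Z)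
       * be (b%:Z - 1)),
    be j%:Z = 1 & forall b : nat, (b < j)%N -> be b%:Z = 0].

Definition pairing (al be : int -> K) : K := \sum_(b < t.+1) al b%:Z * be b%:Z.

(** At q = 0 only the terms with j <= b <= k survive: none for k < j and b = j alone for k = j. For
    k = j + 1 the term b = k drops out because then [j + s < t] and the column vanishes there. *)
Lemma pairing_regular (k j : nat) (al be : int -> K) :
  (s <= k)%N -> (k + s <= t)%N -> (s <= j)%N -> (j + s <= t)%N ->
  is_row k al -> is_col j be -> exists r,
  [/\ reg (pairing al be / al k%:Z * q ^ (pot j%:Z - pot k%:Z)) r, (k < j)%N -> r = 0
    & (j == k) || (j.+1 == k) -> r = 1].
Proof.
move=> sk kt sj jt [r1 r2 r3 r4] [c1 c2 c3].
have term (b : 'I_t.+1) : exists r, [/\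
    reg (row_scaled k al b%:Z * col_scaled j be b%:Z) r,
    (k < j)%N -> r = 0, (j == k) || (j.+1 == k) -> (b : nat) != j -> r = 0 &
    (j == k) || (j.+1 == k) -> (b : nat) = j -> r = 1].
  have bt : (b <= t)%N by rewrite -ltnS.
  have [bj|jb] := ltnP b j.
    exists 0; rewrite /col_scaled (c3 _ bj) mul0r mulr0; split.
    - exact: reg0.
    - by [].
    - by [].
    - by move=> _ h; exfalso; lia.
  have [r [hr ra rb rc]] := @row_regular k al sk kt r1 r2 r3 r4 b ltac:(lia).
  have [r' [hr' ra' rb']] := @col_regular j be sj jt c1 c2 b ltac:(lia).
  exists (r * r'); split; first exact: regM hr hr'.
  - by move=> kj; rewrite rc ?mul0r //; lia.
  - move=> kj bj; have [kb|bk] := ltnP k b; first by rewrite rc ?mul0r.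
    by rewrite rb' ?mulr0 //; lia.
  move=> kj bj; rewrite ra' // mulr1.
  by have [bk|bk] := eqVneq (b : nat) k; [exact: ra | apply: rb; lia].
pose r := \sum_b sval (cid (term b)); exists r; split.
- have -> : pairing al be / al k%:Z * q ^ (pot j%:Z - pot k%:Z) =
      \sum_(b < t.+1) row_scaled k al b%:Z * col_scaled j be b%:Z.
    rewrite /pairing !mulr_suml; apply: eq_bigr => b _; rewrite /row_scaled /col_scaled.
    have -> : pot j%:Z - pot k%:Z = (pot b%:Z - pot k%:Z) + (pot j%:Z - pot b%:Z) by lia.
    by rewrite (qzD q0); ring.
  by apply: reg_sum => b _; case: (svalP (cid (term b))).
- by move=> kj; rewrite /r big1 // => b _; case: (svalP (cid (term b))) => _ /(_ kj).
move=> kj; have jt' : (j < t.+1)%N by lia.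
rewrite /r (bigD1 (Ordinal jt')) //= big1 => [|b bj].
  by rewrite addr0; case: (svalP (cid (term (Ordinal jt')))) => _ _ _ /(_ kj erefl).
by case: (svalP (cid (term b))) => _ _ /(_ kj bj).
Qed.

(** The column i of parity [c] is matched with the row k = i + [eps], so that the diagonal of the
    square matrix [A] consists of pairings with k = j or k = j + 1. The bound [j + eps + s <= t]
    discards the column without a matching row, and [A] is padded by the identity outside the
    class. *)
Lemma pairing_inj (al be : nat -> int -> K) (w : nat -> K) (eps : nat) (c : bool) :
  (eps <= 1)%N ->
  (forall k, (s <= k)%N -> (k + s <= t)%N -> is_row k (al k)) ->
  (forall j, (s <= j)%N -> (j + s <= t)%N -> is_col j (be j)) ->
  (forall j, (j <= t)%N -> ~~ [&& (s <= j)%N, (j + eps + s <= t)%N & odd j == c] ->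
     w j = 0) ->
  (forall k, (s <= k)%N -> (k + s <= t)%N -> odd k = c (+) odd eps ->
     \sum_(j < t.+1) w j * pairing (al k) (be j) = 0) ->
  forall j, (j <= t)%N -> w j = 0.
Proof.
move=> e1 hal hbe w0 hw.
pose cls (j : nat) := [&& (s <= j)%N, (j + eps + s <= t)%N & odd j == c].
pose A : 'M[K]_t.+1 := \matrix_(i, j) if cls i && cls j then
  pairing (al (i + eps)%N) (be j) / al (i + eps)%N (i + eps)%N%:Z *
    q ^ (pot j%:Z - pot (i + eps)%N%:Z) else (i == j)%:R.
pose w' : 'cV[K]_t.+1 := \col_j (w j * q ^ (- pot j%:Z)).
suff w'0 : w' = 0.
  move=> j jt; have jt' : (j < t.+1)%N by [].
  have /colP/(_ (Ordinal jt')) := w'0; rewrite !mxE /= => /eqP.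
  by rewrite mulf_eq0 (negbTE (qz_neq0 q0 _)) orbF => /eqP.
apply: (@reg_trig_inj C _ A).
  move=> i j; rewrite !mxE; case: ifP => [/andP[/and3P[i1 i2 i3] /and3P[j1 j2 j3]]|_].
    have [r [hr ra rb]] := @pairing_regular (i + eps)%N j (al (i + eps)%N) (be j)
      ltac:(lia) ltac:(lia) ltac:(lia) ltac:(lia)
      (hal (i + eps)%N ltac:(lia) ltac:(lia)) (hbe j ltac:(lia) ltac:(lia)).
    exists r; split; first exact: hr.
      (* The indices [i] and [j] have equal parity, so i < j forces i + 2 <= j and the row index i +
         [eps] stays below j. *)
      by move=> ij; apply: ra; move: i3 j3; lia.
    move=> ij; rewrite rb ?oner_neq0 // ij.
    by move: e1; case: (eps) => [|[|//]] _; rewrite ?addn0 ?addn1 eqxx ?orbT.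
  exists (i == j)%:R; split.
  - by case: (i == j); [exact: reg1 | exact: reg0].
  - by move=> ij; case: eqP => // e; move: ij; rewrite e ltnn.
  by move=> ->; rewrite eqxx oner_neq0.
apply/colP => i; rewrite [LHS]mxE [RHS]mxE.
have [ci|nci] := boolP (cls i); last first.
  apply: big1 => j _; rewrite !mxE (negbTE nci) /=; case: eqP => [<-|_]; last by rewrite mul0r.
  by rewrite w0 ?mul0r ?mulr0 // -ltnS.
have /and3P[i1 i2 i3] := ci.
have := hw (i + eps)%N ltac:(lia) ltac:(lia) ltac:(rewrite oddD (eqP i3); done).
move/(congr1 (fun x => x * ((al (i + eps)%N (i + eps)%N%:Z)^-1 * q ^ (- pot (i + eps)%N%:Z)))).
rewrite mul0r mulr_suml => E; rewrite -[RHS]E; apply: eq_bigr => j _; rewrite !mxE ci /=.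
have [cj|ncj] := boolP (cls j).
  rewrite [q ^ (pot _ - _)](qzD q0).
  have e : q ^ pot j%:Z * q ^ (- pot j%:Z) = 1 by rewrite -(qzD q0) subrr.
  move: e; move: (q ^ pot _) (q ^ (- pot j%:Z)) => x y e.
  by ring: e.
by rewrite (w0 j) ?mul0r ?mulr0 // -ltnS.
Qed.

End Asymptotics.

(** * Multiplicities in the cubes *)

Section Multiplicity.
Variables (K : fieldType) (q : K).
Hypothesis q_neq0 : q != 0.
Hypothesis q_free : forall n, (0 < n)%N -> q ^+ n != 1.
Variables l m t s d : nat.
Hypotheses (ltd : l = (t + d)%N) (mts : m = (t + s)%N) (sd : (s == 0%N) || (d == 0%N)).
Hypothesis st : (s.*2 <= t)%N.
Local Notation V := (simple_mod q_neq0 (l%:Z, 0)).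
Local Notation VV := (tens V V).
Local Notation W := (tens VV V).
Local Notation n := (udim V).
Local Notation qi := (qint q).
Local Notation bv := (bv q_neq0 l).
Local Notation rv := (rv q_neq0 l).
Local Notation cf2 := (@cf2 K q q_neq0 l).
Local Notation wt0 := (wt0 l).
Local Notation wt2 := (wt2 l).
Local Notation wt3 := (wt3 l).
Local Notation proj2 := (proj2 q_neq0 l).
Local Notation proj_odd := (proj_odd q_neq0 l).
Local Notation theta := (theta q l).
Local Notation fstc := (@fstc K q q_neq0 l).
Local Notation lstc := (@lstc K q q_neq0 l).
Local Notation hw3 := (@hw3 K q q_neq0 l).
Local Notation isoc := (@isoc K q q_neq0 l).
Local Notation cube := (@cube K q q_neq0 l).
Local Notation T := (fe1 q l m).
Local Notation S := (fe2 q l m).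
Local Notation B := (feU q l m).
Local Notation L := (feL q l m).
Local Notation v := (feV q l m).
Implicit Types (x : 'cV[K]_(n * n * n)) (y z : 'cV[K]_(n * n)).

Lemma feVE (j : int) : v j = theta j - cval q ((l%:Z - m%:Z) *+ 2).
Proof.
rewrite /feV /theta /cval /qint.
have h0 := h_neq0 q_neq0 q_free.
have h1 : q - q^-1 != 0 by [].
rewrite mulf_div -expr2 mulrC -mulrBr; congr (_ * _).
rewrite mulrBl !mulrBr -!(qzD q_neq0).
set a := q ^ _; set b := q ^ _; set c := q ^ _; set e := q ^ _.
have -> : a = q ^ ((l%:Z - j) *+ 2 + 1) by congr (q ^ _); lia.
have -> : b = q ^ (- ((l%:Z - m%:Z) *+ 2) - 1) by congr (q ^ _); lia.
have -> : c = q ^ ((l%:Z - m%:Z) *+ 2 + 1) by congr (q ^ _); lia.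
have -> : e = q ^ (- ((l%:Z - j) *+ 2) - 1) by congr (q ^ _); lia.
by ring.
Qed.

Definition wb (b : int) : 'cV[K]_(n * n) := bv b *t bv (m%:Z - b).

Lemma weight_wb b : weight_vector VV (wt2 m%:Z) (wb b).
Proof.
have -> : wt2 m%:Z = wt0 b + wt0 (m%:Z - b) by congr (_, _); rewrite /=; lia.
by apply: (weight_tens q_neq0); apply: weight_bv.
Qed.

Lemma FE_wb b : tensF V V *m (tensE V V *m wb b) =
  (T b + S b) *: wb b + B b *: wb (b + 1) + L b *: wb (b - 1).
Proof.
have E1 : tensE V V *m wb b = qi (l%:Z - b + 1) *: (bv (b - 1) *t bv (m%:Z - b))
   + (q ^ (l%:Z - b *+ 2) * qi (l%:Z - (m%:Z - b) + 1)) *: (bv b *t bv (m%:Z - b - 1)).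
  rewrite mulmxDl !tensv_mul mul1mx K_bv !E_bv !tensZl !tensZr scalerA.
  by congr (_ + (q ^ _ * _) *: _); rewrite /wip /=; lia.
have E2 b' c : tensF V V *m (bv b' *t bv c) =
    (q ^ (c *+ 2 - l%:Z) * qi (b' + 1)) *: (bv (b' + 1) *t bv c) +
    qi (c + 1) *: (bv b' *t bv (c + 1)) :> 'cV_(n * n).
  rewrite mulmxDl !tensv_mul mul1mx K_bv !F_bv !tensZl !tensZr scalerA.
  rewrite [_ * q ^ _]mulrC.
  by congr ((q ^ _ * _) *: _ + _); rewrite /wip /=; lia.
rewrite E1 mulmxDr -!scalemxAr !E2 /wb !scalerDr !scalerA.
have -> : b - 1 + 1 = b by lia.
have -> : m%:Z - b - 1 + 1 = m%:Z - b by lia.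
have -> : m%:Z - (b + 1) = m%:Z - b - 1 by lia.
have -> : m%:Z - (b - 1) = m%:Z - b + 1 by lia.
have -> : l%:Z - (m%:Z - b) + 1 = l%:Z - m%:Z + b + 1 by lia.
move: (bv b *t _) (bv (b - 1) *t _) (bv (b + 1) *t _) => X Y Z.
rewrite /fe1 /fe2 /feU /feL.
have -> : (m%:Z - b) *+ 2 - b *+ 2 - 2 = (l%:Z - b *+ 2) + ((m%:Z - b - 1) *+ 2 - l%:Z).
  by lia.
rewrite (qzD q_neq0 (l%:Z - b *+ 2)).
by apply/matrixP=> i k; rewrite !mxE; ring.
Qed.

Lemma cas_wb b : cas VV *m wb b =
  (T b + S b + cval q ((l%:Z - m%:Z) *+ 2)) *: wb b + B b *: wb (b + 1) + L b *: wb (b - 1).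
Proof.
rewrite (casE q_neq0 (weight_wb b)) FE_wb (wd_wt2 q_neq0) [in RHS]scalerDl.
by apply/matrixP=> i k; rewrite !mxE; ring.
Qed.

Lemma wb_sum y : weight_vector VV (wt2 m%:Z) y ->
  y = \sum_(b < t.+1) cf2 b%:Z (m%:Z - b%:Z) y *: wb b%:Z.
Proof.
move=> wy; apply: cf2_ext => b c hb hc; rewrite cf2_sum.
have [ebc|ne] := eqVneq (b + c) m%:Z; last first.
  rewrite (cf2_weight q_free wy ne) big1 // => i _; rewrite cf2Z cf2_bv.
  case: (b =P i%:Z) => [ei|_]; last by rewrite mulr0.
  case: (c =P _) => [ec|_]; last by rewrite andbF mulr0.
  by exfalso; lia.
have [k ek] : exists k : nat, b = k%:Z by exists `|b|%N; lia.
have kt : (k < t.+1)%N by lia.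
rewrite (bigD1 (Ordinal kt)) //= big1 => [|i ik].
  have -> : m%:Z - k%:Z = c by lia.
  by rewrite addr0 cf2Z cf2_bv -ek !eqxx hb /= -ebc addrAC subrr add0r eqxx hc mulr1.
rewrite cf2Z cf2_bv; case: (b =P i%:Z) => [ei|_]; last by rewrite mulr0.
have e : (i : nat) = k by lia.
by rewrite -val_eqE /= e eqxx in ik.
Qed.

(** In the eigenvector equation at c the next coordinate has a nonzero coefficient, so two
    consecutive zeros propagate upwards. They start at s, below which coordinates are out of
    range. *)
Lemma bottom_eq0 (j : nat) z : weight_vector VV (wt2 m%:Z) z ->
  cas VV *m z = theta j%:Z *: z -> cf2 s%:Z (m%:Z - s%:Z) z = 0 -> z = 0.
Proof.
move=> wz cz z0; rewrite (wb_sum wz) big1 // => b _.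
suff -> : cf2 b%:Z (m%:Z - b%:Z) z = 0 by rewrite scale0r.
have bt : (b <= t)%N by rewrite -ltnS.
have zlow (i : int) : i < s%:Z -> cf2 i (m%:Z - i) z = 0.
  by move=> si; apply: cf2_out; lia.
have [bs|sb] := ltnP b s; first by apply: zlow.
have step k : (s + k <= t)%N -> cf2 (s + k)%N%:Z (m%:Z - (s + k)%N%:Z) z = 0 /\
    cf2 ((s + k)%N%:Z - 1) (m%:Z - ((s + k)%N%:Z - 1)) z = 0.
  elim: k => [|k IH] h; first by rewrite addn0; split=> //; apply: zlow; lia.
  have [|z1 z2] := IH; first lia.
  have -> : (s + k.+1)%N%:Z - 1 = (s + k)%N%:Z by lia.
  split=> //; move: h z1 z2; have [c ec] : exists c, c = (s + k)%N by exists (s + k)%N.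
  rewrite addnS -ec => h z1 z2.
  have := congr1 (cf2 c%:Z (m%:Z - c%:Z)) cz; rewrite cf2_cas cf2Z z1 !mulr0 addr0.
  rewrite cf2_F; [|lia|lia]; rewrite -mulrA.
  have -> : qi c%:Z * cf2 (c%:Z - 1) (m%:Z - c%:Z) (tensE V V *m z) = 0.
    have [->|c0] := posnP c; first by rewrite qi0 mul0r.
    rewrite cf2_E; [|lia|lia].
    have -> : c%:Z - 1 + 1 = c%:Z by lia.
    have -> : m%:Z - c%:Z + 1 = m%:Z - (c%:Z - 1) by lia.
    by rewrite z1 z2 !mulr0 addr0 mulr0.
  rewrite mulr0 add0r.
  rewrite cf2_E; [|lia|lia].
  have -> : m%:Z - c%:Z - 1 + 1 = m%:Z - c%:Z by lia.
  rewrite z1 mulr0 addr0.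
  have -> : m%:Z - c%:Z - 1 = m%:Z - c.+1%:Z by lia.
  have -> : c%:Z + 1 = c.+1%:Z by lia.
  have h1 : qi (m%:Z - c%:Z) != 0 by apply: (qi_neq0 q_neq0 q_free); lia.
  have h2 : qi (l%:Z - c%:Z) != 0 by apply: (qi_neq0 q_neq0 q_free); lia.
  by move/eqP; rewrite mulf_eq0 (negbTE h1) mulf_eq0 (negbTE h2) => /eqP.
have -> : (b : nat) = (s + (b - s))%N by lia.
by case: (step (b - s)%N) => //; lia.
Qed.

(** An eigenform of C23: project to the component t - k and read the coordinate at b = s, which by
    [bottom_eq0] is zero only if the projection is. The reversed index is the place where the form
    concentrates at q = 0. *)
Definition row_of (k : nat) (b : int) : K :=
  cf2 s%:Z (m%:Z - s%:Z) (proj2 (t - k) *m wb b).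

Lemma row_of_rec (k : nat) (b : int) : (k <= t)%N ->
  v (t%:Z - k%:Z) * row_of k b =
  (T b + S b) * row_of k b + B b * row_of k (b + 1) + L b * row_of k (b - 1).
Proof.
move=> kt; have jl : (t - k <= l)%N by lia.
have e := cas_proj2 q_free (wb b) jl.
have PC : cas VV *m proj2 (t - k) = proj2 (t - k) *m cas VV.
  by apply/esym/speci_comm.
rewrite mulmxA PC -mulmxA cas_wb !mulmxDr -!scalemxAr in e.
have := congr1 (cf2 s%:Z (m%:Z - s%:Z)) e.
rewrite !cf2A !cf2Z.
have -> : (t - k)%N%:Z = t%:Z - k%:Z by lia.
rewrite feVE -!/(row_of k _) => E.
by rewrite mulrBl -E; ring.
Qed.

Lemma row_of_out (k : nat) (b : int) : b = s%:Z - 1 \/ b = t%:Z + 1 -> row_of k b = 0.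
Proof.
move=> hb; rewrite /row_of; suff -> : wb b = 0 by rewrite mulmx0 cf20.
rewrite /wb; have [h|h] := boolP (0 <= b <= l%:Z); last by rewrite bv_out // tens0mx.
by rewrite (@bv_out _ _ _ _ (_ - _)) ?tensmx0 //; case: hb; lia.
Qed.

Lemma row_of_sum (k : nat) y : weight_vector VV (wt2 m%:Z) y ->
  cf2 s%:Z (m%:Z - s%:Z) (proj2 (t - k) *m y) =
  \sum_(b < t.+1) row_of k b%:Z * cf2 b%:Z (m%:Z - b%:Z) y.
Proof.
move=> wy; rewrite {1}(wb_sum wy) mulmx_sumr cf2_sum; apply: eq_bigr => b _.
by rewrite -scalemxAr cf2Z mulrC.
Qed.

Lemma row_of_nz (k : nat) : (s <= k)%N -> (k + s <= t)%N ->
  exists2 b : nat, (s <= b <= t)%N & row_of k b%:Z != 0.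
Proof.
move=> sk kt; have jl : (t - k <= l)%N by lia.
have [z [z0 wz ez]] := @proj2_exists K q q_neq0 q_free l (t - k)%N m%:Z jl ltac:(lia).
have nz : cf2 s%:Z (m%:Z - s%:Z) z != 0.
  have cz : cas VV *m z = theta (t - k)%N%:Z *: z.
    by rewrite -[in LHS]ez (cas_proj2 q_free _ jl) ez.
  by apply: contraNneq z0 => e; rewrite (bottom_eq0 wz cz e).
have [/existsP[b /andP[hb nb]]|/existsPn no] :=
  boolP [exists b : 'I_t.+1, (s <= b)%N && (row_of k (b : nat)%:Z != 0)].
  by exists b => //; rewrite hb /= -ltnS.
case/eqP: nz; rewrite -[z in cf2 _ _ z]ez row_of_sum // big1 // => b _.
have [bs|sb] := ltnP b s.
  by rewrite [cf2 _ _ z]cf2_out ?mulr0 //; lia.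
by have := no b; rewrite sb /= negbK => /eqP ->; rewrite mul0r.
Qed.

Lemma isoc_exists (j : nat) : (s <= j)%N -> (j + s <= t)%N ->
  exists x, [/\ hw3 m%:Z x, isoc j x = x & cf2 j%:Z (m%:Z - j%:Z) (fstc x) = 1].
Proof.
move=> sj jt; have jl : (j <= l)%N by lia.
have [z [z0 wz ez]] := @proj2_exists K q q_neq0 q_free l j m%:Z jl ltac:(lia).
(* Otherwise the component j would contain the weight of index m - l - 1, which is less than s and
   hence than j. *)
have En : actE VV ^+ l.+1 *m z = 0.
  apply/eqP/negPn/negP => nz.
  have wE := weightEX q_neq0 l.+1 wz.
  have PE : proj2 j *m actE VV ^+ l.+1 = actE VV ^+ l.+1 *m proj2 j.
    exact: (commrX l.+1 (proj2_E q_neq0 q_free l j)).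
  have wE' : weight_vector VV (wt2 (m%:Z - l.+1%:Z)) (actE VV ^+ l.+1 *m z).
    have <- // : wt2 m%:Z + alpha *+ l.+1 = wt2 (m%:Z - l.+1%:Z).
    have -> : alpha *+ l.+1 = (l.+1%:Z, - l.+1%:Z).
      by elim: (l.+1) => // i IH; rewrite mulrSr IH; congr (_, _); rewrite /=; lia.
    by congr (_, _); rewrite /=; lia.
  have := @proj2_range K q q_neq0 q_free l j (m%:Z - l.+1%:Z) _ jl wE'.
  by rewrite mulmxA PE -mulmxA ez => /(_ nz); lia.
pose x := hw_lift (U := VV) q_neq0 l (wt2 m%:Z) z.
have hx : hw3 m%:Z x.
  split; last exact: (hw_liftE (U := VV) q_neq0 q_free wz En).
  have -> : wt3 m%:Z = wt2 m%:Z + (l%:Z, 0) by congr (_, _); rewrite /=; lia.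
  exact: (hw_lift_weight (U := VV) q_neq0 l wz).
have cx : isoc j x = x.
  exact: (hw_lift_fix (U := VV) _ _ _ (proj2_E q_neq0 q_free l j) ez).
have x0 : x != 0.
  apply: contraNneq z0 => e; rewrite -(rsl_hw_lift (U := VV) q_neq0 l (wt2 m%:Z) z).
  by rewrite -/x e rsl0.
have ex : (cas VV *t 1%:M) *m x = theta j%:Z *: x by rewrite -cx (cas_isoc q_free).
have nz : cf2 j%:Z (m%:Z - j%:Z) (fstc x) != 0.
  by apply: contraNneq x0 => e; rewrite (fstc_lead q_free jl _ hx ex e) //; lia.
exists ((cf2 j%:Z (m%:Z - j%:Z) (fstc x))^-1 *: x); split.
- split; last by rewrite -scalemxAr hx.2 scaler0.
  exact: (subspaceZ _ (@subspace_weight K q W (wt3 m%:Z)) hx.1).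
- by rewrite /isoc -scalemxAr -/(isoc _ _) [isoc _ _]cx.
by rewrite -[_ *: x]addr0 fstcD fstc0 addr0 cf2Z mulVf.
Qed.

Definition lead (j : nat) x : K := cf2 j%:Z (m%:Z - j%:Z) (fstc (isoc j x)).

Lemma leadD j a x x' : lead j (a *: x + x') = a * lead j x + lead j x'.
Proof. by rewrite /lead /isoc mulmxDr -scalemxAr fstcD cf2D. Qed.

Section Basis.
Variable xx : nat -> 'cV[K]_(n * n * n).
Hypothesis hxx : forall j, (s <= j)%N -> (j + s <= t)%N ->
  [/\ hw3 m%:Z (xx j), isoc j (xx j) = xx j & cf2 j%:Z (m%:Z - j%:Z) (fstc (xx j)) = 1].

Lemma cas_xx j : (s <= j)%N -> (j + s <= t)%N ->
  (cas VV *t 1%:M) *m xx j = theta j%:Z *: xx j.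
Proof.
move=> sj jt; have [_ <- _] := hxx sj jt; rewrite (cas_isoc q_free) //; lia.
Qed.

Lemma isoc_lead j x : (s <= j)%N -> (j + s <= t)%N -> hw3 m%:Z x ->
  isoc j x = lead j x *: xx j.
Proof.
move=> sj jt hx; have [h1 h2 h3] := hxx sj jt; have jl : (j <= l)%N by lia.
apply/eqP; rewrite -subr_eq0; apply/eqP.
have [h4 h5] := isoc_hw q_free j hx.
apply: (fstc_lead q_free jl (m := m%:Z)); first lia.
- split; last by rewrite mulmxBr h5 -scalemxAr h1.2 scaler0 subrr.
  have sW := @subspace_weight K q W (wt3 m%:Z).
  by apply: (subspaceB sW) => //; apply: (subspaceZ _ sW); case: h1.
- rewrite mulmxBr (cas_isoc q_free) // -scalemxAr cas_xx // scalerBr !scalerA.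
  by rewrite mulrC.
by rewrite [isoc j x - _]addrC -scaleNr fstcD cf2D h3 mulr1 /lead addNr.
Qed.

Lemma hw3_decomp x : hw3 m%:Z x ->
  x = \sum_(j < t.+1 | (s <= j)%N && (j + s <= t)%N) lead j x *: xx j.
Proof.
move=> hx; rewrite -[LHS](sum_isoc q_free).
have tl : (t <= l)%N by lia.
rewrite -(big_mkord xpredT (fun j => isoc j x)) (@big_cat_nat _ _ _ t.+1) //=.
rewrite [X in _ + X]big_nat_cond [X in _ + X]big1 ?addr0; last first.
  move=> j /andP[/andP[tj jl] _]; apply/eqP/negPn/negP => ne.
  have jl' : (j <= l)%N by [].
  by have := isoc_range q_free jl' hx ne; lia.
rewrite big_mkord [RHS]big_mkcond; apply: eq_bigr => j _.
have jl : (j <= l)%N by have := ltn_ord j; lia.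
case: ifP => [/andP[sj jt]|no]; first exact: isoc_lead.
apply/eqP/negPn/negP => ne.
have := isoc_range q_free jl hx ne; have := isoc_low q_free jl hx ne.
by move: no; lia.
Qed.

Lemma row_fstc k x : hw3 m%:Z x ->
  cf2 s%:Z (m%:Z - s%:Z) (proj2 (t - k) *m fstc x) =
  \sum_(j < t.+1 | (s <= j)%N && (j + s <= t)%N) lead j x *
    \sum_(b < t.+1) row_of k b%:Z * cf2 b%:Z (m%:Z - b%:Z) (fstc (xx j)).
Proof.
move=> hx; rewrite {1}(hw3_decomp hx) fstc_sum mulmx_sumr cf2_sum.
apply: eq_bigr => j /andP[sj jt]; have [h1 _ _] := hxx sj jt.
rewrite -[_ *: xx j]addr0 fstcD fstc0 addr0 -scalemxAr cf2Z row_of_sum //.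
by apply: fstc_weight h1.1.
Qed.

Lemma xx_low j (b : nat) : (s <= j)%N -> (j + s <= t)%N -> (b < j)%N ->
  cf2 b%:Z (m%:Z - b%:Z) (fstc (xx j)) = 0.
Proof.
move=> sj jt bj; have [h1 _ _] := hxx sj jt.
by apply: (fstc_low q_free _ _ h1 (cas_xx sj jt) bj); lia.
Qed.

Lemma xx_rec j (b : nat) : (s <= j)%N -> (j + s <= t)%N -> (j < b <= t)%N ->
  (theta j%:Z - theta b%:Z) * cf2 b%:Z (m%:Z - b%:Z) (fstc (xx j)) =
  - (q ^ ((l%:Z - b%:Z + 1) *+ 2) * qi b%:Z * qi (l%:Z - m%:Z + b%:Z) *
     cf2 (b%:Z - 1) (m%:Z - (b%:Z - 1)) (fstc (xx j))).
Proof.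
move=> sj jt hb; have [h1 _ _] := hxx sj jt.
have := fstc_rec (b := b%:Z) h1 (cas_xx sj jt).
by apply; lia.
Qed.

Lemma cube_lead p j x : hw3 m%:Z x -> cube p x -> (j <= l)%N -> odd j != p ->
  lead j x = 0.
Proof.
by move=> hx [h1 _] jl op; rewrite /lead (isoc_cube q_free jl h1 op) fstc0 cf20.
Qed.

Lemma cube_row p k x : hw3 m%:Z x -> cube p x -> (k <= t)%N -> odd (t - k) != p ->
  cf2 s%:Z (m%:Z - s%:Z) (proj2 (t - k) *m fstc x) = 0.
Proof.
move=> hx [_ h2] kt op; have tl : (t - k <= l)%N by lia.
move: h2; rewrite (fstc_cube q_free p hx.2) (proj_odd_eq0 q_free) => h2.
by rewrite h2 // cf20.
Qed.

Lemma eq_hw3 x : hw3 m%:Z x ->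
  (forall j, (s <= j)%N -> (j + s <= t)%N -> lead j x = 0) -> x = 0.
Proof.
move=> hx h; rewrite (hw3_decomp hx) big1 // => j /andP[sj jt].
by rewrite h // scale0r.
Qed.

(* Existence by counting: there is one more intermediate Casimir eigenvalue of *)
(* the parity of s than of the other parity.                                   *)
Lemma cube_exists (p : bool) : ~~ odd t -> odd s = p ->
  exists2 x, x != 0 & hw3 m%:Z x /\ cube p x.
Proof.
move=> ot os; pose h := (t./2 - s)%N.
have th : t = (s + s + h.*2)%N by rewrite /h; move: ot st; lia.
(* Unknowns: the coefficients on the h + 1 vectors [xx j] with j = s + 2u. Equations: the bottom
   coordinates of the h components of index s + 2i + 1 for C23. There is one equation too few. *)
pose G : 'M[K]_(h.+1, h) := \matrix_(u, i)
  cf2 s%:Z (m%:Z - s%:Z) (proj2 (s + i.*2.+1) *m fstc (xx (s + u.*2))).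
have [w w0 wG] : exists2 w : 'rV[K]_h.+1, w != 0 & w *m G = 0.
  have : kermx G != 0.
    rewrite -mxrank_eq0 mxrank_ker -lt0n subn_gt0.
    exact: leq_ltn_trans (rank_leq_col G) _.
  by move=> /rowV0Pn[w /sub_kermxP wG w0]; exists w.
have hu (u : 'I_h.+1) : (s <= s + u.*2)%N /\ (s + u.*2 + s <= t)%N.
  by have := ltn_ord u; lia.
pose x := \sum_(u < h.+1) w 0 u *: xx (s + u.*2).
have hx : hw3 m%:Z x.
  split.
    have sW := @subspace_weight K q W (wt3 m%:Z).
    rewrite /x; apply: (subspace_sum sW) => u _ _; apply: (subspaceZ _ sW).
    by have [h1 h2] := hu u; have [[]] := hxx h1 h2.
  rewrite /x mulmx_sumr big1 // => u _; have [h1 h2] := hu u.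
  by have [[_ h3] _ _] := hxx h1 h2; rewrite -scalemxAr h3 scaler0.
have isoc_x (i : nat) : (i <= l)%N -> isoc i x =
    \sum_(u < h.+1) (if (s + u.*2)%N == i then w 0 u *: xx (s + u.*2) else 0).
  move=> il; rewrite /isoc /x mulmx_sumr; apply: eq_bigr => u _.
  have [h1 h2] := hu u; have [_ e _] := hxx h1 h2.
  rewrite -scalemxAr -/(isoc _ _) -{1}e (isoc_isoc q_free) //; last by lia.
  by case: eqP => _; rewrite ?e ?scaler0.
have x0 : x != 0.
  have /rV0Pn[u wu] := w0; apply: contraNneq wu => e.
  have [h1 h2] := hu u; have [_ _ e1] := hxx h1 h2.
  have : lead (s + u.*2) x = 0 by rewrite e /lead /isoc mulmx0 fstc0 cf20.
  rewrite /lead isoc_x; last by lia.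
  rewrite (bigD1 u) //= eqxx big1 => [|i iu]; last first.
    case: eqP => // /addnI/double_inj ei.
    by rewrite -val_eqE /= ei eqxx in iu.
  by rewrite -[_ *: _ + 0]/(_ *: _ + 0) fstcD fstc0 addr0 cf2Z e1 mulr1 => ->.
exists x => //; split=> //; split.
  have -> : x = \sum_(u < h.+1) isoc (s + u.*2) (w 0 u *: xx (s + u.*2)).
    apply: eq_bigr => u _; have [h1 h2] := hu u; have [_ e _] := hxx h1 h2.
    by rewrite /isoc -scalemxAr -/(isoc _ _) e.
  rewrite mulmx_sumr big1 // => u _; have [h1 h2] := hu u.
  rewrite /isoc mulmxA tensmx_mul mulmx1.
  suff -> : proj_odd p *m proj2 (s + u.*2) = 0 by rewrite tens0mx mul0mx.
  rewrite -[LHS]mulmx1; apply: eqmx_tens => a b; rewrite !mul0mx mulmx1 -mulmxA.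
  apply/(proj_odd_eq0 q_free) => i il op; rewrite (proj2_proj2 q_free) //; last by lia.
  case: eqP => // ei; move: op; rewrite -ei oddD odd_double addbF os.
  by rewrite eqxx.
rewrite (fstc_cube q_free p hx.2) (proj_odd_eq0 q_free) => j jl op.
have wz := proj2_weight j (fstc_weight hx.1).
apply/eqP/negPn/negP => ne.
have r1 := proj2_range q_free jl (fstc_weight hx.1) ne.
have r2 := fstc_range q_free jl hx ne.
move/eqP: ne; apply; apply: (bottom_eq0 wz (cas_proj2 q_free _ jl)).
(* The bounds [r1] and [r2] place j between s and t - s, and its parity differs from that of s, so
   its component is controlled by a column of [G]. *)
have [i ei] : exists i : nat, j = (s + i.*2.+1)%N.
  by exists ((j - s)./2)%N; move: op os r2; lia.
have ih : (i < h)%N by rewrite /h; lia.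
have /matrixP/(_ 0 (Ordinal ih)) := wG; rewrite !mxE => E.
rewrite /x fstc_sum mulmx_sumr cf2_sum -[RHS]E; apply: eq_bigr => u _.
by rewrite -[_ *: xx _]addr0 fstcD fstc0 addr0 -scalemxAr cf2Z !mxE ei.
Qed.

End Basis.

End Multiplicity.

(** * Injectivity from the limit q = 0 *)

Section Bound.
Variables (C : fieldType) (l m t s d : nat).
Local Notation K := (Cq C).
Local Notation q := (qvar C).
Hypotheses (ltd : l = (t + d)%N) (mts : m = (t + s)%N) (sd : (s == 0%N) || (d == 0%N)).
Hypothesis st : (s.*2 <= t)%N.
Local Notation q0 := (qvar_neq0 C).
Let qf : forall n, (0 < n)%N -> q ^+ n != 1 := @qvar_free C.
Local Notation V := (simple_mod q0 (l%:Z, 0)).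
Local Notation n := (udim V).

(** The coordinates [lead j] of x live on j of parity p and are orthogonal to the rows k for which t
    - k has the other parity, so [pairing_inj] applies with [eps] = 1 exactly for even t. Only the
    column j = t - s can then lack a row; it has the wrong parity when s does not have parity p, and
    in the remaining case its coordinate is assumed to be zero. *)
Lemma cube_inj (p : bool) (x : 'cV[K]_(n * n * n)) :
  hw3 (l := l) m%:Z x -> cube (l := l) p x ->
  odd t \/ odd s <> p \/ lead m (t - s) x = 0 -> x = 0.
Proof.
move=> hx cx top.
have ex (j : nat) : exists y : 'cV[K]_(n * n * n), (s <= j)%N -> (j + s <= t)%N ->
    [/\ hw3 (l := l) m%:Z y, isoc (l := l) j y = y &
        cf2 (l := l) j%:Z (m%:Z - j%:Z) (fstc (l := l) y) = 1].
  have [sj|sj] := leqP s j; last by exists 0 => h; exfalso; lia.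
  have [jt|jt] := leqP (j + s) t; last by exists 0 => _ h; exfalso; lia.
  have [y hy] := isoc_exists q0 qf ltd mts sd st sj jt.
  by exists y.
have [xx hxx] := choice ex.
apply: (eq_hw3 qf ltd mts sd st hxx hx) => j sj jt.
pose w (j : nat) : K := if (s <= j)%N && (j + s <= t)%N then lead m j x else 0.
have -> : lead m j x = w j by rewrite /w sj jt.
have jt' : (j <= t)%N by lia.
pose al (k : nat) (b : int) : K := row_of q0 l m t s k b.
pose be (j : nat) (b : int) : K := cf2 (l := l) b (m%:Z - b) (fstc (l := l) (xx j)).
pose eps : nat := ~~ odd t.
have eps1 : (eps <= 1)%N by rewrite /eps; case: (odd t).
apply: (pairing_inj ltd mts sd st (al := al) (be := be) (w := w) (c := p) eps1 _ _ _ _ jt').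
- move=> k sk kt; have kt' : (k <= t)%N by lia.
  split.
  + by move=> b _; exact: (row_of_rec q0 qf ltd mts sd st b%:Z kt').
  + by apply: (row_of_out q0 ltd mts sd st); left.
  + by apply: (row_of_out q0 ltd mts sd st); right.
  exact: (row_of_nz q0 qf ltd mts sd st sk kt).
- move=> i si it; have [_ _ h3] := hxx i si it; split.
  + by move=> b hb; exact: (xx_rec qf ltd mts sd st hxx si it hb).
  + exact: h3.
  by move=> b hb; exact: (xx_low qf ltd mts sd st hxx si it hb).
- move=> i it no; rewrite /w; case: ifP => // /andP[h1 h2].
  have il : (i <= l)%N by lia.
  have [/eqP op|op] := boolP (odd i == p); last first.
    exact: (cube_lead qf hx cx il op).
  have ite : i = (t - s)%N.
    by move: no; rewrite h1 op eqxx /eps; case: (odd t); lia.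
  have et : ~~ odd t.
    by apply/negP => ot; move: no; rewrite h1 op eqxx /eps ot; lia.
  case: top => [ot|[os|e]].
  + by rewrite ot in et.
  + exfalso; apply: os; rewrite -op ite oddB; last by lia.
    by rewrite (negbTE et).
  by rewrite ite.
move=> k sk kt ok; have kt' : (k <= t)%N by lia.
have okp : odd (t - k) != p.
  by rewrite oddB // ok /eps; case: (odd t); case: (p).
rewrite -[RHS](cube_row qf ltd mts sd st hx cx kt' okp).
rewrite (row_fstc qf ltd mts sd st hxx k hx) [RHS]big_mkcond.
apply: eq_bigr => i _; rewrite /w.
by case: ifP => _; [ | rewrite mul0r].
Qed.

End Bound.

(** * From highest weight vectors to submodules *)

Section Assembly.
Variables (K : fieldType) (q : K).
Hypothesis q_neq0 : q != 0.
Hypothesis q_free : forall n, (0 < n)%N -> q ^+ n != 1.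
Implicit Types (M N : uqmod q).
Local Notation qi := (qint q).

Lemma hw_coefE (d : int) (k : nat) :
  acoef q k * (q ^ d - q ^ (k%:Z *+ 2 - d)) = qi (k%:Z + 1) * qi (d - k%:Z).
Proof.
have e (a b c : int) : c = a + b -> q ^ a * q ^ b = q ^ c by move=> ->; rewrite qzD.
have hh : (q - q^-1)^-1 ^+ 2 = ((q - q^-1) * (q - q^-1))^-1 by rewrite expr2 invfM.
rewrite /acoef /qint mulf_div hh [LHS]mulrAC; congr (_ / _).
rewrite exprVn exprnP invr_expz -[X in (X - _) * _ = _]expr1z.
rewrite !mulrBl !mulrBr.
rewrite (e 1 d (d + 1)) ?(e 1 _ (k%:Z *+ 2 - d + 1)) ?(e _ d (d - k%:Z *+ 2 - 1)); try lia.
rewrite (e _ (k%:Z *+ 2 - d) (- d - 1)); last lia.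
rewrite (e _ (d - k%:Z) (d + 1)); last lia.
rewrite (e (k%:Z + 1) _ (k%:Z *+ 2 - d + 1)); last lia.
rewrite (e _ (d - k%:Z) (d - k%:Z *+ 2 - 1)); last lia.
rewrite (e _ _ (- d - 1)); last lia.
by [].
Qed.

Section Simple.
Variables (M : uqmod q) (lam : weight) (v : 'cV[K]_(udim M)).
Hypotheses (oM : in_Of M) (dom : lam.2 <= lam.1) (wv : weight_vector M lam v).
Hypotheses (Ev : actE M *m v = 0) (v0 : v != 0).
Local Notation D := `|lam.1 - lam.2|%N.
Local Notation L := (simple_mod q_neq0 lam).

Let wlam : wd lam = D%:Z. Proof. by rewrite /wd; lia. Qed.

Definition dv (k : nat) : 'cV[K]_D.+1 := \col_i ((i : nat) == k)%:R.

Lemma dv_out k : (D < k)%N -> dv k = 0.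
Proof.
move=> Dk; apply/colP=> i; rewrite !mxE; case: eqP => // e.
by have := ltn_ord i; lia.
Qed.

Lemma dv_ord (i : 'I_D.+1) : dv i = delta_mx i 0.
Proof. by apply/matrixP=> j k; rewrite !mxE ord1 andbT. Qed.

Lemma dv_ext m (A B : 'M[K]_(m, D.+1)) : (forall k, A *m dv k = B *m dv k) -> A = B.
Proof.
move=> e; apply/matrixP=> i j; have := e j.
by rewrite dv_ord -!colE => /matrixP/(_ i 0); rewrite !mxE.
Qed.

Lemma E_dv0 : actE L *m dv 0 = 0.
Proof.
have -> : dv 0 = delta_mx ord0 0 by rewrite -dv_ord.
by rewrite -colE; apply/colP=> i; rewrite !mxE.
Qed.

Lemma E_dv k : actE L *m dv k.+1 = qi (D%:Z - k%:Z) *: dv k.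
Proof.
have [Dk|kD] := leqP D k.
  rewrite dv_out // mulmx0; have [->|ne] := eqVneq k D.
    by rewrite subrr qi0 scale0r.
  by rewrite dv_out ?scaler0 //; lia.
have kD' : (k.+1 < D.+1)%N by lia.
have -> : dv k.+1 = delta_mx (Ordinal kD') 0 by rewrite -dv_ord.
rewrite -colE; apply/colP=> i; rewrite !mxE /= eqSS eq_sym.
by case: eqP => [->|_]; rewrite ?mulr1 ?mulr0.
Qed.

Lemma F_dv k : actF L *m dv k = qi (k%:Z + 1) *: dv k.+1.
Proof.
have [kD|Dk] := leqP k D; last by rewrite !dv_out ?mulmx0 ?scaler0 //; lia.
have -> : dv k = delta_mx (Ordinal (kD : (k < D.+1)%N)) 0 by rewrite -dv_ord.
rewrite -colE; apply/colP=> i; rewrite !mxE /=.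
case: eqP => [->|_]; last by rewrite mulr0.
by rewrite mulr1; congr (qi _); lia.
Qed.

Lemma K_dv mu k : actK L mu *m dv k = q ^ wip mu (lam - alpha *+ k) *: dv k.
Proof.
have [kD|Dk] := leqP k D; last by rewrite !dv_out ?mulmx0 ?scaler0 //; lia.
have -> : dv k = delta_mx (Ordinal (kD : (k < D.+1)%N)) 0 by rewrite -dv_ord.
rewrite (simple_weight_vector q_neq0); congr (q ^ wip _ _ *: _) => /=.
elim: k {kD} => [|k IH]; first by rewrite simple_hw // mulr0n subr0.
by rewrite simple_weightS IH mulrSr opprD addrA.
Qed.

Definition hw_fact (k : nat) : K := \prod_(i < k) qi (i%:Z + 1).

Lemma hw_fact_neq0 k : hw_fact k != 0.
Proof. by apply/prodf_neq0 => i _; apply: (qi_neq0 q_neq0 q_free); lia. Qed.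

Lemma hw_factS k : qi (k%:Z + 1) * (hw_fact k.+1)^-1 = (hw_fact k)^-1.
Proof.
rewrite /hw_fact big_ord_recr /= invfM mulrCA mulfV ?mulr1 //.
by apply: (qi_neq0 q_neq0 q_free); lia.
Qed.

(** The basis vector k goes to F^k v / [k]!, where [hw_fact] is the q-factorial; F v_k = [k+1]
    v_(k+1) forces this normalisation. *)
Definition hw_map : 'M[K]_(udim M, D.+1) :=
  \sum_(k < D.+1) ((hw_fact k)^-1 *: (actF M ^+ k *m v)) *m (dv k)^T.

Lemma hw_mapE k : hw_map *m dv k = (hw_fact k)^-1 *: (actF M ^+ k *m v).
Proof.
have [kD|Dk] := leqP k D; last first.
  by rewrite dv_out // mulmx0 (FX_hw_eq0 q_neq0 q_free oM wv Ev) ?scaler0 //; lia.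
have dvT (i : nat) : (i <= D)%N -> (dv i)^T *m dv k = (i == k)%:R%:M.
  move=> iD; apply/matrixP=> a b; rewrite !ord1 mxE.
  rewrite (bigD1 (Ordinal (kD : (k < D.+1)%N))) //= big1 => [|c ck].
    by rewrite !mxE /= !eqxx addr0 mulr1 mulr1n eq_sym.
  rewrite !mxE; have -> : ((c : nat) == k) = false by apply/negbTE; move: ck; rewrite -val_eqE.
  by rewrite mulr0.
rewrite mulmx_suml (bigD1 (Ordinal (kD : (k < D.+1)%N))) //= big1 => [|i ik].
  by rewrite -mulmxA dvT // eqxx mulmx1 addr0.
rewrite -mulmxA dvT; last by have := ltn_ord i; lia.
have -> : ((i : nat) == k) = false by apply/negbTE; move: ik; rewrite -val_eqE.
by rewrite raddf0 mulmx0.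
Qed.

Lemma hw_map_E : hw_map *m actE L = actE M *m hw_map.
Proof.
apply: dv_ext => -[|k]; rewrite -!mulmxA hw_mapE.
  by rewrite E_dv0 mulmx0 -scalemxAr expr0 mul1mx Ev scaler0.
rewrite E_dv -!scalemxAr hw_mapE (EF_hw q_neq0 q_free wv Ev) wlam hw_coefE !scalerA.
by congr (_ *: _); rewrite -hw_factS; ring.
Qed.

Lemma hw_map_F : hw_map *m actF L = actF M *m hw_map.
Proof.
apply: dv_ext => k; rewrite -!mulmxA hw_mapE F_dv -!scalemxAr hw_mapE scalerA.
by rewrite hw_factS exprS -mulmxA.
Qed.

Lemma hw_map_K mu : hw_map *m actK L mu = actK M mu *m hw_map.
Proof.
apply: dv_ext => k; rewrite -!mulmxA hw_mapE K_dv -!scalemxAr hw_mapE.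
by rewrite (weightFX q_neq0 k wv) !scalerA mulrC.
Qed.

Lemma dv_sum (x : 'cV[K]_D.+1) : x = \sum_(k < D.+1) x k 0 *: dv k.
Proof.
rewrite [LHS](matrix_sum_delta x); apply: eq_bigr => k _.
by rewrite big_ord_recl big_ord0 addr0 dv_ord.
Qed.

(** The images of the basis vectors have distinct eigenvalues under K_(1,0), so a spectral projector
    isolates each coefficient. *)
Lemma hw_map_inj (x : 'cV[K]_D.+1) : hw_map *m x = 0 -> x = 0.
Proof.
move=> e; rewrite (dv_sum x) big1 // => k _.
have kD : (k <= D)%N by rewrite -ltnS.
pose A := actK M (1, 0).
pose r := [seq q ^ (lam.1 - i%:Z) | i <- iota 0 D.+1].
have eA i : A *m (actF M ^+ i *m v) = q ^ (lam.1 - i%:Z) *: (actF M ^+ i *m v).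
  rewrite (weightFX q_neq0 i wv); congr (q ^ _ *: _).
  have -> : alpha *+ i = (i%:Z, - i%:Z).
    by elim: i => // i IH; rewrite mulrSr IH; congr (_, _); rewrite /=; lia.
  by rewrite /wip /=; lia.
have := congr1 (mulmx (speci A r (q ^ (lam.1 - (k : nat)%:Z)))) e.
rewrite mulmx0 {1}(dv_sum x) !mulmx_sumr (bigD1 k) //= big1 => [|i ik].
  rewrite addr0 -scalemxAr hw_mapE -!scalemxAr (speci_id _ (eA k)) scalerA => /eqP.
  rewrite scaler_eq0 mulf_eq0 invr_eq0 (negbTE (hw_fact_neq0 _)) orbF => /orP[/eqP ->|].
    by rewrite scale0r.
  by rewrite (negbTE (FX_hw_neq0 q_neq0 q_free wv Ev v0 _)) // wlam; lia.
rewrite -scalemxAr hw_mapE -!scalemxAr (speci_0 _ _ (eA i)) ?scaler0 //.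
  by apply/mapP; exists (i : nat); rewrite // mem_iota add0n ltn_ord.
by apply/eqP => /(qzI q_neq0 q_free) h; move/eqP: ik; apply; apply: val_inj => /=; lia.
Qed.

Lemma submod_iso_simple :
  submod_iso M (lspan (fun y => exists k, y = actF M ^+ k *m v)) L.
Proof.
exists hw_map; split.
- move=> x y /eqP; rewrite -subr_eq0 -mulmxBr => /eqP/hw_map_inj/eqP.
  by rewrite subr_eq0 => /eqP.
- move=> y; split=> [|[x ->]].
    apply: (lspan_min (S := fun y => exists x, y = hw_map *m x)) => [|_ [k ->]].
      split=> [|a _ _ [x ->] [x' ->]]; first by exists 0; rewrite mulmx0.
      by exists (a *: x + x'); rewrite mulmxDr -scalemxAr.
    exists (hw_fact k *: dv k).
    by rewrite -scalemxAr hw_mapE scalerA mulfV ?hw_fact_neq0 // scale1r.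
  rewrite (dv_sum x) mulmx_sumr; apply: (subspace_sum (subspace_lspan _)) => k _ _.
  rewrite -scalemxAr hw_mapE scalerA; apply: (subspaceZ _ (subspace_lspan _)).
  by apply: lspan_gen; exists k.
by split; [exact: hw_map_E | exact: hw_map_F | exact: hw_map_K].
Qed.

End Simple.

Lemma submod_iso_eq M S S' N : (forall y, S y <-> S' y) ->
  submod_iso (q := q) M S N -> submod_iso M S' N.
Proof.
move=> e [f [f1 f2 f3]]; exists f; split=> // y.
by rewrite -e.
Qed.

Lemma submod_iso_zero M S : (forall y, S y <-> y = 0) -> submod_iso M S (zero_mod q).
Proof.
move=> S0; exists 0; split.
- by move=> x y _; exact: etrans (flatmx0 (x : 'cV_0)) (esym (flatmx0 (y : 'cV_0))).
- move=> y; rewrite S0; split=> [->|[x ->]]; first by exists 0; rewrite mulmx0.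
  by rewrite mul0mx.
by split=> *; rewrite !mul0mx !mulmx0.
Qed.

Lemma submod_iso_dsum M S1 S2 N1 N2 :
  (forall y, S1 y -> S2 y -> y = 0) ->
  submod_iso (q := q) M S1 N1 -> submod_iso M S2 N2 ->
  submod_iso M (fun y => exists y1 y2, [/\ S1 y1, S2 y2 & y = y1 + y2]) (dsum N1 N2).
Proof.
move=> dj [f [f1 f2 [fE fF fK]]] [g [g1 g2 [gE gF gK]]].
exists (row_mx f g); split.
- move=> x y /eqP; rewrite -subr_eq0 -mulmxBr -[x - y]vsubmxK mul_row_col.
  rewrite addr_eq0 => /eqP e.
  have fz : f *m usubmx (x - y) = 0.
    apply: dj; first by apply/f2; exists (usubmx (x - y)).
    by apply/g2; exists (- dsubmx (x - y)); rewrite mulmxN.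
  have gz : g *m dsubmx (x - y) = 0 by apply/eqP; rewrite -oppr_eq0 -e fz.
  have u0 : usubmx (x - y) = 0 by apply: f1; rewrite fz mulmx0.
  have d0 : dsubmx (x - y) = 0 by apply: g1; rewrite gz mulmx0.
  by apply/eqP; rewrite -subr_eq0 -[x - y]vsubmxK u0 d0 col_mx0.
- move=> y; split=> [[y1 [y2 [/f2[x1 ->] /g2[x2 ->] ->]]]|[x ->]].
    by exists (col_mx x1 x2); rewrite mul_row_col.
  exists (f *m usubmx x), (g *m dsubmx x); split.
  + by apply/f2; exists (usubmx x).
  + by apply/g2; exists (dsubmx x).
  by rewrite -[x in LHS]vsubmxK mul_row_col.
by split=> [||lam]; rewrite /= mul_row_block mul_mx_row !mulmx0 addr0 add0r
  ?fE ?fF ?fK ?gE ?gF ?gK.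
Qed.

Section Big.
Variables (M : uqmod q) (lam : nat -> weight) (sv : nat -> 'cV[K]_(udim M)) (P : pred nat).
Hypothesis oM : in_Of M.
Hypothesis hsv : forall i, P i ->
  [/\ (lam i).2 <= (lam i).1, weight_vector M (lam i) (sv i),
      actE M *m sv i = 0 & sv i != 0].
Hypothesis lamI : forall i j, P i -> P j -> wd (lam i) = wd (lam j) -> i = j.

Definition hw_family (r : seq nat) := lspan (fun y => exists i k,
  [/\ i \in r, P i & y = actF M ^+ k *m sv i]).

Lemma submod_iso_big (r : seq nat) : uniq r -> submod_iso M (hw_family r)
  (\big[@dsum K q/zero_mod q]_(i <- r | P i) simple_mod q_neq0 (lam i)).
Proof.
elim: r => [_|i r IH /andP[ir ur]].
  rewrite big_nil; apply: submod_iso_zero => y; split=> [|->]; last exact: (subspace_lspan _).1.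
  apply: (lspan_min (S := fun y => y = 0)) => [|_ [i [k []]]] //.
  by split=> [//|a _ _ -> ->]; rewrite scaler0 addr0.
rewrite big_cons; case: ifP => [Pi|nPi]; last first.
  apply: submod_iso_eq (IH ur) => y.
  split; apply: (lspan_min (subspace_lspan _)) => _ [j [k [jr Pj ->]]]; apply: lspan_gen.
    by exists j, k; rewrite inE jr orbT.
  exists j, k; split=> //; move: jr; rewrite inE => /orP[/eqP ji|//].
  by rewrite -ji Pj in nPi.
have [d1 d2 d3 d4] := hsv Pi.
pose S1 := lspan (fun y => exists k, y = actF M ^+ k *m sv i).
have dj y : S1 y -> hw_family r y -> y = 0.
  move=> h1 h2.
  (* The Casimir values of the other strings. The projector [e] fixes the string of [sv i] and kills
     all of these, since [lamI] keeps the values apart; so the sum is direct. *)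
  pose nd := [seq cval q (wd (lam j)) | j <- r & P j].
  pose e := speci (cas M) nd (cval q (wd (lam i))).
  have <- : e *m y = y.
    move: h1; apply: (lspan_min (S := fun y => e *m y = y)) => [|_ [k ->]].
      split=> [|a u u' eu eu']; first by rewrite mulmx0.
      by rewrite mulmxDr -scalemxAr eu eu'.
    by apply: speci_id; apply: (cas_hw q_neq0 q_free d2 d3).
  move: h2; apply: (lspan_min (subspace_ker _)) => _ [j [k [jr Pj ->]]].
  have [j1 j2 j3 j4] := hsv Pj.
  apply: speci_0 (cas_hw q_neq0 q_free j2 j3 k).
    by apply/mapP; exists j; rewrite // mem_filter Pj.
  apply/eqP => /(cval_inj q_neq0 q_free) ee.
  have ji : j = i by apply: lamI => //; apply: ee; rewrite /wd; lia.
  by rewrite -ji jr in ir.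
have := submod_iso_dsum dj (submod_iso_simple oM d1 d2 d3 d4) (IH ur).
apply: submod_iso_eq => y; split=> [[y1 [y2 [h1 h2 ->]]]|].
  apply: (subspaceD (subspace_lspan _)).
    move: h1; apply: (lspan_min (subspace_lspan _)) => _ [k ->].
    by apply: lspan_gen; exists i, k; rewrite mem_head.
  move: h2; apply: (lspan_min (subspace_lspan _)) => _ [j [k [jr Pj ->]]].
  by apply: lspan_gen; exists j, k; rewrite inE jr orbT.
apply: (lspan_min (S := fun y => exists y1 y2, [/\ S1 y1, hw_family r y2 & y = y1 + y2])).
  split=> [|a _ _ [y1 [y2 [h1 h2 ->]]] [z1 [z2 [g1 g2 ->]]]].
    by exists 0, 0; rewrite addr0; split=> //; apply: (subspace_lspan _).1.
  exists (a *: y1 + z1), (a *: y2 + z2); split.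
  - exact: (subspace_lspan _).2.
  - exact: (subspace_lspan _).2.
  by rewrite scalerDr addrACA.
move=> _ [j [k [jr Pj ->]]]; move: jr; rewrite inE => /orP[/eqP ji|jr].
  exists (actF M ^+ k *m sv j), 0; rewrite addr0; split=> //.
    by apply: lspan_gen; exists k; rewrite ji.
  exact: (subspace_lspan _).1.
exists 0, (actF M ^+ k *m sv j); rewrite add0r; split=> //.
  exact: (subspace_lspan _).1.
by apply: lspan_gen; exists j, k.
Qed.

End Big.

Variable l : nat.
Local Notation V := (simple_mod q_neq0 (l%:Z, 0)).
Local Notation W := (tens (tens V V) V).
Local Notation n := (udim V).
Local Notation wt3 := (wt3 l).

(** The eigenvalue q^m of K_(0,1) separates the weights of V (x) V (x) V. The spectral projectors
    are polynomials in this operator and so preserve the cube. *)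
Lemma cube_weights (p : bool) (y : 'cV[K]_(n * n * n)) : cube p y ->
  lspan (fun z => cube (l := l) (q_neq0 := q_neq0) p z /\
    exists m : nat, weight_vector W (wt3 m%:Z) z) y.
Proof.
pose A := actK W (0, 1).
pose r := [seq q ^ (m%:Z) | m <- iota 0 (l * 3).+1].
have eA m z : weight_vector W (wt3 m%:Z) z -> A *m z = q ^ (m%:Z) *: z.
  by move=> wz; rewrite wz; congr (q ^ _ *: _); rewrite /wip /=; lia.
have gen z : lspan (fun x => exists2 m : nat, (m <= l * 3)%N & weight_vector W (wt3 m%:Z) x) z.
  move: (@oVVV K q q_neq0 l z); apply: (lspan_min (subspace_lspan _)) => x [mu wx].
  have [->|x0] := eqVneq x 0; first exact: (subspace_lspan _).1.
  by have [m em ml] := weight_wt3 q_free wx x0; apply: lspan_gen; exists m; rewrite -?em.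
have dA : diagz A r.
  split.
    rewrite map_inj_uniq ?iota_uniq // => i j /(qzI q_neq0 q_free); lia.
  move=> z; move: (gen z); apply: (lspan_min (subspace_lspan _)) => x [m ml wx].
  apply: lspan_gen; exists (q ^ m%:Z); last exact: eA.
  by apply/mapP; exists m; rewrite // mem_iota.
move=> cy; rewrite -(sum_speci y dA).
apply: (subspace_sum (subspace_lspan _)) => a /mapP[m]; rewrite mem_iota => ml -> _.
apply: lspan_gen; split.
  exact: (speci_stable r _ (subspace_cube q_neq0 l p) (@cube_K _ q q_neq0 l p (0, 1)) cy).
exists m; move: (gen y); apply: (lspan_min (S := fun y => weight_vector W (wt3 m%:Z)
    (speci A r (q ^ m%:Z) *m y))) => [|x [i il wx]].
  have sW := @subspace_weight K q W (wt3 m%:Z).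
  split=> [|c u u' hu hu']; first by rewrite mulmx0; apply: sW.1.
  by rewrite mulmxDr -scalemxAr; apply: sW.2.
have [im|im] := eqVneq i m; first by rewrite -im (speci_id _ (eA _ _ wx)).
rewrite (speci_0 _ _ (eA _ _ wx)); first exact: weight_vector0.
  by apply/mapP; exists i; rewrite // mem_iota.
by apply/eqP => /(qzI q_neq0 q_free) h; move/eqP: im; apply; lia.
Qed.

End Assembly.

(** * Multiplicities and decomposition of the cubes *)

Section Main.
Variables (C : fieldType) (l : nat).
Local Notation q := (qvar C).
Local Notation q0 := (qvar_neq0 C).
Let qf : forall n, (0 < n)%N -> q ^+ n != 1 := @qvar_free C.
Local Notation V := (simple_mod q0 (l%:Z, 0)).
Local Notation n := (udim V).
Local Notation W := (tens (tens V V) V).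

(* V_(3l - m, m) is a constituent of the p-cube. *)
Definition good (p : bool) (m : nat) :=
  [&& (m.*2 <= l * 3)%N, ~~ odd (minn l m) & odd (m - l) == p].

Lemma good_dec m : (m.*2 <= l * 3)%N ->
  [/\ l = (minn l m + (l - m))%N, m = (minn l m + (m - l))%N,
    ((m - l)%N == 0%N) || ((l - m)%N == 0%N) & ((m - l).*2 <= minn l m)%N].
Proof. by move=> h; split; lia. Qed.

(** The multiplicity is one or zero, with [s] = 0 as a dummy value in the second case. For
    uniqueness, subtract from x the multiple of [s] with the same coordinate at j = t - s;
    [cube_inj] kills the difference. The coordinate of [s] is nonzero by the same lemma. *)
Lemma cube_hw (p : bool) (m : nat) : exists s : 'cV[Cq C]_(n * n * n),
  (good p m -> [/\ s != 0, hw3 (l := l) m%:Z s & cube (l := l) p s]) /\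
  forall x, (m.*2 <= l * 3)%N -> hw3 (l := l) m%:Z x -> cube (l := l) p x ->
    x = 0 \/ good p m /\ exists a, x = a *: s.
Proof.
have [ml|ml] := leqP m.*2 (l * 3); last first.
  by exists 0; split=> [/andP[h _]|x h]; exfalso; lia.
have [e1 e2 e3 e4] := good_dec ml.
have inj := @cube_inj C l m _ _ _ e1 e2 e3 e4.
have [g|g] := boolP (good p m); last first.
  exists 0; split=> // x _ hx cx; left; apply: (inj p x hx cx).
  move: g; rewrite /good ml /= negb_and negbK => /orP[h|/eqP h]; first by left.
  by right; left.
have /and3P[_ gt /eqP gp] := g.
have ex (j : nat) : exists y : 'cV[Cq C]_(n * n * n),
    (m - l <= j)%N -> (j + (m - l) <= minn l m)%N ->
    [/\ hw3 (l := l) m%:Z y, isoc (l := l) j y = y &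
        cf2 (l := l) j%:Z (m%:Z - j%:Z) (fstc (l := l) y) = 1].
  have [sj|sj] := leqP (m - l) j; last by exists 0 => h; exfalso; lia.
  have [jt|jt] := leqP (j + (m - l)) (minn l m); last by exists 0 => _ h; exfalso; lia.
  have [y hy] := isoc_exists q0 qf e1 e2 e3 e4 sj jt.
  by exists y.
have [xx hxx] := choice ex.
have [s s0 [hs cs]] := cube_exists qf e1 e2 e3 e4 hxx gt gp.
exists s; split=> // x _ hx cx; right; split=> //.
pose ld := lead m (minn l m - (m - l)) : 'cV[Cq C]_(n * n * n) -> Cq C.
have ls : ld s != 0.
  by apply/eqP => h; move/eqP: s0; apply; apply: (inj p s hs cs); right; right.
exists (ld x / ld s); apply/eqP; rewrite -subr_eq0; apply/eqP.
have sW := @subspace_weight _ q W (wt3 l m%:Z).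
apply: (inj p).
- split; first by apply: (subspaceB sW hx.1 (subspaceZ _ sW hs.1)).
  by rewrite mulmxBr -scalemxAr hx.2 hs.2 scaler0 subrr.
- have sC := subspace_cube q0 l p.
  by apply: (subspaceB sC cx (subspaceZ _ sC cs)).
right; right; rewrite addrC -scaleNr leadD -/(ld s) -/(ld x) mulNr.
by rewrite divfK // addNr.
Qed.

(** [mi] lists the good weights by a summation index as in the final statement. Its injectivity
    keeps the Casimir values apart; since every good weight is reached, the strings exhaust the
    cube, which is spanned by the F-strings of its highest weight vectors. *)
Lemma cube_iso (p : bool) (P : pred nat) (mi : nat -> nat) :
  {in P &, injective mi} -> (forall i, P i -> good p (mi i)) ->
  (forall m, good p m -> exists i, [/\ (i < l.+1)%N, P i & mi i = m]) ->
  submod_iso W (cube (l := l) (q_neq0 := q0) p)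
    (\big[@dsum _ q/zero_mod q]_(0 <= i < l.+1 | P i) simple_mod q0 (wt3 l (mi i)%:Z)).
Proof.
move=> miI Pg gP.
have [sv hsv] := choice (cube_hw p).
have oW := @oVVV _ q q0 l.
have hs i : P i -> [/\ (wt3 l (mi i)%:Z).2 <= (wt3 l (mi i)%:Z).1,
    weight_vector W (wt3 l (mi i)%:Z) (sv (mi i)), actE W *m sv (mi i) = 0 & sv (mi i) != 0].
  move=> Pi; have g := Pg i Pi; have [s0 [ws Es] _] := (hsv (mi i)).1 g; split=> //.
  by have /and3P[h _ _] := g; rewrite /=; lia.
have := submod_iso_big q0 qf oW hs.
move=> /(_ _ (index_iota 0 l.+1) (iota_uniq _ _)) h.
apply: (submod_iso_eq _ (h _)); last first.
  move=> i j Pi Pj e; apply: miI => //.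
  by move: e; rewrite /wd /=; lia.
have sC := subspace_cube q0 l p.
move=> y; split.
  apply: (lspan_min sC) => _ [i [k [_ Pi ->]]].
  apply: mstable_exp; first exact: cube_F.
  by have [_ _ ] := (hsv (mi i)).1 (Pg i Pi).
move=> cy; move: (cube_weights qf cy); apply: (lspan_min (subspace_lspan _)).
move=> z [cz [m wz]].
have := @hw_spanP (Cq C) q q0 qf W _ _ _ sC (@cube_E _ q q0 qf l p) (@cube_F _ q q0 qf l p) oW cz wz.
apply: (lspan_min (subspace_lspan _)) => _ [k [mu [v [[cv wv Ev] ->]]]].
have [->|v0] := eqVneq v 0; first by rewrite mulmx0; apply: (subspace_lspan _).1.
have [m' em _] := weight_wt3 qf wv v0.
have d0 := hw_ge0 q0 qf wv Ev oW v0.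
rewrite em in wv d0.
have m'l : (m'.*2 <= l * 3)%N by move: d0; rewrite /wd /=; lia.
have [v00|[g [a ->]]] := (hsv m').2 v m'l (conj wv Ev) cv; first by rewrite v00 eqxx in v0.
have [i [il Pi ei]] := gP m' g.
rewrite -scalemxAr; apply: (subspaceZ _ (subspace_lspan _)); apply: lspan_gen.
by exists i, k; rewrite mem_index_iota ei; split.
Qed.

End Main.

Lemma Cq_char2 (R : realType) : (2%:R : Cq R[i]) != 0.
Proof.
have -> : (2%:R : Cq R[i]) = tofrac ((2%:R : R[i])%:P) by rewrite !rmorph_nat.
by rewrite tofrac_eq0 polyC_eq0 pnatr_eq0.
Qed.

(** * The braided cubes as intersections of kernels *)

Section Cubes.
Variables (K : fieldType) (q : K).
Hypothesis q_neq0 : q != 0.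
Hypothesis q_free : forall n, (0 < n)%N -> q ^+ n != 1.
Hypothesis char2 : (2%:R : K) != 0.
Variables (Ru : universal_R q) (l : nat).
Local Notation V := (simple_mod q_neq0 (l%:Z, 0)).

Lemma S2P x : S2 Ru V x <-> proj_odd q_neq0 l false *m x = 0.
Proof.
rewrite -(sq2P q_free Ru char2); split;
  by apply: (lspan_min (subspace_lspan _)) => y [z e]; apply: lspan_gen; exists z;
     rewrite e expr0 mul1r.
Qed.

Lemma L2P x : L2 Ru V x <-> proj_odd q_neq0 l true *m x = 0.
Proof.
rewrite -(sq2P q_free Ru char2); split;
  by apply: (lspan_min (subspace_lspan _)) => y [z e]; apply: lspan_gen; exists z;
     rewrite e expr1 mulN1r.
Qed.

Lemma S3P x : cube (l := l) (q_neq0 := q_neq0) false x <-> S3 Ru V x.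
Proof.
split=> -[h1 h2]; split.
- exact/(tens_sub_kerP S2P).
- exact/(tens_sub_kerPr S2P).
- exact/(tens_sub_kerP S2P).
exact/(tens_sub_kerPr S2P).
Qed.

Lemma L3P x : cube (l := l) (q_neq0 := q_neq0) true x <-> L3 Ru V x.
Proof.
split=> -[h1 h2]; split.
- exact/(tens_sub_kerP L2P).
- exact/(tens_sub_kerPr L2P).
- exact/(tens_sub_kerP L2P).
exact/(tens_sub_kerPr L2P).
Qed.

End Cubes.

Theorem theorem2p35 (R : realType) (Ru : universal_R (qvar R[i])) (l : nat) :
  submod_iso (tens3 (Vsimple R[i] l%:Z 0)) (S3 Ru (Vsimple R[i] l%:Z 0))
    (if odd l then
       \big[@dsum _ _/zero_mod _]_(0 <= i < l.+1 | (2 * i <= l - 1)%N)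
          Vsimple R[i] (3 * l%:Z - 2 * i%:Z) (2 * i%:Z)
     else
       \big[@dsum _ _/zero_mod _]_(0 <= i < l.+1 | (4 * i <= 3 * l)%N)
          Vsimple R[i] (3 * l%:Z - 2 * i%:Z) (2 * i%:Z))
  /\
  submod_iso (tens3 (Vsimple R[i] l%:Z 0)) (L3 Ru (Vsimple R[i] l%:Z 0))
    (if odd l then
       zero_mod _
     else
       \big[@dsum _ _/zero_mod _]_(0 <= i < l.+1 |
                                  (l <= 2 * i)%N && (4 * i + 2 <= 3 * l)%N)
          Vsimple R[i] (3 * l%:Z - 2 * i%:Z - 1) (2 * i%:Z + 1)).
Proof.
have S3E := S3P (@qvar_free R[i]) (Cq_char2 R) Ru (l := l) (q_neq0 := qvar_neq0 R[i]).
have L3E := L3P (@qvar_free R[i]) (Cq_char2 R) Ru (l := l) (q_neq0 := qvar_neq0 R[i]).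
have VE a b m : a = 3 * l%:Z - m%:Z -> b = m%:Z ->
    Vsimple R[i] a b = simple_mod (qvar_neq0 R[i]) (wt3 l m%:Z).
  by move=> -> ->; rewrite /Vsimple; congr (simple_mod _ (_, _)); lia.
have iso p := @cube_iso R[i] l p.
split.
  have VEi i : Vsimple R[i] (3 * l%:Z - 2 * i%:Z) (2 * i%:Z) =
      simple_mod (qvar_neq0 R[i]) (wt3 l (i.*2)%:Z) by apply: VE; lia.
  refine (@submod_iso_eq _ _ (tens3 (Vsimple R[i] l%:Z 0)) _ _ _ S3E _).
  (* For odd l an even [minn l m] forces m < l, and the good m are the even ones below l. For even l
     they are all even m with 2m <= 3l. *)
  case: ifP => ol; under eq_bigr => i _ do rewrite VEi;
    apply: (iso false _ double) => [i j _ _|i|m];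
    rewrite /good ?unfold_in; try lia;
    by move=> /and3P[h1 h2 /eqP h3]; exists m./2; split; rewrite ?unfold_in; lia.
refine (@submod_iso_eq _ _ (tens3 (Vsimple R[i] l%:Z 0)) _ _ _ L3E _).
case: ifP => ol.
  (* No m is good: an even [minn l m] forces m < l, and then the truncated difference [m - l] is 0,
     which is not odd. *)
  have := iso true pred0 id; rewrite big_pred0_eq; apply=> // m.
  by rewrite /good => /and3P[h1 h2 /eqP h3]; exfalso; lia.
(* For even l the good m are the odd ones above l with 2m <= 3l, written m = 2i + 1. *)
have VEi i : Vsimple R[i] (3 * l%:Z - 2 * i%:Z - 1) (2 * i%:Z + 1) =
    simple_mod (qvar_neq0 R[i]) (wt3 l (i.*2.+1)%:Z) by apply: VE; lia.
under eq_bigr => i _ do rewrite VEi.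
apply: (iso true _ (fun i => i.*2.+1)) => [i j _ _|i|m];
  rewrite /good ?unfold_in; try lia.
by move=> /and3P[h1 h2 /eqP h3]; exists m./2; split; rewrite ?unfold_in; lia.
Qed.
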